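(* Let $P$ be a probability distribution on $\mathbb{R}^d$ which has bounded support and is absolutely continuous with respect to Lebesgue measure. Let $X_1,X_2,\ldots$ be i.i.d. with distribution $P$, let $\hat{\mathcal J}_n=\hat{\mathcal J}(X_1,\ldots,X_n)$ be a MAP partition of $[n]$, and let $\hat{\mathcal A}_n$ be the family of the convex hulls of the clusters of observations in $\hat{\mathcal J}_n$, i.e. $\hat{\mathcal A}_n=\{\mathrm{conv}\{X_j: j\in J\}: J\in\hat{\mathcal J}_n\}$. Let $\mathbf{M}_\Delta$ be the set of finite $P$-partitions that maximise the function $\Delta$ (among finite $P$-partitions). Then $\mathbf{M}_\Delta\neq\emptyset$ and almost surely $$\inf_{\mathcal M\in\mathbf{M}_\Delta}\overline{d_P}(\hat{\mathcal A}_n,\mathcal M)\to 0\qquad(n\to\infty).$$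
   Context: Fix $d\ge 1$, $\alpha>0$ and symmetric positive definite matrices $T,\Sigma\in\mathbb{R}^{d\times d}$. Put $C=\alpha/\sqrt{\det T}$, $R=\Sigma^{-1/2}$ and $R_m=(\Sigma^{-1}+T^{-1}/m)^{1/2}$ for $m\in\mathbb{N}$ (symmetric positive definite square roots); $\|\cdot\|$ is the Euclidean norm and $[n]=\{1,\ldots,n\}$. For $\mathbf{x}=(x_1,\ldots,x_n)\in(\mathbb{R}^d)^n$, nonempty $J\subseteq[n]$, let $\overline{\mathbf{x}_J}=\frac1{|J|}\sum_{j\in J}x_j$. For a partition $\mathcal J$ of $[n]$ into nonempty sets (clusters) let $$Q_{\mathbf{x}}(\mathcal J)=C^{|\mathcal J|}\prod_{J\in\mathcal J}\frac{|J|!}{|J|^{(d+2)/2}\det R_{|J|}}\cdot\exp\Big\{\frac12\sum_{J\in\mathcal J}|J|\cdot\big\|R_{|J|}^{-1}R^2\,\overline{\mathbf{x}_J}\big\|^2\Big\}.$$ Up to a factor not depending on $\mathcal J$, this is the posterior probability of $\mathcal J$ given $\mathbf{x}$ in the Gaussian mixture model in which $\mathcal J$ follows the Chinese Restaurant Process with parameter $\alpha$, cluster means are i.i.d. $\mathcal N(0,T)$, and given its cluster mean $\theta$ each observation of a cluster is independently $\mathcal N(\theta,\Sigma)$. A MAP (maximal a posteriori) partition $\hat{\mathcal J}(x_1,\ldots,x_n)$ is any partition of $[n]$ maximising $Q_{\mathbf{x}}$. Let $X\sim P$. A family $\mathcal A$ of measurable sets is a $P$-partition if $P(\bigcup_{A\in\mathcal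 A}A)=1$ and $P(A\cap B)=0$ for all $A,B\in\mathcal A$, $A\ne B$. For a finite family $\mathcal G$ of measurable subsets of $\mathbb{R}^d$, $$\Delta(\mathcal G)=\frac12\sum_{G\in\mathcal G}P(G)\,\big\|R\,\mathbb{E}(X\mid X\in G)\big\|^2+\sum_{G\in\mathcal G}P(G)\ln P(G),$$ where sets with $P(G)=0$ contribute $0$. The symmetric difference pseudometric is $d_P(A,B)=P\big((A\setminus B)\cup(B\setminus A)\big)$. For finite families $\mathcal A=\{A^{(1)},\ldots,A^{(k)}\}$ and $\mathcal B=\{B^{(1)},\ldots,B^{(l)}\}$ of measurable sets, $\overline{d_P}(\mathcal A,\mathcal B)=\min_{\sigma}\max_{i\le K}d_P(A^{(i)},B^{(\sigma(i))})$, where $K=\max\{k,l\}$, $\sigma$ ranges over permutations of $[K]$, and $A^{(i)}=\emptyset$ for $i>k$, $B^{(j)}=\emptyset$ for $j>l$. *)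

(* Defs.v *)
From HB Require Import structures.
From mathcomp Require Import all_boot all_order all_algebra finmap.
From mathcomp Require Import perm lra.
From mathcomp Require Import all_classical all_reals all_analysis.

Set Implicit Arguments.
Unset Strict Implicit.
Unset Printing Implicit Defensive.
Import Order.TTheory GRing.Theory Num.Theory numFieldNormedType.Exports.
Local Open Scope classical_set_scope.
Local Open Scope ring_scope.

Definition measure_mx_display : measure_display.
Proof. exact: default_measure_display. Qed.

(* Matrices, hence the column vectors representing R^d, carry the Borel
   sigma-algebra. *)
Section borel_mx.
Variables (R : realType) (m n : nat).

Let mx_set0 : <<s @open 'M[R]_(m, n) >> set0.
Proof. exact: sigma_algebra0. Qed.

Let mx_setC A : <<s @open 'M[R]_(m, n) >> A -> <<s @open 'M[R]_(m, n) >> (~` A).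
Proof. exact: sigma_algebraC. Qed.

Let mx_bigcup (F : (set 'M[R]_(m, n))^nat) :
  (forall i, <<s @open 'M[R]_(m, n) >> (F i)) ->
  <<s @open 'M[R]_(m, n) >> (\bigcup_i (F i)).
Proof. exact: sigma_algebra_bigcup. Qed.

HB.instance Definition _ := @isMeasurable.Build measure_mx_display
  'M[R]_(m, n) <<s @open 'M[R]_(m, n) >> mx_set0 mx_setC mx_bigcup.

End borel_mx.

(* R with the display under which the library equips lebesgue_measure with its
   measure instance. *)
Local Notation mR R := (measurableTypeR R).

Section lebesgue_cons.
Variables (R : realType) (n : nat).
Variable mu : {sigma_finite_measure set (n.-tuple (mR R)) -> \bar R}.

Definition tuple_cons (p : mR R * n.-tuple (mR R)) : n.+1.-tuple (mR R) :=
  [the n.+1.-tuple _ of p.1 :: p.2].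

Lemma measurable_tuple_cons : measurable_fun [set: _] tuple_cons.
Proof. by apply: measurable_cons; [exact: measurable_fst|exact: measurable_snd]. Qed.

Definition lebesgue_cons : set (n.+1.-tuple (mR R)) -> \bar R :=
  pushforward (@lebesgue_measure R \x mu)%E tuple_cons.

Let lebesgue_cons0 : lebesgue_cons set0 = 0%E.
Proof. by rewrite /lebesgue_cons /pushforward preimage_set0 measure0. Qed.

Let lebesgue_cons_ge0 A : (0 <= lebesgue_cons A)%E.
Proof. exact: (measure_ge0 (@lebesgue_measure R \x mu)%E). Qed.

Let lebesgue_cons_sigma_additive : semi_sigma_additive lebesgue_cons.
Proof.
apply: measure_semi_sigma_additive; exact: measurable_tuple_cons.
Qed.

HB.instance Definition _ := isMeasure.Build _ _ _ lebesgue_cons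
  lebesgue_cons0 lebesgue_cons_ge0 lebesgue_cons_sigma_additive.

Let lebesgue_cons_sigma_finite : sigma_finite [set: _] lebesgue_cons.
Proof.
have /sigma_finiteP[F [FT ndF Foo]] := sigma_finiteT (@lebesgue_measure R).
have /sigma_finiteP[G [GT ndG Goo]] := sigma_finiteT mu.
pose g (t : n.+1.-tuple (mR R)) : mR R * n.-tuple (mR R) :=
  (thead t, [tuple of behead t]).
have mg : measurable_fun [set: _] g.
  apply/measurable_fun_pairP; split; first exact: measurable_tnth.
  exact: measurable_behead.
have gK : g \o tuple_cons = id.
  by apply/funext => -[x t]; rewrite /g /tuple_cons/=; congr pair; exact: val_inj.
exists (fun k => g @^-1` (F k `*` G k)).
  rewrite -preimage_bigcup; apply/esym; rewrite -subTset => t _ /=.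
  have [i _ Fi] : (\bigcup_i F i) (thead t) by rewrite -FT.
  have [j _ Gj] : (\bigcup_i G i) [tuple of behead t] by rewrite -GT.
  exists (maxn i j) => //; split => /=.
    by move: Fi; exact/subsetPset/ndF/leq_maxl.
  by move: Gj; exact/subsetPset/ndG/leq_maxr.
move=> k; have [mFk Fkoo] := Foo k; have [mGk Gkoo] := Goo k; split.
  by rewrite -[X in measurable X]setTI; apply: mg => //; exact: measurableX.
rewrite /lebesgue_cons /pushforward -comp_preimage gK preimage_id.
by rewrite product_measure1E// lte_mul_pinfty// ge0_fin_numE.
Qed.

HB.instance Definition _ := Measure_isSigmaFinite.Build _ _ _ lebesgue_cons
  lebesgue_cons_sigma_finite.

End lebesgue_cons.

Fixpoint lebesgue_tuple (R : realType) (n : nat) :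
    {sigma_finite_measure set (n.-tuple (mR R)) -> \bar R} :=
  if n is n'.+1 then lebesgue_cons (lebesgue_tuple R n')
  else @dirac _ _ [tuple] R.

Section lebesgue_vector.
Variables (R : realType) (d : nat).

Definition col_of_tuple (t : d.-tuple (mR R)) : 'cV[R]_d := \col_i tnth t i.

Lemma measurable_col_of_tuple : measurable_fun [set: _] col_of_tuple.
Proof.
pose rb (q : 'cV[rat]_d * rat) : set 'cV[R]_d :=
  ball (\col_i ratr (q.1 i 0) : 'cV[R]_d) (ratr q.2).
have mrb q : measurable (col_of_tuple @^-1` rb q).
  have [q0|q0] := leP (ratr q.2 : R) 0.
    rewrite (_ : _ @^-1` _ = set0)//; apply/seteqP; split => // t /= [].
    by rewrite ltNge q0.
  rewrite (_ : _ @^-1` _ = \bigcap_(i in [set: 'I_d])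
     ((@tnth d (mR R))^~ i @^-1` ball (ratr (q.1 i 0) : R) (ratr q.2)));
     last first.
    apply/seteqP; split => t /=.
      by move=> [_ h] i _ /=; have := h i 0; rewrite !mxE.
    by move=> h; split => // i j; rewrite ord1 !mxE; exact: h.
  apply: fin_bigcap_measurable => // i _.
  rewrite -[X in measurable X]setTI; apply: measurable_tnth => //.
  by rewrite ball_itv; exact: measurable_itv.
have mopen (U : set 'cV[R]_d) : open U -> measurable (col_of_tuple @^-1` U).
  move=> oU.
  rewrite (_ : U = \bigcup_(q in [set q | rb q `<=` U]) rb q); last first.
    apply/seteqP; split => [x Ux|x [q /= qU]]; last exact: qU.
    have /nbhs_ballP[e /= e0 eU] : nbhs x U by exact: open_nbhs_nbhs.
    have [r] := rat_in_itvoo (divr_gt0 e0 (ltr0n R 2)).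
    rewrite in_itv/= => /andP[r0 re].
    have /choice[c cP] : forall i : 'I_d, exists q : rat,
        `|x i 0 - ratr q| < ratr r.
      move=> i; have [|q] := @rat_in_itvoo R (x i 0 - ratr r) (x i 0); first by lra.
      rewrite in_itv/= => /andP[q1 q2].
      by exists q; rewrite gtr0_norm; lra.
    exists (\col_i c i, r) => /=.
      move=> y [_ ry]; apply: eU; split => // i j; rewrite ord1.
      have := ry i 0; rewrite !mxE /ball/= => ryi.
      have -> : x i 0 - y i 0 = (x i 0 - ratr (c i)) + (ratr (c i) - y i 0) by lra.
      by rewrite (le_lt_trans (ler_normD _ _))//; have := cP i; lra.
    split => // i j; rewrite ord1 !mxE /ball/= distrC; exact: cP.
  rewrite preimage_bigcup bigcup_mkcond.
  apply: countable_bigcupT_measurable; first exact: countableP.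
  by move=> q; case: ifPn => // _; exact: mrb.
apply: (measurability _ (erefl : @measurable _ 'cV[R]_d = <<s @open 'cV[R]_d >>)).
move=> _ [U oU <-].
by rewrite setTI; exact: mopen.
Qed.

Definition lebesgue_vector : set 'cV[R]_d -> \bar R :=
  pushforward (lebesgue_tuple R d) col_of_tuple.

Let lebesgue_vector0 : lebesgue_vector set0 = 0%E.
Proof. by rewrite /lebesgue_vector /pushforward preimage_set0 measure0. Qed.

Let lebesgue_vector_ge0 A : (0 <= lebesgue_vector A)%E.
Proof. exact: (measure_ge0 (lebesgue_tuple R d)). Qed.

Let lebesgue_vector_sigma_additive : semi_sigma_additive lebesgue_vector.
Proof.
apply: measure_semi_sigma_additive; exact: measurable_col_of_tuple.
Qed.

HB.instance Definition _ := isMeasure.Build _ _ _ lebesgue_vector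
  lebesgue_vector0 lebesgue_vector_ge0 lebesgue_vector_sigma_additive.

End lebesgue_vector.

Section gaussian_mixture.
Variables (R : realType) (d : nat).
Implicit Types (v : 'cV[R]_d) (T Sigma : 'M[R]_d).

Definition enorm v : R := Num.sqrt (\sum_i v i 0 ^+ 2).

Definition posdefmx (A : 'M[R]_d) : Prop :=
  A^T = A /\ forall v, v != 0 -> 0 < (v^T *m A *m v) 0 0.

(* The symmetric positive definite square root, which exists and is unique when
   A is symmetric positive definite; 0 is a junk value for the other A. *)
Definition sqrtmx (A : 'M[R]_d) : 'M[R]_d :=
  xget 0 [set B | posdefmx B /\ B *m B = A].

Definition obs_scale Sigma : 'M[R]_d := sqrtmx (invmx Sigma).

Definition cluster_scale T Sigma (m : nat) : 'M[R]_d :=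
  sqrtmx (invmx Sigma + m%:R^-1 *: invmx T).

Section posterior.
Variables (alpha : R) (T Sigma : 'M[R]_d) (n : nat) (x : 'I_n -> 'cV[R]_d).

Definition cluster_mean (J : {set 'I_n}) : 'cV[R]_d :=
  #|J|%:R^-1 *: \sum_(j in J) x j.

(* Up to a factor depending only on x, the posterior probability of JJ given x
   when JJ follows the Chinese Restaurant Process with parameter alpha, cluster
   means are i.i.d. N(0, T), and the observations of a cluster with mean theta
   are i.i.d. N(theta, Sigma). *)
Definition posterior (JJ : {set {set 'I_n}}) : R :=
  let C := alpha / Num.sqrt (\det T) in
  let Rm := cluster_scale T Sigma in
  C ^+ #|JJ| *
  (\prod_(J in JJ)
     ((#|J|)`!%:R / (#|J|%:R `^ ((d + 2)%:R / 2) * \det (Rm #|J|)))) *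
  expR (2^-1 * \sum_(J in JJ) #|J|%:R *
    enorm (invmx (Rm #|J|) *m (obs_scale Sigma *m obs_scale Sigma) *m
           cluster_mean J) ^+ 2).

Definition MAP_partition (JJ : {set {set 'I_n}}) : Prop :=
  finset.partition JJ [set: 'I_n]%SET /\
  forall KK : {set {set 'I_n}}, finset.partition KK [set: 'I_n]%SET ->
    posterior KK <= posterior JJ.

Definition cluster_hulls (JJ : {set {set 'I_n}}) : set (set 'cV[R]_d) :=
  [set smallest (@convex_set R 'cV[R]_d) [set x j | j in [set` J]]
    | J in [set` JJ]].

End posterior.

Section limit.
Variable P : probability 'cV[R]_d R.

Definition msupport : set 'cV[R]_d :=
  [set x | forall U, open U -> U x -> (0 < P U)%E].

Definition P_partition (F : set (set 'cV[R]_d)) : Prop :=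
  [/\ forall A, F A -> measurable A,
      P (\bigcup_(A in F) A) = 1%E &
      forall A B, F A -> F B -> A <> B -> P (A `&` B) = 0%E].

Definition prob (A : set 'cV[R]_d) : R := fine (P A).

Definition condmean (G : set 'cV[R]_d) : 'cV[R]_d :=
  \col_i ((prob G)^-1 * \int[P]_(x in G) x i 0).

(* The sets G with P(G) = 0 contribute 0 to both sums. *)
Definition Delta Sigma (F : set (set 'cV[R]_d)) : R :=
  2^-1 * (\sum_(G \in F) prob G * enorm (obs_scale Sigma *m condmean G) ^+ 2) +
  \sum_(G \in F) prob G * ln (prob G).

Definition maximal_partitions Sigma : set (set (set 'cV[R]_d)) :=
  [set M | [/\ finite_set M, P_partition M &
     forall F, finite_set F -> P_partition F -> Delta Sigma F <= Delta Sigma M]].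

Definition dist_P (A B : set 'cV[R]_d) : R := prob ((A `\` B) `|` (B `\` A)).

(* A finite family is enumerated without repetition and padded with empty sets
   by the default value of nth. The index of \big[min/_] is the value at the
   identity permutation, so that the minimum is over 'S_K exactly. *)
Definition dbar_P (F G : set (set 'cV[R]_d)) : R :=
  let a : seq (set 'cV[R]_d) := fset_set F in
  let b : seq (set 'cV[R]_d) := fset_set G in
  let K := maxn (size a) (size b) in
  let cost (s : 'S_K) :=
    \big[Order.max/0]_(i < K) dist_P (nth set0 a i) (nth set0 b (s i)) in
  \big[Order.min/cost 1%g]_(s : 'S_K) cost s.

End limit.

End gaussian_mixture.

(* X_0, X_1, ... are mutually independent with common distribution P. *)
Definition iid_with (R : realType) (dO dV : measure_display)
    (Omega : measurableType dO) (V : measurableType dV)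
    (Pr : probability Omega R) (X : nat -> {RV Pr >-> V})
    (P : probability V R) : Prop :=
  (forall (I : {fset nat}) (A : nat -> set V), (forall i, measurable (A i)) ->
    Pr (\bigcap_(i in [set` I]) (X i @^-1` A i)) =
      (\prod_(i <- I) Pr (X i @^-1` A i))%E) /\
  (forall i (A : set V), measurable A -> distribution Pr (X i) A = P A).

(* Main.v *)
Require Import Defs.
From HB Require Import structures.
From mathcomp Require Import all_boot all_order all_algebra finmap.
From mathcomp Require Import perm spectral complex ring lra.
From mathcomp Require Import all_classical all_reals all_analysis measurable_realfun.

(** Up to terms of order [ln n], the log posterior of a partition of [n] bounded
observations into boundedly many clusters is [n * ln n - n] plus [n] times a score,
which is [Delta] with the masses and the means of cells replaced by the shares and
the means of clusters ([score_estimate]). So MAP partitions should converge to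
maximisers of [Delta]. Three properties of MAP partitions make this rigorous. Any
two clusters are separated by a hyperplane ([MAP_separated]), because at
fixed sizes the log posterior is a strictly convex function of the cluster sums, and
exchanging two observations only changes the sums. Every
cluster has at least [delta * n] observations ([MAP_cluster_size]), because a small
cluster could be merged into a large one; so the number of clusters is bounded. And
the hulls of the clusters converge.

Convergence is proved along an ultrafilter on the indices [k] of a family of samples,
whose frequencies converge on an algebra of events, so that no subsequences have to be
extracted. The normals and offsets of the separating hyperplanes then have limits. As
[P] is absolutely continuous, hyperplanes are null ([hyperplane_negligible]) and almost
every point of the support has mass in all of its [2 ^ d] corners at every scale
([full_point_ae]); both follow from the fact that a bounded set which misses its small
translates in one direction is null ([slide_null]). Around a point with these
properties, off the limit hyperplanes, all data belong to one cluster, and data in all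
corners put a neighbourhood of the point inside the hull of that cluster
([inner_ball_exists]). The rational balls that eventually lie in the hull of a cluster
make up its limit cell. The limit cells are disjoint, cover almost everything
([limit_cells_full]), and the hulls, the shares and the first moments of the clusters
converge to those of the cells ([cell_dist_cvg], [share_cvg], [clust_moment_cvg]).

A competing [P]-partition cuts every sample into clusters whose score tends to its
[Delta] ([induced_score]); optimality of the MAP partitions shows that the limit cells
do at least as well ([MAP_limit]). To compare with all partitions it is enough to have
frequencies of the cells of countably many partitions that are cofinal for [Delta]
([base_events]).

Such samples arise in two ways. Quantizing [P] on the atoms of finitely many events
gives deterministic ones ([quantization]), and the limit of their MAP partitions is a
maximiser. For i.i.d. observations the law of large numbers ([freq_cvg]) applies
almost surely to all events of the countable algebra; if the distance to the maximisers
did not tend to 0, an ultrafilter on the bad indices would contradict the limit theorem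
([MAP_cvg]). *)

Set Implicit Arguments.
Unset Strict Implicit.
Unset Printing Implicit Defensive.
Import Order.TTheory GRing.Theory Num.Theory numFieldNormedType.Exports.
Local Open Scope classical_set_scope.
Local Open Scope ring_scope.

(** * Square roots of positive definite matrices *)

Section square_roots.
Variable R : realType.

Lemma interpolation (F : fieldType) (s : seq F) (f : F -> F) :
  exists p : {poly F}, {in s, forall x, p.[x] = f x}.
Proof.
elim: s => [|a s [p pP]]; first by exists 0.
have [sa|sa] := boolP (a \in s).
  by exists p => x; rewrite inE => /predU1P[->|]; exact: pP.
pose w : {poly F} := \prod_(b <- s) ('X - b%:P).
have wa : w.[a] != 0 by rewrite -[_ == 0]/(root w a) root_prod_XsubC.
exists (p + ((f a - p.[a]) / w.[a]) *: w) => x.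
rewrite inE !hornerE => /predU1P[->|xs]; first by rewrite mulfVK// addrC subrK.
have /eqP -> : w.[x] == 0 by rewrite -[_ == 0]/(root w x) root_prod_XsubC.
by rewrite mulr0 addr0 pP.
Qed.

(** Over [R[i]] the matrix is unitarily diagonalisable with real eigenvalues, so a
polynomial in it is governed by the values of the polynomial at these
eigenvalues; both the eigenvalues and the polynomial identity descend to [R]. *)
Lemma symmetric_annihilator n (A : 'M[R]_n.+1) : A^T = A ->
  exists l : 'rV[R]_n.+1, (forall i, eigenvalue A (l 0 i)) /\
    forall q : {poly R}, (forall i, q.[l 0 i] = 0) -> horner_mx A q = 0.
Proof.
move=> symA.
pose f : {rmorphism R -> complex R} := real_complex R.
pose Ac := map_mx f A.
have hA : Ac \is hermsymmx.
  apply: realsym_hermsym.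
    apply/is_hermitianmxP; rewrite expr0 scale1r map_mx_id//.
    by rewrite /Ac map_trmx symA.
  apply/mxOverP => i j; rewrite mxE /f; apply/complex_realP; by exists (A i j).
have nA := hermitian_normalmx hA.
have /orthomx_spectralP EA := nA.
set U := spectralmx Ac in EA; set D := spectral_diag Ac in EA.
have Uu : U \in unitmx by exact: spectral_unit.
have /mxOverP Dr := hermitian_spectral_diag_real hA.
pose l : 'rV[R]_n.+1 := \row_i complex.Re (D 0 i).
have Dl : D = map_mx f l.
  apply/rowP => i; rewrite !mxE /f.
  by have := Dr 0 i; rewrite -/D => /complex_realP [x ->].
have hornA q : horner_mx Ac q = invmx U *m diag_mx (map_mx (horner q) D) *m U.
  by rewrite EA -horner_mx_diag horner_mx_uconjC.
exists l; split.
  move=> i; rewrite -(eigenvalue_map f) -/Ac.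
  rewrite (_ : f (l 0 i) = D 0 i); last by rewrite [in RHS]Dl [RHS]mxE.
  apply/eigenvalueP; exists (delta_mx 0 i *m U).
    rewrite {1}EA !mulmxA mulmxK// scalemxAl; congr (_ *m _).
    by rewrite -rowE row_diag_mx.
  apply/eqP => /(congr1 (mulmx^~ (invmx U))); rewrite mulmxK// mul0mx.
  by move=> /rowP/(_ i); rewrite !mxE !eqxx => /eqP; rewrite oner_eq0.
move=> q ql.
apply: (@map_mx_inj _ _ f); rewrite map_horner_mx hornA Dl map_mx0.
rewrite (_ : map_mx _ _ = 0); first by rewrite raddf0 mulmx0 mul0mx.
by apply/rowP => i; rewrite [LHS]mxE [X in _.[X]]mxE horner_map/= ql rmorph0 mxE.
Qed.

Lemma posdef_eigenvalue_gt0 n (A : 'M[R]_n) a :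
  posdefmx A -> eigenvalue A a -> 0 < a.
Proof.
move=> [symA posA] /eigenvalueP[v vA v0].
have v'0 : v^T != 0 by rewrite trmx_eq0.
have := posA _ v'0; rewrite trmxK vA -scalemxAl mxE.
have vv : 0 <= (v *m v^T) 0 0.
  by rewrite mxE sumr_ge0// => i _; rewrite mxE -expr2 sqr_ge0.
move=> avv; rewrite -(pmulr_lgt0 a (x := (v *m v^T) 0 0))//.
rewrite lt_neqAle vv andbT; apply: contraTneq avv => <-.
by rewrite mulr0 ltxx.
Qed.

Lemma trmx_horner n (A : 'M[R]_n.+1) p : A^T = A -> (horner_mx A p)^T = horner_mx A p.
Proof.
move=> symA; elim/poly_ind: p => [|p c IH]; first by rewrite rmorph0 trmx0.
rewrite rmorphD rmorphM/= horner_mx_X horner_mx_C linearD/= tr_scalar_mx.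
by rewrite trmx_mul IH symA; congr (_ + _); apply: comm_mx_horner.
Qed.

Lemma dot_self n (u : 'cV[R]_n) : (u^T *m u) 0 0 = \sum_i u i 0 ^+ 2.
Proof. by rewrite mxE; apply: eq_bigr => i _; rewrite mxE. Qed.

(** If [q] interpolates the fourth root on the spectrum, then [q(A)] is symmetric
and invertible, so that its square is a positive definite root of [A]. *)
Lemma posdef_sqrt n (A : 'M[R]_n) : posdefmx A ->
  exists B : 'M[R]_n, posdefmx B /\ B *m B = A.
Proof.
case: n A => [A _|n A pA].
  exists 0; split; last by rewrite [LHS]flatmx0 [RHS]flatmx0.
  by split => [|v]; [rewrite trmx0|rewrite [v]flatmx0 eqxx].
have [symA posA] := pA.
have [l [eigl annl]] := symmetric_annihilator symA.
have [q qP] := interpolation [seq l 0 i | i : 'I_n.+1] (fun x => Num.sqrt (Num.sqrt x)).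
have ql i : q.[l 0 i] = Num.sqrt (Num.sqrt (l 0 i)) by rewrite qP// map_f// mem_enum.
pose S := horner_mx A q.
have symS : S^T = S by exact: trmx_horner.
have SA : S *m S *m (S *m S) = A.
  have /annl/eqP : forall i, (q * q * (q * q) - 'X).[l 0 i] = 0; last first.
    by rewrite rmorphB !rmorphM/= horner_mx_X subr_eq0 => /eqP.
  move=> i; rewrite hornerD hornerN hornerX !hornerM ql.
  have l0 : 0 <= l 0 i by exact/ltW/(posdef_eigenvalue_gt0 pA).
  by rewrite -[X in X * _ - _]expr2 -[X in _ * X - _]expr2 sqr_sqrtr ?sqrtr_ge0// -expr2 sqr_sqrtr// subrr.
exists (S *m S); split => //; split; first by rewrite trmx_mul symS.
move=> v v0; have -> : v^T *m (S *m S) *m v = (S *m v)^T *m (S *m v).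
  by rewrite trmx_mul symS !mulmxA.
rewrite dot_self.
rewrite lt_neqAle sumr_ge0 ?andbT => [|i _]; last by rewrite sqr_ge0.
apply/eqP => /esym/eqP; rewrite psumr_eq0 => [|i _]; last by rewrite sqr_ge0.
move=> /allP Sv0; have {}Sv0 : S *m v = 0.
  apply/colP => i; have := Sv0 i (mem_index_enum _).
  by rewrite sqrf_eq0 => /eqP ->; rewrite mxE.
have := posA _ v0; rewrite -SA -mulmxA -[_ *m v]mulmxA -[_ *m v]mulmxA Sv0.
by rewrite !mulmx0 mxE ltxx.
Qed.

Lemma sqrtmxP n (A : 'M[R]_n) : posdefmx A ->
  posdefmx (sqrtmx A) /\ sqrtmx A *m sqrtmx A = A.
Proof.
by move=> /posdef_sqrt[B BP]; rewrite /sqrtmx; case: xgetP => [? _ //|/(_ B)].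
Qed.

Lemma posdef_unit n (A : 'M[R]_n) : posdefmx A -> A \in unitmx.
Proof.
move=> [symA posA]; rewrite -row_free_unit -kermx_eq0; apply/rowV0P => v /sub_kermxP vA.
apply/eqP/negPn/negP => v0.
have := posA v^T; rewrite trmx_eq0 trmxK vA mul0mx mxE ltxx => /(_ v0).
by [].
Qed.

Lemma posdef_det_gt0 n (A : 'M[R]_n) : posdefmx A -> 0 < \det A.
Proof.
move=> pA; have [_ <-] := sqrtmxP pA.
rewrite det_mulmx -expr2 exprn_even_gt0//= -unitfE -unitmxE.
by apply: posdef_unit; have [] := sqrtmxP pA.
Qed.

Lemma posdef_inv n (A : 'M[R]_n) : posdefmx A -> posdefmx (invmx A).
Proof.
move=> pA; have Au := posdef_unit pA; have [symA posA] := pA; split.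
  by rewrite trmx_inv symA.
move=> v v0; have -> : v^T *m invmx A *m v = (invmx A *m v)^T *m A *m (invmx A *m v).
  by rewrite trmx_mul trmx_inv symA !mulmxA mulmxKV.
apply: posA; apply: contra_neq v0 => Av0.
by rewrite -[v](mulKVmx Au) Av0 mulmx0.
Qed.

Lemma posdefD n (A B : 'M[R]_n) : posdefmx A -> posdefmx B -> posdefmx (A + B).
Proof.
move=> [sA pA] [sB pB]; split; first by rewrite linearD/= sA sB.
by move=> v v0; rewrite mulmxDr mulmxDl mxE addr_gt0 ?pA ?pB.
Qed.

Lemma posdefZ n (A : 'M[R]_n) a : 0 < a -> posdefmx A -> posdefmx (a *: A).
Proof.
move=> a0 [sA pA]; split; first by rewrite linearZ/= sA.
by move=> v v0; rewrite -scalemxAr -scalemxAl mxE mulr_gt0 ?pA.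
Qed.

End square_roots.

(** * The log weight of a cluster *)

Section quadratic_forms.
Variables (R : realType) (n : nat).
Implicit Types (A B : 'M[R]_n) (u v : 'cV[R]_n).

Definition bil A u v : R := (u^T *m A *m v) 0 0.

Lemma bilDl A u u' v : bil A (u + u') v = bil A u v + bil A u' v.
Proof. by rewrite /bil linearD/= !mulmxDl mxE. Qed.

Lemma bilDr A u v v' : bil A u (v + v') = bil A u v + bil A u v'.
Proof. by rewrite /bil mulmxDr mxE. Qed.

Lemma bilZl A a u v : bil A (a *: u) v = a * bil A u v.
Proof. by rewrite /bil linearZ/= -!scalemxAl mxE. Qed.

Lemma bilZr A a u v : bil A u (a *: v) = a * bil A u v.
Proof. by rewrite /bil -scalemxAr mxE. Qed.

Lemma bilNl A u v : bil A (- u) v = - bil A u v.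
Proof. by rewrite -scaleN1r bilZl mulN1r. Qed.

Lemma bilNr A u v : bil A u (- v) = - bil A u v.
Proof. by rewrite -scaleN1r bilZr mulN1r. Qed.

Lemma bilC A u v : A^T = A -> bil A u v = bil A v u.
Proof.
move=> sA; rewrite /bil; transitivity ((u^T *m A *m v)^T 0 0).
  by rewrite [RHS]mxE.
by rewrite !trmx_mul trmxK sA mulmxA.
Qed.

Lemma bilDm A B u v : bil (A + B) u v = bil A u v + bil B u v.
Proof. by rewrite /bil mulmxDr mulmxDl mxE. Qed.

Lemma bilZm A a u v : bil (a *: A) u v = a * bil A u v.
Proof. by rewrite /bil -scalemxAr -scalemxAl mxE. Qed.

Lemma bil_ge0 A v : posdefmx A -> 0 <= bil A v v.
Proof.
move=> [_ pA]; have [->|v0] := eqVneq v 0; first by rewrite /bil mulmx0 mxE.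
exact/ltW/pA.
Qed.

Definition mx_size A : R := \sum_i \sum_j `|A i j|.

Lemma mx_size_ge0 A : 0 <= mx_size A.
Proof. by apply: sumr_ge0 => i _; apply: sumr_ge0. Qed.

Lemma entry_le_norm m k (A : 'M[R]_(m, k)) i j : `|A i j| <= `|A|.
Proof.
rewrite [leRHS]/Num.Def.normr /= mx_normrE; apply/bigmax_geP; right => /=.
by exists (i, j).
Qed.

Lemma norm_le_entry m k (A : 'M[R]_(m, k)) e : 0 <= e ->
  (forall i j, `|A i j| <= e) -> `|A| <= e.
Proof.
by move=> e0 Ae; rewrite [leLHS]/Num.Def.normr /= mx_normrE; apply/bigmax_leP; split => // -[].
Qed.

Lemma normM_mx_size A v : `|A *m v| <= mx_size A * `|v|.
Proof.
apply: norm_le_entry => [|i j]; first by rewrite mulr_ge0// mx_size_ge0.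
rewrite mxE (le_trans (ler_norm_sum _ _ _))// /mx_size mulr_suml.
rewrite [leRHS](bigD1 i)//= -[leLHS]addr0 lerD//; last first.
  by rewrite sumr_ge0// => k _; rewrite mulr_ge0// sumr_ge0.
rewrite mulr_suml ler_sum// => k _; rewrite normrM ler_wpM2l//.
exact: entry_le_norm.
Qed.

Lemma bil_le A u v : `|bil A u v| <= mx_size A * `|u| * `|v|.
Proof.
rewrite /bil -mulmxA mxE (le_trans (ler_norm_sum _ _ _))//.
rewrite /mx_size 2!mulr_suml ler_sum// => i _.
rewrite mxE normrM mxE mulrAC mulrC ler_pM// ?entry_le_norm//.
rewrite (le_trans (ler_norm_sum _ _ _))// mulr_suml ler_sum// => j _.
by rewrite normrM ler_wpM2l// entry_le_norm.
Qed.

Lemma enormE v : enorm v ^+ 2 = bil 1%:M v v.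
Proof.
rewrite /enorm sqr_sqrtr; last by rewrite sumr_ge0// => i _; rewrite sqr_ge0.
by rewrite /bil mulmx1 dot_self.
Qed.

Lemma bil_mul A u v : bil 1%:M (A *m u) (A *m v) = bil (A^T *m A) u v.
Proof. by rewrite /bil mulmx1 trmx_mul !mulmxA. Qed.

Lemma norm_le_enorm v : `|v| ^+ 2 <= enorm v ^+ 2.
Proof.
rewrite ler_sqr ?nnegrE ?sqrtr_ge0//.
apply: norm_le_entry => [|i j]; first by rewrite sqrtr_ge0.
rewrite ord1 -sqrtr_sqr ler_wsqrtr// (bigD1 i)//= lerDl.
by rewrite sumr_ge0// => k _; rewrite sqr_ge0.
Qed.

(** With [A = B * B] and [B] invertible, [|v|] is at most a constant times [|B v|]. *)
Lemma posdef_coercive A : posdefmx A ->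
  exists2 c : R, 0 < c & forall v, c * `|v| ^+ 2 <= bil A v v.
Proof.
move=> pA; have [[sB pB] BB] := sqrtmxP pA; set B := sqrtmx A in sB pB BB.
have Bu : B \in unitmx by apply: posdef_unit.
have K0 := mx_size_ge0 (invmx B); set K := mx_size _ in K0.
have K1 : 0 < (K + 1) ^+ 2 by rewrite exprn_gt0//; lra.
exists ((K + 1) ^- 2); first by rewrite invr_gt0.
move=> v; rewrite mulrC ler_pdivrMr//.
have := normM_mx_size (invmx B) (B *m v); rewrite mulKmx// => h.
have -> : bil A v v = enorm (B *m v) ^+ 2 by rewrite enormE bil_mul sB BB.
apply: (@le_trans _ _ ((K * `|B *m v|) ^+ 2)).
  by rewrite ler_sqr ?nnegrE// mulr_ge0.
rewrite exprMn mulrC ler_pM ?sqr_ge0//; first exact: norm_le_enorm.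
by rewrite ler_sqr ?nnegrE//; lra.
Qed.

Lemma det_bound (k : R) A : (forall i j, `|A i j| <= k) ->
  `|\det A| <= #|{: 'S_n}|%:R * k ^+ n.
Proof.
move=> Ak; rewrite /determinant (le_trans (ler_norm_sum _ _ _))//.
apply: (@le_trans _ _ (\sum_(s : 'S_n) k ^+ n)); last first.
  by rewrite sumr_const mulr_natl.
apply: ler_sum => s _; rewrite normrM normrX normrN1 expr1n mul1r normr_prod.
rewrite -[X in _ <= k ^+ X](card_ord n) -prodr_const.
by apply: ler_prod => i _; rewrite normr_ge0 Ak.
Qed.

End quadratic_forms.

Section log_weight.
Variables (R : realType) (d : nat) (alpha : R) (T Sigma : 'M[R]_d).
Hypotheses (alpha_gt0 : 0 < alpha) (pT : posdefmx T) (pS : posdefmx Sigma).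

Let Si := invmx Sigma.
Let pSi : posdefmx Si := posdef_inv pS.

(** The matrices [R_m^-1 * R ^ 2] enter the posterior through their Gram matrices
only, and [energy_mx m] expresses these without square roots. *)
Definition precision (m : nat) : 'M[R]_d := invmx Sigma + m%:R^-1 *: invmx T.
Definition energy_mx (m : nat) : 'M[R]_d :=
  invmx Sigma *m invmx (precision m) *m invmx Sigma.

(** Swapping and merging clusters act on their sizes and on the sums of their
observations, hence the choice of these two arguments. *)
Definition log_weight (m : nat) (s : 'cV[R]_d) : R :=
  ln (alpha / Num.sqrt (\det T)) + ln (m`!%:R) - (d + 2)%:R / 2 * ln m%:R
  - ln (\det (cluster_scale T Sigma m))
  + 2^-1 * m%:R * bil (energy_mx m) (m%:R^-1 *: s) (m%:R^-1 *: s).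

Lemma posdef_precision m : (0 < m)%N -> posdefmx (precision m).
Proof.
move=> m0; apply: posdefD => //; apply: posdefZ; first by rewrite invr_gt0 ltr0n.
exact: posdef_inv.
Qed.

Lemma posdef_energy m : (0 < m)%N -> posdefmx (energy_mx m).
Proof.
move=> m0; have [sM pM] := posdef_inv (posdef_precision m0); have [sS _] := pSi.
rewrite /energy_mx -/Si; split; first by rewrite !trmx_mul sM sS !mulmxA.
move=> v v0; have -> : v^T *m (Si *m invmx (precision m) *m Si) *m v =
    (Si *m v)^T *m invmx (precision m) *m (Si *m v).
  by rewrite trmx_mul sS !mulmxA.
apply: pM; apply: contra_neq v0 => Sv0.
by rewrite -[v](mulKmx (posdef_unit pSi)) Sv0 mulmx0.
Qed.

Lemma cluster_energyE m v : (0 < m)%N ->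
  enorm (invmx (cluster_scale T Sigma m) *m
    (obs_scale Sigma *m obs_scale Sigma) *m v) ^+ 2 = bil (energy_mx m) v v.
Proof.
move=> m0; have [_ RR] := sqrtmxP pSi.
rewrite /obs_scale -/Si RR.
have [pRm RmRm] := sqrtmxP (posdef_precision m0).
rewrite -/(cluster_scale T Sigma m) in pRm RmRm.
set Rm := cluster_scale T Sigma m in pRm RmRm *.
have Rmu := posdef_unit pRm.
have [sRi _] := posdef_inv pRm; have [sSi _] := pSi.
rewrite enormE bil_mul trmx_mul sRi sSi /energy_mx -/Si -RmRm.
congr (bil _ v v); rewrite !mulmxA; congr (_ *m _); rewrite -!mulmxA; congr (_ *m _).
by rewrite -[LHS]mul1mx -(mulVmx (posdef_unit (posdef_precision m0))) -{2}RmRm -RmRm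
  -!mulmxA mulKVmx// mulmxV// mulmx1.
Qed.

Lemma energyE v : enorm (obs_scale Sigma *m v) ^+ 2 = bil Si v v.
Proof.
have [[sR _] RR] := sqrtmxP pSi.
by rewrite /obs_scale enormE bil_mul sR RR.
Qed.

Lemma posteriorE n (x : 'I_n -> 'cV[R]_d) (JJ : {set {set 'I_n}}) :
  finset.partition JJ [set: 'I_n]%SET ->
  posterior alpha T Sigma x JJ =
    expR (\sum_(J in JJ) log_weight #|J| (\sum_(j in J) x j)).
Proof.
move=> /and3P[_ _ J0].
have Jgt0 J : J \in JJ -> (0 < #|J|)%N.
  by move=> JJJ; rewrite card_gt0; apply: contraNneq J0 => <-.
have C0 : 0 < alpha / Num.sqrt (\det T) by rewrite divr_gt0// sqrtr_gt0 posdef_det_gt0.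
rewrite /posterior /log_weight expR_sum [in LHS]mulr_sumr expR_sum.
rewrite -prodr_const -!big_split/=; apply: eq_bigr => J JJJ.
have m0 := Jgt0 _ JJJ.
rewrite cluster_energyE// expRD mulrA; congr (_ * expR _); last first.
  by rewrite mulrA.
have dR0 : 0 < \det (cluster_scale T Sigma #|J|).
  by apply: posdef_det_gt0; have [] := sqrtmxP (posdef_precision m0).
rewrite !expRD !expRN !lnK ?posrE// ?ltr0n ?fact_gt0//.
rewrite -!mulrA; congr (_ * (_ * _)); rewrite invfM; congr (_ * _).
by rewrite /powR pnatr_eq0 eqn0Ngt m0 mulrA.
Qed.

Lemma MAP_log_weight n (x : 'I_n -> 'cV[R]_d) (JJ KK : {set {set 'I_n}}) :
  MAP_partition alpha T Sigma x JJ -> finset.partition KK [set: 'I_n]%SET ->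
  \sum_(J in KK) log_weight #|J| (\sum_(j in J) x j) <=
  \sum_(J in JJ) log_weight #|J| (\sum_(j in J) x j).
Proof.
move=> [pJJ mJJ] pKK; have := mJJ _ pKK.
by rewrite !posteriorE// ler_expR.
Qed.

(** [precision m] dominates [Sigma^-1] for every [m]. *)
Lemma precision_inv_bound : exists2 k : R, 0 <= k & forall m, (0 < m)%N ->
  forall i j, `|invmx (precision m) i j| <= k.
Proof.
have [c c0 cP] := posdef_coercive pSi.
exists c^-1 => [|m m0 i j]; first by rewrite invr_ge0 ltW.
pose z := invmx (precision m) *m delta_mx j 0 : 'cV[R]_d.
have -> : invmx (precision m) i j = z i 0 by rewrite /z -colE mxE.
apply: (le_trans (entry_le_norm _ _ _)).
have [z0|z0] := eqVneq `|z| 0; first by rewrite z0 invr_ge0 ltW.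
have zgt0 : 0 < `|z| by rewrite lt_neqAle eq_sym z0 /=.
rewrite -(ler_pM2l c0) mulfV ?gt_eqF// -(ler_pM2r zgt0) mul1r -mulrA -expr2.
apply: (le_trans (cP z)).
apply: (@le_trans _ _ (bil (precision m) z z)).
  rewrite /precision bilDm lerDl bilZm mulr_ge0 ?invr_ge0//.
  exact/bil_ge0/posdef_inv.
rewrite /bil -mulmxA mulKVmx; last exact/posdef_unit/posdef_precision.
by rewrite -colE mxE [in leLHS]mxE (le_trans (ler_norm _))// entry_le_norm.
Qed.

(** [energy_mx m] is [Sigma^-1] up to [O(1 / m)], and [det R_m] stays between two
positive bounds; hence the error is uniform in the size of the cluster. *)
Lemma log_weight_approx (r : R) : 0 <= r -> exists2 K : R, 0 <= K &
  forall m (s : 'cV[R]_d), (0 < m)%N -> `|s| <= m%:R * r ->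
  `|log_weight m s - (ln (m`!%:R) - (d + 2)%:R / 2 * ln m%:R
      + 2^-1 * (bil Si s s / m%:R))| <= K.
Proof.
move=> r0; have [k k0 kP] := precision_inv_bound.
pose Ti := invmx T.
have pTi : posdefmx Ti := posdef_inv pT.
have [k1 k10 k1P] : exists2 k1 : R, 0 <= k1 & forall m, (0 < m)%N ->
    mx_size (Si *m invmx (precision m) *m Ti) <= k1.
  pose a := mx_size Si; pose b := mx_size Ti.
  have entry_le_size (A : 'M[R]_d) i j : `|A i j| <= mx_size A.
    rewrite /mx_size (bigD1 i)//= (bigD1 j)//= -!addrA lerDl addr_ge0 ?sumr_ge0//.
    by move=> i' _; apply: sumr_ge0.
  exists (\sum_(i < d) \sum_(j < d) \sum_(l < d) (\sum_(l' < d) a * k) * b).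
    do 3 (apply: sumr_ge0 => ? _); apply: mulr_ge0; last exact: mx_size_ge0.
    by apply: sumr_ge0 => ? _; rewrite mulr_ge0// mx_size_ge0.
  move=> m m0; apply: ler_sum => i _; apply: ler_sum => j _.
  rewrite mxE (le_trans (ler_norm_sum _ _ _))//; apply: ler_sum => l _.
  rewrite normrM ler_pM// ?entry_le_size//.
  rewrite mxE (le_trans (ler_norm_sum _ _ _))//; apply: ler_sum => l' _.
  by rewrite normrM ler_pM ?entry_le_size ?kP.
have [k2 k20 k2P] : exists2 k2 : R, 0 < k2 & forall m, (0 < m)%N ->
    `|ln (\det (cluster_scale T Sigma m))| <= k2.
  pose b1 := #|{: 'S_d}|%:R * k ^+ d.
  pose b2 := #|{: 'S_d}|%:R * (`|Si| + `|Ti|) ^+ d.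
  have b10 : 0 <= b1 by rewrite mulr_ge0// exprn_ge0.
  have b20 : 0 <= b2 by rewrite mulr_ge0// exprn_ge0// addr_ge0.
  exists (ln (1 + b1) + ln (1 + b2) + 1).
    by rewrite ltr_wpDl// addr_ge0// ln_ge0// lerDl.
  move=> m m0.
  have pM := posdef_precision m0.
  have [pRm RmRm] := sqrtmxP pM; rewrite -/(cluster_scale T Sigma m) in pRm RmRm.
  have dR0 := posdef_det_gt0 pRm.
  have dM0 := posdef_det_gt0 pM.
  have E : ln (\det (precision m)) = 2 * ln (\det (cluster_scale T Sigma m)).
    by rewrite -RmRm det_mulmx lnM ?posrE// mulr2n mulrDl mul1r.
  have u : ln (\det (precision m)) <= ln (1 + b2).
    rewrite ler_ln ?posrE ?ltr_wpDr// ler_wpDl//.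
    apply: (le_trans (ler_norm _)); apply: det_bound => i j.
    rewrite mxE (le_trans (ler_normD _ _))// lerD ?entry_le_norm//.
    rewrite mxE normrM -[leRHS]mul1r ler_pM ?entry_le_norm//.
    by rewrite ger0_norm ?invr_ge0// invf_le1 ?ltr0n// ler1n.
  have l : - ln (\det (precision m)) <= ln (1 + b1).
    rewrite -lnV ?posrE// ler_ln ?posrE ?invr_gt0// ?ltr_wpDr// ler_wpDl//.
    rewrite -det_inv (le_trans (ler_norm _))//; apply: det_bound => i j.
    exact: kP.
  have u0 : 0 <= ln (1 + b1) by rewrite ln_ge0// lerDl.
  have l0 : 0 <= ln (1 + b2) by rewrite ln_ge0// lerDl.
  by rewrite ler_norml; apply/andP; split; lra.
exists (`|ln (alpha / Num.sqrt (\det T))| + k2 + k1 * r * r).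
  by rewrite !addr_ge0 ?mulr_ge0// ltW.
move=> m s m0 sr.
have m1 : (0 : R) < m%:R by rewrite ltr0n.
pose v := m%:R^-1 *: s.
have vr : `|v| <= r.
  by rewrite /v normrZ gtr0_norm ?invr_gt0// ler_pdivrMl.
have Mu := posdef_unit (posdef_precision m0).
have E : energy_mx m = Si - m%:R^-1 *: (Si *m invmx (precision m) *m Ti).
  apply/esym/eqP; rewrite subr_eq /energy_mx -/Si scalemxAr -mulmxDr /Ti.
  rewrite -[X in _ == _ *m X]/(precision m) mulmxKV//.
rewrite /log_weight E.
have -> : bil Si s s / m%:R = m%:R * bil Si v v.
  by rewrite /v bilZl bilZr mulVKf ?gt_eqF// mulrC.
rewrite -/v bilDm -(scaleNr _ (Si *m _ *m Ti)) bilZm.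
set c := ln (alpha / _); set q := bil Si v v; set e := bil _ v v.
set D := ln (\det _); set f := ln (m`!%:R); set g := _ * ln _.
have -> : c + f - g - D + 2^-1 * m%:R * (q + - m%:R^-1 * e) -
   (f - g + 2^-1 * (m%:R * q)) = c - D - 2^-1 * e.
  have mK : m%:R * (- m%:R^-1 * e) = - e by rewrite mulNr mulrN mulVKf ?gt_eqF.
  by rewrite -mulrA mulrDr mK; lra.
have eb : `|e| <= k1 * r * r.
  apply: (le_trans (bil_le _ _ _)); rewrite ler_pM ?mulr_ge0 ?mx_size_ge0//.
  by rewrite ler_pM ?mx_size_ge0// k1P.
have D2 : `|D| <= k2 by exact: k2P.
have := ler_normD (c - D) (- (2^-1 * e)).
have := ler_normD c (- D).
rewrite !normrN normrM ger0_norm// => h1 h2.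
have := normr_ge0 e; lra.
Qed.

End log_weight.

(** * MAP clusters are separated by hyperplanes *)

Section separation.
Variables (R : realType) (d : nat) (alpha : R) (T Sigma : 'M[R]_d).
Hypotheses (d_ge1 : (1 <= d)%N) (alpha_gt0 : 0 < alpha).
Hypotheses (pT : posdefmx T) (pS : posdefmx Sigma).

Definition dot (w v : 'cV[R]_d) : R := \sum_i w i 0 * v i 0.

Lemma dotD w u v : dot w (u + v) = dot w u + dot w v.
Proof. by rewrite /dot -big_split; apply: eq_bigr => i _; rewrite mxE mulrDr. Qed.

Lemma dotZ w a v : dot w (a *: v) = a * dot w v.
Proof. by rewrite /dot mulr_sumr; apply: eq_bigr => i _; rewrite mxE mulrCA. Qed.

Lemma dotB w u v : dot w (u - v) = dot w u - dot w v.
Proof. by rewrite -scaleN1r dotD dotZ mulN1r. Qed.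

Lemma dotZl w a v : dot (a *: w) v = a * dot w v.
Proof. by rewrite /dot mulr_sumr; apply: eq_bigr => i _; rewrite mxE mulrA. Qed.

Lemma dotBl w u v : dot (w - u) v = dot w v - dot u v.
Proof. by rewrite /dot -sumrB; apply: eq_bigr => i _; rewrite !mxE mulrBl. Qed.

Lemma dot_bil (A : 'M[R]_d) u v : A^T = A -> dot (A *m u) v = bil A u v.
Proof.
move=> sA; rewrite /bil -[X in _ *m X *m _]sA -trmx_mul [RHS]mxE.
by apply: eq_bigr => i _; rewrite [X in _ = X * _]mxE.
Qed.

Lemma dot_le w v : `|dot w v| <= d%:R * (`|w| * `|v|).
Proof.
rewrite (le_trans (ler_norm_sum _ _ _))//.
apply: (@le_trans _ _ (\sum_(i < d) `|w| * `|v|)); last first.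
  by rewrite sumr_const card_ord mulr_natl.
by apply: ler_sum => i _; rewrite normrM ler_pM// entry_le_norm.
Qed.

(** At a fixed size the log weight is a quadratic polynomial of the sum, which makes
the second order expansion exact. *)
Lemma log_weight_shift m (s v : 'cV[R]_d) : (0 < m)%N ->
  log_weight alpha T Sigma m (s + v) - log_weight alpha T Sigma m s =
  bil (m%:R^-1 *: energy_mx T Sigma m) v s +
  2^-1 * bil (m%:R^-1 *: energy_mx T Sigma m) v v.
Proof.
move=> m0; have [sE _] := posdef_energy pT pS m0.
have m1 : m%:R != 0 :> R by rewrite pnatr_eq0 -lt0n.
rewrite /log_weight !bilZm !bilZl !bilZr -!(mulrA 2^-1) !(mulVKf m1).
rewrite bilDl !bilDr (bilC s v sE).
move: (ln _) (ln _) (_ * ln _) (ln _) => *.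
move: (bil _ _ _) (bil _ _ _) (bil _ _ _) (m%:R^-1) => a b c e; lra.
Qed.

Variables (n : nat) (x : 'I_n -> 'cV[R]_d) (JJ : {set {set 'I_n}}).
Hypothesis mapJJ : MAP_partition alpha T Sigma x JJ.

Local Notation lw := (log_weight alpha T Sigma).

(** Exchanging two observations is a transposition of the indices, and a permutation
maps partitions to partitions with blocks of the same sizes. *)
Lemma swap_optimal (I J : {set 'I_n}) i j : I \in JJ -> J \in JJ -> I != J ->
  i \in I -> j \in J ->
  lw #|I| (\sum_(k in I) x k + (x j - x i)) +
  lw #|J| (\sum_(k in J) x k - (x j - x i)) <=
  lw #|I| (\sum_(k in I) x k) + lw #|J| (\sum_(k in J) x k).
Proof.
move=> IJJ JJJ IJ iI jJ; have [pJJ _] := mapJJ.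
have /finset.trivIsetP tJJ := partition_trivIset pJJ.
pose t := tperm i j.
pose KK := [set t @: L | L : {set 'I_n} in JJ]%SET.
have tinj : injective t by exact: perm_inj.
have pKK : finset.partition KK [set: 'I_n]%SET.
  have -> : [set: 'I_n]%SET = (t @: [set: 'I_n])%SET.
    by apply/esym/setP => k; rewrite !inE; apply/imsetP; exists (t k); rewrite ?inE// tpermK.
  by rewrite imset_partition.
have := MAP_log_weight alpha_gt0 pT pS mapJJ pKK.
rewrite big_imset/=; last by move=> L L' _ _; exact: imset_inj.
rewrite [leLHS](eq_bigr (fun L : {set _} => lw #|L| (\sum_(k in L) x (t k)))); last first.
  move=> L _; rewrite card_imset// big_imset//=.
  by move=> k k' _ _; exact: tinj.
have nmem (L : {set 'I_n}) : L \in JJ -> L != I -> i \notin L.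
  by move=> LJJ LI; have /disjointFl/(_ iI)/negbT := tJJ _ _ LJJ IJJ LI.
have nmemj (L : {set 'I_n}) : L \in JJ -> L != J -> j \notin L.
  by move=> LJJ LJ; have /disjointFl/(_ jJ)/negbT := tJJ _ _ LJJ JJJ LJ.
rewrite (bigD1 I)//= [leRHS](bigD1 I)//=.
rewrite [X in _ + X <= _](bigD1 J)/=; last by rewrite JJJ eq_sym.
rewrite [X in _ <= _ + X](bigD1 J)/=; last by rewrite JJJ eq_sym.
rewrite [X in _ + (_ + X) <= _](_ : _ =
   \sum_(L in JJ | (L != I) && (L != J)) lw #|L| (\sum_(k in L) x k)); last first.
  apply: eq_big => [L|L /andP[/andP[LJJ LI] LJ]]; first by rewrite andbA.
  congr (lw _ _); apply: eq_bigr => k kL; rewrite tpermD//.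
    by apply: contraTneq kL => <-; exact: nmem.
  by apply: contraTneq kL => <-; exact: nmemj.
rewrite [X in _ <= _ + (_ + X)](_ : _ =
   \sum_(L in JJ | (L != I) && (L != J)) lw #|L| (\sum_(k in L) x k)); last first.
  by apply: eq_bigl => L; rewrite andbA.
rewrite [leLHS]addrA [leRHS]addrA lerD2r.
have -> : \sum_(k in I) x (t k) = \sum_(k in I) x k + (x j - x i).
  rewrite (bigD1 i)//= [in RHS](bigD1 i)//= tpermL.
  rewrite (eq_bigr x); first by rewrite [RHS]addrC addrA subrK.
  move=> k /andP[kI ki]; rewrite tpermD// 1?eq_sym//.
  by apply: contraTneq kI => ->; exact: nmemj.
have -> : \sum_(k in J) x (t k) = \sum_(k in J) x k - (x j - x i).
  rewrite (bigD1 j)//= [in RHS](bigD1 j)//= tpermR.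
  rewrite (eq_bigr x); first by rewrite opprB [RHS]addrC addrA subrK.
  move=> k /andP[kJ kj]; rewrite tpermD// 1?eq_sym//.
  by apply: contraTneq kJ => ->; apply: nmem => //; rewrite eq_sym.
by [].
Qed.

(** Exchanging two observations keeps the cluster sizes, and at fixed sizes the
log posterior is a strictly convex function of the cluster sums: optimality
forces the gradient of that function to order the two clusters. *)
Lemma MAP_separated (I J : {set 'I_n}) : I \in JJ -> J \in JJ -> I != J ->
  exists w : 'cV[R]_d, exists c : R, [/\ `|w| = 1,
    forall i, i \in I -> c <= dot w (x i),
    forall j, j \in J -> dot w (x j) <= c &
    exists2 i, i \in I & c = dot w (x i)].
Proof.
move=> IJJ JJJ IJ; have [pJJ _] := mapJJ.
have gt0 (L : {set 'I_n}) : L \in JJ -> (0 < #|L|)%N.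
  by move=> LJJ; rewrite card_gt0; apply: partition_neq0 pJJ LJJ.
have I0 := gt0 _ IJJ; have J0 := gt0 _ JJJ.
have /card_gt0P[i0 i0I] := I0.
have pf m : (0 < m)%N -> posdefmx (m%:R^-1 *: energy_mx T Sigma m).
  by move=> m0; apply: posdefZ; [rewrite invr_gt0 ltr0n|exact: posdef_energy].
set A := #|I|%:R^-1 *: energy_mx T Sigma #|I|.
set B := #|J|%:R^-1 *: energy_mx T Sigma #|J|.
have pA : posdefmx A by exact: pf.
have pB : posdefmx B by exact: pf.
have [sA _] := pA; have [sB _] := pB.
pose w := A *m (\sum_(k in I) x k) - B *m (\sum_(k in J) x k).
have wP i j : i \in I -> j \in J ->
    2 * dot w (x j - x i) + bil A (x j - x i) (x j - x i) + bil B (x j - x i) (x j - x i) <= 0.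
  move=> iI jJ; have := swap_optimal IJJ JJJ IJ iI jJ.
  set sI := \sum_(k in I) x k; set sJ := \sum_(k in J) x k; set v := x j - x i.
  have := log_weight_shift sI v I0; have := log_weight_shift sJ (- v) J0.
  rewrite -/A -/B !bilNl !bilNr.
  rewrite /w dotBl !dot_bil// -/sI -/sJ (bilC sI v sA) (bilC sJ v sB).
  move: (bil A v sI) (bil B v sJ) (bil A v v) (bil B v v) => a b a' b'.
  by move: (lw _ _) (lw _ _) (lw _ _) (lw _ _) => *; lra.
(* A minimiser over [I] of the scalar product with the gradient gives the offset. *)
have [w0|w0] := eqVneq w 0; last first.
  have nw : 0 < `|w| by rewrite normr_gt0.
  pose m := [arg min_(i < i0 in I) dot w (x i)]%O.
  have [mI mP] : m \in I /\ forall i, i \in I -> dot w (x m) <= dot w (x i).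
    by rewrite /m; case: arg_minP.
  exists (`|w|^-1 *: w), (dot (`|w|^-1 *: w) (x m)); split.
  - by rewrite normrZ ger0_norm ?invr_ge0// mulVf// gt_eqF.
  - by move=> i iI; rewrite !dotZl ler_pM2l ?invr_gt0// mP.
  - move=> j jJ; rewrite !dotZl ler_pM2l ?invr_gt0//.
    have := wP _ _ mI jJ; rewrite dotB.
    have := bil_ge0 (x j - x m) pA; have := bil_ge0 (x j - x m) pB; lra.
  - by exists m.
(* Without a gradient the convexity terms must vanish, so that the observations of
   both clusters coincide and every hyperplane through them will do. *)
have xE i j : i \in I -> j \in J -> x j = x i.
  move=> iI jJ; have := wP _ _ iI jJ; rewrite w0.
  have -> : dot 0 (x j - x i) = 0.
    by rewrite /dot big1// => k _; rewrite mxE mul0r.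
  have [_ pA'] := pA; move=> h; apply/eqP; rewrite -subr_eq0; apply/negPn/negP => v0.
  have := pA' _ v0; rewrite -/(bil A _ _).
  by have := bil_ge0 (x j - x i) pB; lra.
have /card_gt0P[j0 j0J] := J0.
exists (const_mx 1), (dot (const_mx 1) (x i0)); split => //.
- apply/eqP; rewrite eq_le; apply/andP; split.
    by apply: norm_le_entry => // i j; rewrite mxE normr1.
  case: (d) d_ge1 => // d' _.
  have := @entry_le_norm R _ _ (const_mx 1 : 'cV[R]_d'.+1) 0 0.
  by rewrite mxE normr1.
- by move=> i iI; rewrite -(xE _ _ i0I j0J) -(xE _ _ iI j0J).
- by move=> j jJ; rewrite (xE _ _ i0I jJ).
- by exists i0.
Qed.

End separation.

(** * MAP clusters have linear size *)

Section factorial_bounds.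
Variable R : realType.

Lemma ln_le_subr1 (y : R) : 0 < y -> ln y <= y - 1.
Proof. by move=> y0; have := expR_ge1Dx (ln y); rewrite lnK ?posrE//; lra. Qed.

Lemma ln_nat_ge0 (n : nat) : 0 <= ln (n%:R : R).
Proof. by case: n => [|n]; [rewrite ln0|rewrite ln_ge0// ler1n]. Qed.

Lemma ln_fact_ge (n : nat) : n%:R * ln (n%:R : R) - n%:R <= ln (n`!%:R : R).
Proof.
elim: n => [|n IH]; first by rewrite mul0r subr0 fact0 ln1.
case: n IH => [_|n IH]; first by rewrite (_ : 1`! = 1%N)// ln1; lra.
have n1 : (0 : R) < n.+1%:R by rewrite ltr0n.
have n2 : (0 : R) < n.+2%:R by rewrite ltr0n.
rewrite factS natrM lnM ?posrE ?ltr0n ?fact_gt0//.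
have := ln_le_subr1 (divr_gt0 n2 n1); rewrite ln_div ?posrE//.
rewrite -(ler_pM2l n1) !mulrBr mulrCA mulfV ?gt_eqF// -(natr1 n.+1); lra.
Qed.

Lemma ln_fact_le (n : nat) :
  ln (n`!%:R : R) <= n%:R * ln n%:R - n%:R + 1 + ln n%:R.
Proof.
elim: n => [|n IH]; first by rewrite fact0 ln1 mul0r ln0//; lra.
case: n IH => [_|n IH]; first by rewrite (_ : 1`! = 1%N)// ln1; lra.
have n1 : (0 : R) < n.+1%:R by rewrite ltr0n.
have n2 : (0 : R) < n.+2%:R by rewrite ltr0n.
rewrite factS natrM lnM ?posrE ?ltr0n ?fact_gt0//.
have := ln_le_subr1 (divr_gt0 n1 n2); rewrite ln_div ?posrE//.
rewrite -(ler_pM2l n2) !mulrBr mulrCA mulfV ?gt_eqF// -(natr1 n.+1); lra.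
Qed.

Lemma ln_fact_le_mul (n : nat) : ln (n`!%:R : R) <= n%:R * ln n%:R.
Proof.
case: n => [|n]; first by rewrite fact0 ln1 mul0r.
have := ln_fact_le n.+1; have := @ln_le_subr1 n.+1%:R.
by rewrite ltr0n => /(_ isT); lra.
Qed.

Lemma ln_fact_add (a b : nat) : (0 < a)%N ->
  ln (a`!%:R : R) + b%:R * ln a%:R <= ln ((a + b)`!%:R : R).
Proof.
move=> a0; elim: b => [|b IH]; first by rewrite addn0 mul0r addr0.
rewrite addnS factS natrM lnM ?posrE ?ltr0n ?fact_gt0// -natr1 mulrDl mul1r.
have : ln (a%:R : R) <= ln ((a + b).+1%:R).
  by rewrite ler_ln ?posrE ?ltr0n// ler_nat ltnW// ltnS leq_addr.
lra.
Qed.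

End factorial_bounds.

Lemma le_of_eq (R : numDomainType) (a b : R) : a = b -> a <= b.
Proof. by move=> ->. Qed.

Section cluster_sizes.
Variables (R : realType) (d : nat) (alpha : R) (T Sigma : 'M[R]_d).
Hypotheses (alpha_gt0 : 0 < alpha) (pT : posdefmx T) (pS : posdefmx Sigma).
Local Notation lw := (log_weight alpha T Sigma).
Local Notation Si := (invmx Sigma).
Local Notation D := ((d + 2)%:R / 2 : R).

Lemma norm_sum_le n (x : 'I_n -> 'cV[R]_d) (r : R) (J : {set 'I_n}) :
  (forall j, `|x j| <= r) -> `|\sum_(j in J) x j| <= #|J|%:R * r.
Proof.
move=> xr; rewrite (le_trans (ler_norm_sum _ _ _))// mulr_natl -sumr_const.
by apply: ler_sum => j _.
Qed.

Lemma energy_le (r : R) m (s : 'cV[R]_d) : 0 <= r -> (0 < m)%N -> `|s| <= m%:R * r ->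
  bil Si s s / m%:R <= mx_size Si * r ^+ 2 * m%:R.
Proof.
move=> r0 m0 sr; have m1 : (0 : R) < m%:R by rewrite ltr0n.
rewrite ler_pdivrMr// (le_trans (ler_norm _))// (le_trans (bil_le _ _ _))//.
rewrite -!mulrA ler_wpM2l ?mx_size_ge0//.
apply: (@le_trans _ _ ((m%:R * r) * (m%:R * r))); first by rewrite ler_pM.
by apply/le_of_eq; ring.
Qed.

(** The tangent of the quadratic form at the mean of the first cluster bounds the
merged energy from below, and the resulting loss is proportional to the size of
the second cluster only. *)
Lemma energy_merge (r : R) a b (s t : 'cV[R]_d) : 0 <= r -> (0 < a)%N -> (0 < b)%N ->
  `|s| <= a%:R * r -> `|t| <= b%:R * r ->
  bil Si s s / a%:R + bil Si t t / b%:R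
    - 4 * (mx_size Si * r ^+ 2) * b%:R <= bil Si (s + t) (s + t) / (a + b)%:R.
Proof.
move=> r0 a0 b0 sr tr.
have a1 : (0 : R) < a%:R by rewrite ltr0n.
have b1 : (0 : R) < b%:R by rewrite ltr0n.
have [sS _] := posdef_inv pS.
pose m := a%:R^-1 *: s.
have mr : `|m| <= r by rewrite normrZ gtr0_norm ?invr_gt0// ler_pdivrMl.
have sE : s = a%:R *: m by rewrite /m scalerA mulfV ?gt_eqF// scale1r.
move: m mr sE => m mr sE.
have h1 := @energy_le r b t r0 b0 tr.
have h2 : - (mx_size Si * r ^+ 2 * b%:R) <= bil Si t m.
  rewrite lerNl (le_trans (ler_norm _))// normrN.
  rewrite (le_trans (bil_le _ _ _))// -!mulrA.
  apply: ler_wpM2l; first exact: mx_size_ge0.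
  by rewrite (le_trans (ler_pM _ _ tr mr))//; apply/le_of_eq; ring.
have h3 : bil Si m m <= mx_size Si * r ^+ 2.
  rewrite (le_trans (ler_norm _))// (le_trans (bil_le _ _ _))// -mulrA.
  apply: ler_wpM2l; first exact: mx_size_ge0.
  by rewrite (le_trans (ler_pM _ _ mr mr)).
have ab0 : (0 : R) < (a + b)%:R by rewrite ltr0n addn_gt0 a0.
have E : bil Si s s / a%:R = a%:R * bil Si m m.
  by rewrite {1 2}sE bilZl bilZr mulrC mulKf ?gt_eqF.
rewrite E [leRHS]mulrC -(ler_pM2l ab0) mulVKf ?gt_eqF//.
have um : bil Si (s + t) m = a%:R * bil Si m m + bil Si t m.
  by rewrite bilDl {1}sE bilZl.
move: um; move: (s + t) => u um.
have := bil_ge0 (u - (a + b)%:R *: m) (posdef_inv pS).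
rewrite bilDl !bilDr !bilNl !bilNr !bilZl !bilZr.
rewrite [bil Si m u]bilC// um.
set q := bil Si u u; set qm := bil Si m m in h3 *.
set c := bil Si t m in h2 *; set e := mx_size Si * r ^+ 2 in h1 h2 h3 *.
set p := bil Si t t / _ in h1 *.
rewrite natrD => h4.
have : (a%:R + b%:R) * (a%:R * qm + p - 4 * e * b%:R) <=
  (a%:R + b%:R) * (a%:R * qm + 2 * c - b%:R * qm).
  rewrite ler_wpM2l ?addr_ge0//; last by move: (mulrC b%:R qm); nra.
lra.
Qed.

Lemma partition_nonempty n (JJ : {set {set 'I_n}}) :
  finset.partition JJ [set: 'I_n]%SET -> forall J, J \in JJ -> (0 < #|J|)%N.
Proof. by move=> pJJ J JJJ; rewrite card_gt0; apply: partition_neq0 pJJ JJJ. Qed.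

Lemma sum_card_partition n (JJ : {set {set 'I_n}}) :
  finset.partition JJ [set: 'I_n]%SET -> \sum_(J in JJ) #|J|%:R = n%:R :> R.
Proof.
by move=> pJJ; rewrite -natr_sum -(card_partition pJJ) cardsT card_ord.
Qed.

(** If all clusters were smaller than [eta * n], their factorials would lose about
[n * ln (1 / eta)] against the partition with a single cluster, while the energies
only account for a multiple of [n]. *)
Lemma MAP_big_cluster (r : R) : 0 <= r -> exists2 eta : R, 0 < eta &
  forall n (x : 'I_n -> 'cV[R]_d) (JJ : {set {set 'I_n}}), (0 < n)%N ->
  (forall j, `|x j| <= r) -> MAP_partition alpha T Sigma x JJ ->
  exists2 I, I \in JJ & eta * n%:R <= #|I|%:R.
Proof.
move=> r0; have [K K0 KP] := log_weight_approx alpha pT pS r0.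
pose C1 := 2^-1 * (mx_size Si * r ^+ 2) + K.
(* [- ln eta] exceeds the sum of all the losses per observation. *)
exists (expR (- (2 + D + K + C1))); first exact: expR_gt0.
set eta := expR _ => n x JJ n0 xr mapJJ.
have [pJJ _] := mapJJ; have gt0 := partition_nonempty pJJ.
apply: contrapT => noI.
have small J : J \in JJ -> #|J|%:R < eta * n%:R.
  by move=> JJJ; rewrite ltNge; apply/negP => h; apply: noI; exists J.
have n1 : (0 : R) < n%:R by rewrite ltr0n.
have D0 : 0 <= D by [].
have pT1 : finset.partition [set [set: 'I_n]%SET]%SET [set: 'I_n]%SET.
  rewrite /finset.partition finset.cover1 eqxx finset.trivIset1 /= inE.
  by apply/negP => /eqP/setP/(_ (Ordinal n0)); rewrite !inE.
have := MAP_log_weight alpha_gt0 pT pS mapJJ pT1.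
rewrite big_set1 cardsT card_ord; apply/negP; rewrite -ltNge.
apply: (@le_lt_trans _ _ (\sum_(J in JJ) #|J|%:R * (ln eta + ln n%:R + C1))).
  apply: ler_sum => J JJJ; have J0 := gt0 _ JJJ.
  have J1 : 1 <= #|J|%:R :> R by rewrite ler1n.
  have sJ := norm_sum_le J xr.
  have := KP _ _ J0 sJ; rewrite ler_norml => /andP[_].
  have := energy_le r0 J0 sJ; have := ln_fact_le_mul R #|J|.
  have := mulr_ge0 D0 (ln_nat_ge0 R #|J|).
  have : ln #|J|%:R <= ln eta + ln n%:R.
    rewrite -lnM ?posrE ?expR_gt0// ler_ln ?posrE ?mulr_gt0 ?expR_gt0 ?ltr0n//.
    exact/ltW/small.
  move=> h1; have := ler_wpM2l (le_trans ler01 J1) h1 => {}h1 h2 h3 h4 h5; rewrite /C1.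
  have h6 : K <= #|J|%:R * K by rewrite ler_peMl.
  move: h5; set a := \sum_(j in J) x j in sJ h4 *.
  move: h1 h2 h3 h4 h6.
  move: (ln #|J|%:R) (lw _ _) (bil _ _ _ / _) (ln (#|J|)`!%:R) (D * _) => *.
  rewrite mulrDr; lra.
rewrite -mulr_suml sum_card_partition// expRK.
have sT := norm_sum_le [set: 'I_n]%SET xr; rewrite cardsT card_ord in sT.
have := KP _ _ n0 sT; rewrite ler_norml => /andP[h1 _].
have := ln_fact_ge R n; have : D * ln n%:R <= D * n%:R.
  by rewrite ler_wpM2l//; apply/ltW/ln_sublinear.
have n2 : 1 <= n%:R :> R by rewrite ler1n.
have : K <= n%:R * K by rewrite ler_peMl.
have : 0 <= bil Si (\sum_(j in [set: 'I_n]%SET) x j) (\sum_(j in [set: 'I_n]%SET) x j) / n%:R.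
  by rewrite divr_ge0//; apply/bil_ge0/posdef_inv.
move: h1; move: (lw _ _) (bil _ _ _ / _) (ln n`!%:R) => *.
lra.
Qed.

(** Merging a cluster of size [b] into one of size [a] gains [b * ln (a / b)] in the
factorials and loses [O(b)] elsewhere: a cluster that is too small with respect
to the largest one could profitably be merged into it. *)
Lemma MAP_cluster_size (r : R) : 0 <= r -> exists2 delta : R, 0 < delta &
  forall n (x : 'I_n -> 'cV[R]_d) (JJ : {set {set 'I_n}}), (0 < n)%N ->
  (forall j, `|x j| <= r) -> MAP_partition alpha T Sigma x JJ ->
  forall J, J \in JJ -> delta * n%:R <= #|J|%:R.
Proof.
move=> r0; have [K K0 KP] := log_weight_approx alpha pT pS r0.
have [eta eta0 etaP] := MAP_big_cluster r0.
pose C2 := D * ln 2 + 2 * (mx_size Si * r ^+ 2) + 3 * K.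
have D0 : 0 <= D by [].
have e0 : 0 <= mx_size Si * r ^+ 2 by rewrite mulr_ge0 ?mx_size_ge0 ?sqr_ge0.
have Dl2 : 0 <= D * ln 2 by rewrite mulr_ge0// ln_ge0// ler1n.
have C20 : 0 <= C2 by rewrite /C2; lra.
have eC2 : expR (- C2) <= 1 by rewrite -(expR0 R) ler_expR oppr_le0.
exists (eta * expR (- C2)); first by rewrite mulr_gt0 ?expR_gt0.
move=> n x JJ n0 xr mapJJ J JJJ; rewrite leNgt; apply/negP => Jsmall.
have [pJJ _] := mapJJ; have gt0 := partition_nonempty pJJ.
have [I IJJ Ibig] := etaP _ _ _ n0 xr mapJJ.
have n1 : (0 : R) < n%:R by rewrite ltr0n.
have IJ : I != J.
  apply: contraTneq Jsmall => <-; rewrite -leNgt (le_trans _ Ibig)//.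
  by rewrite ler_wpM2r// ler_piMr// ltW.
have dIJ : fintype.disjoint (mem I) (mem J) by have /finset.trivIsetP := partition_trivIset pJJ; apply.
have I0 := gt0 _ IJJ; have J0 := gt0 _ JJJ.
have JJI : J \in (JJ :\ I)%SET by rewrite !inE eq_sym IJ.
pose KK := ((I :|: J) |: ((JJ :\ I) :\ J))%SET.
have pKK : finset.partition KK [set: 'I_n]%SET.
  have p2 := partitionD1 (partitionD1 pJJ IJJ) JJI.
  have -> : [set: 'I_n]%SET = ((I :|: J) :|: (([set: 'I_n] :\: I) :\: J))%SET.
    by apply/setP => k; rewrite !inE; case: (k \in I); case: (k \in J).
  apply: partitionU1 => //.
    by case/card_gt0P: I0 => k kI; apply/set0Pn; exists k; rewrite inE kI.
  by rewrite -setI_eq0; apply/eqP/setP => k; rewrite !inE; case: (k \in I); case: (k \in J).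
have := MAP_log_weight alpha_gt0 pT pS mapJJ pKK.
rewrite big_setU1/=; last first.
  apply/negP; rewrite !inE => /and3P[UJ UI UJJ].
  have := partition_trivIset pJJ => /finset.trivIsetP/(_ _ _ UJJ IJJ UI)/pred0P.
  case/card_gt0P: I0 => k kI /(_ k); rewrite !inE kI.
  by [].
rewrite [leRHS](big_setD1 I)//= [X in _ <= _ + X](big_setD1 J)//= [leRHS]addrA lerD2r.
have cU : #|(I :|: J)%SET| = (#|I| + #|J|)%N by apply/eqP; rewrite (leq_card_setU I J).2.
rewrite cU (eq_bigl [predU I & J]); last by move=> k; rewrite !inE.
rewrite bigU//=.
set a := #|I| in I0 Ibig *; set b := #|J| in J0 Jsmall *.
have sI := norm_sum_le I xr; have sJ := norm_sum_le J xr.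
set s := \sum_(j in I) x j in sI *; set t := \sum_(j in J) x j in sJ *.
have sIJ : `|s + t| <= (a + b)%:R * r.
  by rewrite natrD mulrDl (le_trans (ler_normD _ _))// lerD.
have ab0 : (0 < a + b)%N by rewrite addn_gt0 I0.
have := KP _ _ I0 sI; have := KP _ _ J0 sJ; have := KP _ _ ab0 sIJ.
rewrite !ler_norml => /andP[l3 _] /andP[_ l2] /andP[_ l1].
have em := energy_merge r0 I0 J0 sI sJ.
have f1 := ln_fact_add R b I0; have f2 := ln_fact_le_mul R b.
have a1 : (0 : R) < a%:R by rewrite ltr0n.
have b1 : (0 : R) < b%:R by rewrite ltr0n.
have lab : D * ln (a + b)%:R <= D * (ln 2 + ln a%:R + ln b%:R).
  rewrite ler_wpM2l// -!lnM ?posrE ?mulr_gt0// ler_ln ?posrE ?mulr_gt0// ?ltr0n//.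
  rewrite -!natrM ler_nat mul2n -addnn mulnDl leq_add//; first by rewrite leq_pmulr.
  by rewrite leq_pmull.
have la : ln eta + ln n%:R <= ln a%:R.
  by rewrite -lnM ?posrE// ler_ln ?posrE// mulr_gt0.
have lb : ln b%:R < ln eta - C2 + ln n%:R.
  rewrite -[X in _ - X](expRK) -[X in _ + X + _]lnV ?posrE ?expR_gt0// -expRN.
  by rewrite -!lnM ?posrE ?mulr_gt0 ?expR_gt0// ltr_ln ?posrE ?mulr_gt0 ?expR_gt0.
apply/negP; rewrite -ltNge.
have b2 : 1 <= b%:R :> R by rewrite ler1n.
have lnab : b%:R * C2 < b%:R * (ln a%:R - ln b%:R) by rewrite ltr_pM2l//; lra.
have bC2 : D * ln 2 + 2 * (mx_size Si * r ^+ 2) * b%:R + 3 * K <= b%:R * C2.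
  have h1 : D * ln 2 <= b%:R * (D * ln 2) by rewrite ler_peMl.
  have h2 : 3 * K <= b%:R * (3 * K) by rewrite ler_peMl// mulr_ge0.
  by rewrite /C2 !mulrDr [b%:R * (2 * _)]mulrC; lra.
rewrite mulrBr in lnab; rewrite !mulrDr in lab.
move: l1 l2 l3 em f1 f2 lab lnab bC2.
move: (lw a s) (lw b t) (lw (a + b) (s + t)) (bil Si _ _ / a%:R) (bil Si _ _ / b%:R)
  (bil Si _ _ / (a + b)%:R) (ln a`!%:R) (ln b`!%:R) (ln (a + b)`!%:R)
  (D * ln a%:R) (D * ln b%:R) (D * ln (a + b)%:R) (D * ln 2)
  (b%:R * ln a%:R) (b%:R * ln b%:R) (b%:R * C2) (mx_size Si * r ^+ 2).
move=> w1 w2 w3 e1 e2 e3 g1 g2 g3 d1 d2 d3 d4 p1 p2 p3 q.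
lra.
Qed.

End cluster_sizes.

(** * Lebesgue-null sets *)

(** Uniqueness theorems for measures quantify over bundled measures; this bundles the
pushforwards to which they are applied. *)
Lemma pushforward_measure_exists d d' (T1 : measurableType d) (T2 : measurableType d')
    (R : realType) (m : {measure set T1 -> \bar R}) (f : T1 -> T2) :
  measurable_fun [set: T1] f ->
  exists m' : {measure set T2 -> \bar R}, forall A, m' A = m (f @^-1` A).
Proof.
move=> mf.
have p0 : pushforward m f set0 = 0%E by rewrite /pushforward preimage_set0 measure0.
have pge0 A : (0 <= pushforward m f A)%E by exact: measure_ge0.
have padd : semi_sigma_additive (pushforward m f).
  exact: measure_semi_sigma_additive.
pose M := isMeasure.Build _ _ _ (pushforward m f) p0 pge0 padd.
pose m' : {measure set T2 -> \bar R} := HB.pack (pushforward m f) M.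
by exists (m' mf).
Qed.

Section translation_invariance.
Variable R : realType.
Local Notation mR := (measurableTypeR R).

Lemma measurable_shift (a : R) : measurable_fun [set: mR] (fun x : mR => x + a : mR).
Proof. exact: measurable_funD. Qed.

Lemma lebesgue_measure_shift (a : R) (A : set mR) : measurable A ->
  lebesgue_measure ((fun x : mR => x + a) @^-1` A) = lebesgue_measure A.
Proof.
move=> mA.
have [m' m'E] := @pushforward_measure_exists _ _ mR mR R (@lebesgue_measure R) _ (measurable_shift a).
rewrite -m'E; apply/esym/lebesgue_measure_unique => // X /ocitvP[->|[[x y] /= xy ->]].
  by rewrite !measure0.
rewrite m'E (_ : _ @^-1` _ = `]x - a, y - a]%classic); last first.
  by apply/seteqP; split => z /=; rewrite !in_itv/= ltrBlDr lerBrDr.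
rewrite lebesgue_measure_itv/= lte_fin xy.
apply/esym; rewrite [LHS](lebesgue_measure_itv `]x - a, y - a])/= lte_fin ltrD2r xy.
by rewrite -!EFinB; congr (_%:E); lra.
Qed.

Definition shift_tuple n (v : 'I_n -> R) (t : n.-tuple mR) : n.-tuple mR :=
  [tuple tnth t i + v i | i < n].

Lemma measurable_shift_tuple n (v : 'I_n -> R) :
  measurable_fun [set: _] (shift_tuple v).
Proof.
apply/measurable_fun_tnthP => i.
rewrite (_ : _ \o _ = (fun x : mR => x + v i) \o (@tnth n mR)^~ i); last first.
  by apply/funext => t /=; rewrite tnth_mktuple.
by apply: measurableT_comp; [exact: measurable_shift|exact: measurable_tnth].
Qed.

Lemma lebesgue_tuple_shift n (v : 'I_n -> R) (A : set (n.-tuple mR)) :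
  measurable A ->
  lebesgue_tuple R n (shift_tuple v @^-1` A) = lebesgue_tuple R n A.
Proof.
elim: n v A => [|n IH] v A mA.
  congr (lebesgue_tuple R 0 _); apply/funext => t /=; congr (A _).
  by apply: eq_from_tnth => -[].
pose v' (i : 'I_n) := v (lift ord0 i).
pose g (p : mR * n.-tuple mR) : mR * n.-tuple mR := (p.1 + v ord0, shift_tuple v' p.2).
have mg : measurable_fun [set: mR * n.-tuple mR] g.
  apply/measurable_fun_pairP; split.
    by apply: (measurableT_comp (measurable_shift _)); exact: measurable_fst.
  by apply: (measurableT_comp (measurable_shift_tuple _)); exact: measurable_snd.
have gE : shift_tuple v \o @tuple_cons R n = @tuple_cons R n \o g.
  apply/funext => -[x t] /=; apply: eq_from_tnth => i.
  rewrite tnth_mktuple /tuple_cons/=.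
  case: (unliftP ord0 i) => [j|] ->.
    by rewrite !tnthS tnth_mktuple.
  by rewrite !tnth0.
have [m' m'E] := @pushforward_measure_exists _ _ (mR * n.-tuple mR)%type
  (mR * n.-tuple mR)%type R (@lebesgue_measure R \x lebesgue_tuple R n)%E g mg.
rewrite /= /lebesgue_cons /pushforward -comp_preimage gE comp_preimage -m'E.
apply/esym; apply: product_measure_unique; last first.
  by rewrite -[X in measurable X]setTI; apply: measurable_tuple_cons.
move=> B C mB mC; rewrite m'E (_ : g @^-1` _ =
    ((fun x : mR => x + v ord0) @^-1` B) `*` (shift_tuple v' @^-1` C)); last first.
  by apply/seteqP; split => -[x t].
apply: etrans; first apply: product_measure1E; last first.
- by congr (_ * _)%E; [exact: lebesgue_measure_shift|exact: IH].
- by rewrite -[X in measurable X]setTI; apply: measurable_shift_tuple.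
- by rewrite -[X in measurable X]setTI; apply: measurable_shift.
Qed.

Lemma lebesgue_tuple_cube_fin n (r : R) :
  (lebesgue_tuple R n [set t : n.-tuple mR | forall i, (`|tnth t i| <= r)%R] < +oo)%E.
Proof.
elim: n => [|n IH].
  by rewrite /= diracE; case: (_ \in _); rewrite ltry.
have mc : measurable [set t : n.-tuple mR | forall i, `|tnth t i| <= r].
  rewrite (_ : [set _ | _] = \bigcap_(i in [set: 'I_n]) ((@tnth n mR)^~ i @^-1` `[-r, r])).
    apply: fin_bigcap_measurable => // i _; rewrite -[X in measurable X]setTI.
    by apply: measurable_tnth => //; exact: measurable_itv.
  apply/seteqP; split => t /= h i; first by move=> _ /=; rewrite in_itv/= -ler_norml.
  by have := h i I; rewrite /= in_itv/= -ler_norml.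
rewrite /= /lebesgue_cons /pushforward (_ : _ @^-1` _ =
    `[-r, r]%classic `*` [set t | forall i, `|tnth t i| <= r]); last first.
  apply/seteqP; split => -[x t] /=.
    move=> h; rewrite in_itv/= -ler_norml; split; first by have := h ord0; rewrite tnth0.
    by move=> i; have := h (lift ord0 i); rewrite tnthS.
  rewrite in_itv/= -ler_norml => -[xr tr] i.
  case: (unliftP ord0 i) => [j|] ->; rewrite ?tnthS ?tnth0//.
rewrite product_measure1E//.
rewrite lte_mul_pinfty//.
  rewrite ge0_fin_numE//; have /= -> := @lebesgue_measure_itv R `[-r, r].
  by case: ifP; rewrite ?ltry.
Qed.

End translation_invariance.

Section null_sets.
Variables (R : realType) (d : nat).
Local Notation mR := (measurableTypeR R).
Local Notation lambda := (@lebesgue_vector R d).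

Lemma open_measurable_mx m n (U : set 'M[R]_(m, n)) : open U -> measurable U.
Proof. by move=> oU; exact: sub_sigma_algebra. Qed.

Lemma closed_measurable_mx m n (U : set 'M[R]_(m, n)) : closed U -> measurable U.
Proof.
move=> cU; rewrite -[U]classical_sets.setCK; apply: measurableC.
by apply: open_measurable_mx; exact: closed_openC.
Qed.

Lemma continuous_measurable_mx m n (f : 'M[R]_(m, n) -> 'M[R]_(m, n)) :
  continuous f -> measurable_fun [set: _] f.
Proof.
move=> cf; apply: (measurability _ (erefl : @measurable _ 'M[R]_(m, n) = <<s @open 'M[R]_(m, n) >>)).
move=> _ [U oU <-]; rewrite setTI; apply: open_measurable_mx.
by move/continuousP : cf; apply.
Qed.

Lemma lebesgue_vector_shift (v : 'cV[R]_d) (A : set 'cV[R]_d) : measurable A ->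
  lambda ((fun x => x + v) @^-1` A) = lambda A.
Proof.
move=> mA; rewrite /lebesgue_vector /pushforward -comp_preimage.
have -> : (fun x => x + v) \o @col_of_tuple R d =
    @col_of_tuple R d \o shift_tuple (fun i => v i 0).
  by apply/funext => t; apply/colP => i; rewrite !mxE tnth_mktuple.
rewrite comp_preimage; apply: lebesgue_tuple_shift.
by rewrite -[X in measurable X]setTI; apply: measurable_col_of_tuple.
Qed.

Lemma lebesgue_vector_bounded (A : set 'cV[R]_d) (r : R) : measurable A ->
  (forall x, A x -> `|x| <= r) -> (lambda A < +oo)%E.
Proof.
move=> mA Ar.
apply: le_lt_trans (lebesgue_tuple_cube_fin d r).
rewrite /lebesgue_vector /pushforward; apply: le_measure; rewrite ?inE.
- by rewrite -[X in measurable X]setTI; apply: measurable_col_of_tuple.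
- rewrite (_ : [set _ | _] = \bigcap_(i in [set: 'I_d]) ((@tnth d mR)^~ i @^-1` `[-r, r])).
    apply: fin_bigcap_measurable => // i _; rewrite -[X in measurable X]setTI.
    by apply: measurable_tnth => //; exact: measurable_itv.
  apply/seteqP; split => t /= h i; first by move=> _ /=; rewrite in_itv/= -ler_norml.
  by have := h i I; rewrite /= in_itv/= -ler_norml.
- move=> t /= /Ar h i; have := entry_le_norm (col_of_tuple t) i 0.
  by rewrite mxE => /le_trans; apply.
Qed.

(** A bounded set that misses all its small translates in one direction has
infinitely many disjoint translates inside a bounded set, all of the same
measure. *)
Lemma slide_null (E : set 'cV[R]_d) (r eps : R) (v : 'cV[R]_d) :
  measurable E -> (forall x, E x -> `|x| <= r) -> 0 < eps ->
  (forall x t, E x -> 0 < t < eps -> ~ E (x + t *: v)) -> lambda E = 0%E.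
Proof.
move=> mE Er eps0 Ev.
pose t (j : nat) : R := eps / j.+2%:R.
have t0 j : 0 < t j by rewrite divr_gt0.
have teps j : t j < eps.
  by rewrite ltr_pdivrMr// ltr_pMr// ltr1n.
have tanti i j : (i < j)%N -> 0 < t i - t j < eps.
  move=> ij; rewrite subr_gt0 ltr_pM2l// ltf_pV2 ?posrE// ltr_nat !ltnS ij/=.
  by have := t0 j; have := teps i; lra.
pose F j := (fun x => x + - (t j *: v)) @^-1` E.
have mF j : measurable (F j).
  rewrite -[X in measurable X]setTI; apply: continuous_measurable_mx => //.
  by move=> x; apply: (@continuousD _ _ _ id (cst _)); [exact: cvg_id|exact: cst_continuous].
have FE j : lambda (F j) = lambda E by exact: lebesgue_vector_shift.
have key i j x : (i < j)%N -> F i x -> F j x -> False.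
  rewrite /F /= => ij Fi Fj; apply: (Ev _ _ Fi (tanti _ _ ij)).
  by rewrite scalerBl addrA subrK.
have tF : trivIset [set: nat] F.
  apply/trivIsetP => i j _ _ ij; apply/seteqP; split => // x [Fi Fj].
  by move: ij; rewrite neq_ltn => /orP[/key|/key]; apply; eauto.
pose B := [set x : 'cV[R]_d | `|x| <= r + eps * `|v|].
have mB : measurable B.
  apply: closed_measurable_mx.
  apply: (@closed_comp _ _ (fun x : 'cV[R]_d => `|x|) [set y | y <= r + eps * `|v|]).
    by move=> x _; exact: norm_continuous.
  exact: closed_le.
have FB j : F j `<=` B.
  move=> x /= /Er; rewrite /B/= => h.
  rewrite -[x](subrK (t j *: v)) (le_trans (ler_normD _ _))// lerD//.
  by rewrite normrZ gtr0_norm// ler_wpM2r// ltW.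
have Bfin : (lambda B < +oo)%E by apply: (@lebesgue_vector_bounded _ (r + eps * `|v|)).
have nE n : (lambda E *+ n <= lambda B)%E.
  have <- : lambda (\big[setU/set0]_(i < n) F i) = (lambda E *+ n)%E.
    rewrite measure_semi_additive_ord_I//.
    - rewrite (eq_bigr (fun=> lambda E)); last by move=> i _; exact: FE.
      by rewrite big_const_ord iter_addr_0.
    - exact: sub_trivIset tF.
    - by apply: bigsetU_measurable => i _; exact: mF.
  apply: le_measure; rewrite ?inE//.
    by apply: bigsetU_measurable => i _; exact: mF.
  by rewrite -bigcup_mkord => x [i _ /FB].
have Efin : lambda E \is a fin_num.
  by rewrite ge0_fin_numE// (le_lt_trans (nE 1%N))// mule1n.
have Bfn : lambda B \is a fin_num by rewrite ge0_fin_numE.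
apply/eqP; rewrite eq_le measure_ge0 andbT leNgt; apply/negP => E0.
have e0 : 0 < fine (lambda E) by rewrite fine_gt0// E0 ltey_eq Efin.
have := nE (Num.truncn (fine (lambda B) / fine (lambda E))).+1.
rewrite -(fineK Efin) -(fineK Bfn) -EFin_natmul lee_fin leNgt => /negP; apply.
rewrite -mulr_natr mulrC -ltr_pdivrMr//; exact: truncnS_gt.
Qed.

End null_sets.

(** * Support points surrounded by mass *)

Section rational_balls.
Variables (R : realType) (d : nat).

Definition rball (q : 'cV[rat]_d * rat) : set 'cV[R]_d :=
  ball (\col_i ratr (q.1 i 0) : 'cV[R]_d) (ratr q.2).

Lemma rball_open q : open (rball q).
Proof.
rewrite /rball; have [q0|q0] := ltP 0 (ratr q.2 : R); first exact: ball_open.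
rewrite (_ : ball _ _ = set0); first exact: open0.
by apply/seteqP; split => // y [] /(le_lt_trans q0); rewrite ltxx.
Qed.

Lemma open_rball (U : set 'cV[R]_d) x : open U -> U x ->
  exists q, rball q x /\ rball q `<=` U.
Proof.
move=> oU Ux.
have /nbhs_ballP[e /= e0 eU] : nbhs x U by exact: open_nbhs_nbhs.
have [r] := rat_in_itvoo (divr_gt0 e0 (ltr0n R 2)).
rewrite in_itv/= => /andP[r0 re].
have /choice[c cP] : forall i : 'I_d, exists q : rat, `|x i 0 - ratr q| < ratr r.
  move=> i; have [|q] := @rat_in_itvoo R (x i 0 - ratr r) (x i 0); first by lra.
  rewrite in_itv/= => /andP[q1 q2].
  by exists q; rewrite gtr0_norm; lra.
exists (\col_i c i, r); split; last first.
  move=> y [_ ry]; apply: eU; split => // i j; rewrite ord1.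
  have := ry i 0; rewrite !mxE /ball/= => ryi.
  have -> : x i 0 - y i 0 = (x i 0 - ratr (c i)) + (ratr (c i) - y i 0) by lra.
  by rewrite (le_lt_trans (ler_normD _ _))//; have := cP i; lra.
split => // i j; rewrite ord1 !mxE /ball/= distrC; exact: cP.
Qed.

Lemma negligible_bigcup_countable dT (T : measurableType dT)
    (mu : {measure set T -> \bar R}) (I : countType) (F : I -> set T) :
  (forall i, mu.-negligible (F i)) -> mu.-negligible (\bigcup_i F i).
Proof.
move=> nF; pose G n := if @choice.unpickle I n is Some i then F i else set0.
apply: (@negligibleS _ _ _ _ (\bigcup_n G n)).
  by move=> x [i _ Fix]; exists (choice.pickle i) => //; rewrite /G choice.pickleK.
apply: negligible_bigcup => n; rewrite /G; case: choice.unpickle => [i|]; first exact: nF.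
exact: negligible_set0.
Qed.

End rational_balls.

Lemma measurable_rball (R : realType) d (q : 'cV[rat]_d * rat) : measurable (rball q : set 'cV[R]_d).
Proof. by apply: open_measurable_mx; exact: rball_open. Qed.

Section absolutely_continuous.
Variables (R : realType) (d : nat) (P : probability 'cV[R]_d R).
Hypothesis P_bounded : bounded_set (msupport P).
Hypothesis P_ac : P `<< @lebesgue_vector R d.
Local Notation S := (msupport P).
Implicit Types (x y v w : 'cV[R]_d).

Lemma support_open U x : open U -> S x -> U x -> (0 < P U)%E.
Proof. by move=> oU Sx Ux; apply: Sx. Qed.

Lemma support_closed : closed S.
Proof.
move=> x Sx U oU Ux.
have [y [Sy Uy]] : S `&` U !=set0 by apply: Sx; exact: open_nbhs_nbhs.
exact: support_open Sy Uy.
Qed.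

(** A point outside the support has a null rational ball around it, and the rational
balls are countably many. *)
Lemma support_full : P.-negligible (~` S).
Proof.
pose F q : set 'cV[R]_d := if `[< P (rball q) = 0%E >] then rball q else set0.
apply: (@negligibleS _ _ _ _ (\bigcup_q F q)); last first.
  apply: negligible_bigcup_countable => q; rewrite /F; case: ifPn => [/asboolP Pq|_].
    exact/(negligibleP P (@measurable_rball R d q)).
  exact: negligible_set0.
move=> x /existsNP[U /not_implyP[oU /not_implyP[Ux PU]]].
have [q [qx qU]] := open_rball oU Ux.
exists q => //; rewrite /F ifT//; apply/asboolP/eqP.
rewrite eq_le measure_ge0 andbT leNgt; apply/negP => Pq; apply: PU.
apply: (lt_le_trans Pq); apply: le_measure => //; rewrite inE.
  exact: measurable_rball.
exact: open_measurable_mx.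
Qed.

Lemma support_bound : exists2 r : nat, (0 < r)%N & forall x, S x -> `|x| <= r%:R.
Proof.
have [M [_ MP]] := P_bounded.
exists (Num.truncn `|M|).+1 => // x Sx; apply: MP => //.
by apply: le_lt_trans (ler_norm _) _; exact: truncnS_gt.
Qed.

Lemma ac_null E : measurable E -> lebesgue_vector E = 0%E -> P E = 0%E.
Proof.
by move=> mE E0; apply/(measure0_null_setP P mE)/P_ac/measure0_null_setP.
Qed.

(** Lebesgue measure sees such a set, cut down to the bounded support, as a null set. *)
Lemma slide_negligible (E : set 'cV[R]_d) (eps : R) v : closed E -> 0 < eps ->
  (forall x t, S x -> E x -> 0 < t < eps -> S (x + t *: v) -> ~ E (x + t *: v)) ->
  P.-negligible E.
Proof.
move=> cE eps0 Ev; have [r _ rP] := support_bound.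
apply: (@negligibleS _ _ _ _ ((S `&` E) `|` ~` S)).
  by move=> x Ex; have [Sx|Sx] := pselect (S x); [left|right].
apply: negligibleU support_full.
have mSE : measurable (S `&` E).
  by apply: closed_measurable_mx; apply: closedI => //; exact: support_closed.
apply/negligibleP => //; apply: ac_null => //.
apply: (@slide_null _ _ _ r%:R eps v) => //; first by move=> x [/rP].
by move=> x t [Sx Ex] te [Sxt]; apply: Ev.
Qed.

Lemma dot_continuous w : continuous (@dot R d w).
Proof.
move=> x; apply/(@cvgrPdist_lt R R _ (nbhs (x : 'cV[R]_d)) _ (@dot R d w)) => e e0.
have k0 : 0 < d%:R * `|w| + 1 by rewrite ltr_wpDl// mulr_ge0.
near=> y; rewrite -dotB (le_lt_trans (dot_le _ _))// mulrA.
apply: (@le_lt_trans _ _ ((d%:R * `|w| + 1) * `|x - y|)).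
  by rewrite ler_wpM2r// lerDl.
rewrite mulrC -ltr_pdivlMr//; near: y.
by apply: cvgr_dist_lt; [exact: cvg_id|rewrite divr_gt0].
Unshelve. all: by end_near. Qed.

(** A hyperplane misses its translates along its normal vector. *)
Lemma hyperplane_negligible w c : w != 0 -> P.-negligible [set x | dot w x = c].
Proof.
move=> w0; apply: (@slide_negligible _ 1 w) => //.
  apply: (@closed_comp _ _ (dot w) [set y | y = c]); last exact: closed_eq.
  by move=> x _; exact: dot_continuous.
move=> x t _ /= xc /andP[t0 _] _; rewrite dotD dotZ xc => /eqP.
rewrite -subr_eq0 addrC addKr mulf_eq0 gt_eqF//= => /eqP ww.
have : `|w| ^+ 2 <= 0.
  by rewrite -ww (le_trans (norm_le_enorm _))// enormE /bil mulmx1 dot_self /dot.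
by rewrite le_eqVlt ltNge sqr_ge0 orbF sqrf_eq0 normr_eq0 (negbTE w0).
Qed.

Definition corner (s : {ffun 'I_d -> bool}) (eps : R) x : set 'cV[R]_d :=
  [set y | forall i, 0 < (-1) ^+ (s i) * (y i 0 - x i 0) < eps].

Lemma open_box (f : 'I_d -> 'cV[R]_d -> R) (eps : R) :
  (forall i, continuous (f i)) -> open [set y | forall i, 0 < f i y < eps].
Proof.
move=> cf; rewrite openE => y /= fy; rewrite /interior.
apply: (@filter_forall _ _ (fun i => [set z | 0 < f i z < eps]) (nbhs (y : 'cV[R]_d))) => i.
have : open (f i @^-1` `]0, eps[%classic).
  by move/continuousP : (cf i); apply; exact: interval_open.
rewrite openE => /(_ y); rewrite /= in_itv/= => /(_ (fy i)).
by apply: filterS => z /=; rewrite in_itv.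
Qed.

Lemma corner_open s eps x : open (corner s eps x).
Proof.
apply: (open_box (f := fun i y => (-1) ^+ (s i) * (y i 0 - x i 0))) => i y.
apply: (@continuousM R _ (cst _) (fun y : 'cV[R]_d => y i 0 - x i 0)); first exact: cst_continuous.
by apply: (@continuousB R R _ (fun y : 'cV[R]_d => y i 0) (cst _));
  [exact: coord_continuous|exact: cst_continuous].
Qed.

Lemma corner_openl s eps y : open [set x | corner s eps x y].
Proof.
apply: (open_box (f := fun i x => (-1) ^+ (s i) * (y i 0 - x i 0))) => i x.
apply: (@continuousM R _ (cst _) (fun x : 'cV[R]_d => y i 0 - x i 0)); first exact: cst_continuous.
by apply: (@continuousB R R _ (cst _) (fun x : 'cV[R]_d => x i 0));
  [exact: cst_continuous|exact: coord_continuous].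
Qed.

(** At every scale each corner contains a charged ball. The margin [delta] keeps the
ball in the corners of nearby points, which is what later puts a whole
neighbourhood, and not just one point, into a convex hull. *)
Definition full_point x := S x /\ forall (s : {ffun 'I_d -> bool}) eps, 0 < eps ->
  exists q delta, [/\ 0 < delta,
    forall z i, rball q z -> delta < (-1) ^+ (s i) * (z i 0 - x i 0) < eps &
    (0 < P (rball q))%E].

(** The support points with an empty corner form a set that cannot meet its
translates along the diagonal of that corner. *)
Lemma full_point_ae : P.-negligible (~` full_point).
Proof.
pose E (sk : {ffun 'I_d -> bool} * nat) : set 'cV[R]_d :=
  S `&` ~` [set x | exists2 y, corner sk.1 (sk.2.+1%:R^-1) x y & S y].
have nE sk : P.-negligible (E sk).
  case: sk => s k; rewrite /E/=.
  have k0 : (0 : R) < k.+1%:R^-1 by rewrite invr_gt0.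
  apply: (@slide_negligible _ k.+1%:R^-1 (\col_i (-1) ^+ (s i))) => //.
    apply: closedI; first exact: support_closed.
    apply: open_closedC; rewrite (_ : [set x | _] =
        \bigcup_(y in S) [set x | corner s k.+1%:R^-1 x y]).
      by apply: bigcup_open => y _; exact: corner_openl.
    by apply/seteqP; split => x; [move=> [y ? ?]; exists y|move=> [y ? ?]; exists y].
  move=> x t Sx [_ Ex] tk Sxt _; apply: Ex; exists (x + t *: \col_i (-1) ^+ s i) => //.
  move=> i; rewrite !mxE addrAC subrr add0r mulrCA -expr2 sqrr_sign mulr1.
  exact: tk.
apply: (@negligibleS _ _ _ _ (~` S `|` \bigcup_sk E sk)); last first.
  by apply: negligibleU support_full _; exact: negligible_bigcup_countable.
move=> x nx; have [Sx|] := pselect (S x); last by left.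
right; apply: contrapT => nEx; apply: nx; split => // s eps eps0.
pose k := Num.truncn eps^-1.
have keps : k.+1%:R^-1 <= eps.
  by rewrite invf_ple ?posrE// ltW// truncnS_gt.
have [y xy Sy] : exists2 y, corner s (k.+1%:R^-1) x y & S y.
  by apply: contrapT => h; apply: nEx; exists (s, k).
have := @corner_open s k.+1%:R^-1 x.
rewrite openE => /(_ y xy)/nbhs_ballP[e /= e0 eU].
have e20 : 0 < e / 2 by rewrite divr_gt0.
have [q [qy qU]] := @open_rball _ _ (ball y (e / 2)) y (ball_open y (e / 2)) (ballxx _ e20).
exists q, (e / 2); split => //; last first.
  by apply: (support_open _ Sy qy); exact: rball_open.
move=> z i /qU[_ yz].
have /andP[_ h2] : 0 < (-1) ^+ s i * (z i 0 - x i 0) < k.+1%:R^-1.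
  apply: (eU z); split=> // i' j'; apply: le_ball (yz i' j').
  by rewrite ler_piMr ?(ltW e0)//; lra.
rewrite (lt_le_trans h2 keps) andbT.
(* Moving [z] by [e / 2] towards the vertex of the corner does not leave the
   corner, hence the margin. *)
pose z' : 'cV[R]_d := z - (e / 2) *: \col_i (-1) ^+ s i.
have /(_ i)/andP[h1 _] : corner s k.+1%:R^-1 x z'.
  apply: eU; split=> // i' j'; rewrite !mxE /ball/= opprB addrCA.
  have := yz i' j'; rewrite /ball/= => h.
  rewrite (le_lt_trans (ler_normD _ _))// normrM normrX normrN1 expr1n mulr1.
  by rewrite gtr0_norm//; lra.
move: h1; rewrite !mxE addrAC mulrBr mulrCA -expr2 sqrr_sign mulr1.
by rewrite subr_gt0.
Qed.

End absolutely_continuous.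

(** * Convex hulls of finite samples *)

Lemma lipschitz_continuous (R : realType) (V W : normedModType R) (f : V -> W) (k : R) :
  (forall u v, `|f u - f v| <= k * `|u - v|) -> continuous f.
Proof.
move=> fk x; apply/cvgrPdist_lt => e e0.
have k0 : 0 < `|k| + 1 by rewrite ltr_wpDl.
near=> y; apply: (le_lt_trans (fk x y)).
apply: (@le_lt_trans _ _ ((`|k| + 1) * `|x - y|)).
  by rewrite ler_wpM2r// (le_trans (ler_norm _))// lerDl.
rewrite mulrC -ltr_pdivlMr//; near: y.
by apply: cvgr_dist_lt; [exact: cvg_id|rewrite divr_gt0].
Unshelve. all: by end_near. Qed.

Section convex_hulls.
Variables (R : realType) (d : nat).
Implicit Types (C : set 'cV[R]_d) (x y w : 'cV[R]_d).

Local Notation hull := (smallest (@convex_set R 'cV[R]_d)).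

Lemma convex_setP C : @convex_set R 'cV[R]_d C <->
  forall x y t, 0 <= t <= 1 -> C x -> C y -> C (t *: x + (1 - t) *: y).
Proof.
split=> cC x y t.
  move=> /andP[t0 t1] Cx Cy.
  have := cC x y (Itv01 t0 t1); rewrite !inE => /(_ Cx Cy).
  by [].
rewrite !inE => Cx Cy; apply: (cC x y t%:inum) => //.
by apply/andP; split; [exact: ge0|exact: le1].
Qed.

Lemma hull_convex A : @convex_set R 'cV[R]_d (hull A).
Proof.
apply/convex_setP => x y t t01 hx hy C /= [cC AC].
move/convex_setP: (cC); apply => //; [exact: hx|exact: hy].
Qed.

Lemma halfspace_convex w c : @convex_set R 'cV[R]_d [set x | c <= dot w x].
Proof.
apply/convex_setP => x y t /andP[t0 t1] /= cx cy; rewrite dotD !dotZ.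
have := ler_wpM2l t0 cx; have := @ler_wpM2l _ (1 - t) _ _ _ cy.
by rewrite subr_ge0 => /(_ t1); lra.
Qed.

Lemma halfspace_convex_le w c : @convex_set R 'cV[R]_d [set x | dot w x <= c].
Proof.
apply/convex_setP => x y t /andP[t0 t1] /= cx cy; rewrite dotD !dotZ.
have := ler_wpM2l t0 cx; have := @ler_wpM2l _ (1 - t) _ _ _ cy.
by rewrite subr_ge0 => /(_ t1); lra.
Qed.

(** A convex set that has a point in each open orthant around [x] contains [x]:
the coordinates can be matched one at a time, each time on a segment that joins
two orthants differing in that coordinate only. *)
Lemma orthants_mem C x (y : {ffun 'I_d -> bool} -> 'cV[R]_d) :
  @convex_set R 'cV[R]_d C -> (forall s, C (y s)) ->
  (forall (s : {ffun 'I_d -> bool}) i, 0 < (-1) ^+ (s i) * (y s i 0 - x i 0)) -> C x.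
Proof.
move=> /convex_setP cC Cy yx.
have key k : (k <= d)%N -> forall s : {ffun 'I_d -> bool}, exists2 z, C z &
    forall i : 'I_d, ((i < k)%N -> z i 0 = x i 0) /\
      ((k <= i)%N -> 0 < (-1) ^+ (s i) * (z i 0 - x i 0)).
  elim: k => [_ s|k IH kd s]; first by exists (y s) => // i; split.
  pose k0 := Ordinal kd.
  pose sp b : {ffun 'I_d -> bool} := [ffun i => if i == k0 then b else s i].
  have [p Cp pP] := IH (ltnW kd) (sp false).
  have [q Cq qP] := IH (ltnW kd) (sp true).
  have := (pP k0).2 (leqnn _); have := (qP k0).2 (leqnn _).
  rewrite !ffunE eqxx expr0 expr1 mul1r mulN1r opprB.
  set a := p k0 0 - x k0 0; set b := x k0 0 - q k0 0 => b0 a0.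
  have ab0 : 0 < a + b by rewrite addr_gt0.
  pose t := b / (a + b).
  have t0 : 0 < t by rewrite divr_gt0.
  have tE : 1 - t = a / (a + b) by rewrite /t; field; exact: lt0r_neq0.
  have t1 : 0 < 1 - t by rewrite tE divr_gt0.
  exists (t *: p + (1 - t) *: q).
    by apply: cC => //; rewrite ltW//=; lra.
  move=> i; rewrite !mxE; split.
    rewrite ltnS leq_eqVlt => /predU1P[ik|ik].
      have -> : i = k0 by exact: val_inj.
      have -> : p k0 0 = a + x k0 0 by rewrite /a subrK.
      have -> : q k0 0 = x k0 0 - b by rewrite /b opprB addrCA subrr addr0.
      have : t * a = (1 - t) * b by rewrite tE /t; field; exact: lt0r_neq0.
      lra.
    by rewrite (pP i).1// (qP i).1// -mulrDl addrCA subrr addr0 mul1r.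
  move=> ki; have nik : i != k0 by rewrite -val_eqE /= gtn_eqF.
  have := (pP i).2 (ltnW ki); have := (qP i).2 (ltnW ki).
  rewrite !ffunE (negbTE nik) => h1 h2.
  have := mulr_gt0 t0 h2; have := mulr_gt0 t1 h1.
  set e := (-1) ^+ _; move: (p i 0) (q i 0) (x i 0) => u v z.
  have -> : e * (t * u + (1 - t) * v - z) = t * (e * (u - z)) + (1 - t) * (e * (v - z)) by ring.
  by move=> *; apply: addr_gt0.
have [z Cz zP] := key d (leqnn _) [ffun=> false].
have -> : x = z by apply/colP => i; rewrite (zP i).1.
by [].
Qed.

(** By induction on the number of points: one weight is split off and the others are
rescaled. *)
Lemma convex_combination n (f : 'I_n -> 'cV[R]_d) C : @convex_set R 'cV[R]_d C ->
  forall (J : {set 'I_n}) (c : 'I_n -> R), (forall j, j \in J -> C (f j)) ->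
  (forall j, 0 <= c j) -> (forall j, j \notin J -> c j = 0) ->
  \sum_j c j = 1 -> C (\sum_j c j *: f j).
Proof.
move=> /convex_setP cC J; have [m] := ubnP #|J|.
elim: m J => // m IH J Jm c CJ c0 cJ c1.
have [j0 cj0] : exists j0, c j0 != 0.
  apply/existsP; rewrite -[X in is_true X]negbK negb_exists; apply/negP => /forallP h.
  by move: c1; rewrite big1 => [/eqP|j _]; [rewrite eq_sym oner_eq0|exact/eqP/negPn/h].
have j0J : j0 \in J by apply: contraNT cj0 => /cJ ->.
have cE : c j0 + \sum_(j | j != j0) c j = 1 by rewrite -c1 [RHS](bigD1 j0).
have [e1|ne1] := eqVneq (c j0) 1.
  have z j : j != j0 -> c j = 0.
    move: cE; rewrite e1 => /eqP; rewrite -subr_eq0 addrAC subrr add0r psumr_eq0//.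
    by move=> /allP h jj0; apply/eqP; apply: (implyP (h j (mem_index_enum _))).
  rewrite (bigD1 j0)//= big1 ?addr0 ?e1 ?scale1r; first exact: CJ.
  by move=> j jj0; rewrite z// scale0r.
have lt1 : c j0 < 1.
  rewrite lt_neqAle ne1 -cE lerDl; exact: sumr_ge0.
have gt0 : 0 < 1 - c j0 by lra.
pose c' j := if j == j0 then 0 else c j / (1 - c j0).
have -> : \sum_j c j *: f j = c j0 *: f j0 + (1 - c j0) *: \sum_j c' j *: f j.
  rewrite (bigD1 j0)//=; congr (_ + _).
  rewrite [in RHS](bigD1 j0)//= {1}/c' eqxx scale0r add0r scaler_sumr.
  apply: eq_bigr => j jj0; rewrite /c' (negbTE jj0) scalerA mulrC divfK//.
  by rewrite gt_eqF.
apply: cC; first by rewrite c0 ltW.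
  exact: CJ.
apply: (IH (J :\ j0)%SET).
- by move: Jm; rewrite (cardsD1 j0) j0J ltnS.
- by move=> j; rewrite !inE => /andP[_]; exact: CJ.
- by move=> j; rewrite /c'; case: eqP => // _; rewrite divr_ge0// ltW.
- move=> j; rewrite !inE negb_and negbK /c'; case: eqP => //= _ jJ.
  by rewrite cJ// mul0r.
- rewrite (bigD1 j0)//= {1}/c' eqxx add0r.
  rewrite (eq_bigr (fun j => c j / (1 - c j0))); last first.
    by move=> j jj0; rewrite /c' (negbTE jj0).
  by rewrite -mulr_suml -[X in X / _](addKr (c j0)) cE addrC divff// gt_eqF.
Qed.

(** The hull is the continuous image of a simplex, which is compact. *)
Lemma hull_finite_closed n (f : 'I_n -> 'cV[R]_d) (J : {set 'I_n}) :
  closed (hull [set f j | j in [set` J]]).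
Proof.
pose Delta : set 'rV[R]_n :=
  [set c | [/\ forall j, 0 <= c 0 j, forall j, j \notin J -> c 0 j = 0 & \sum_j c 0 j = 1]].
pose g (c : 'rV[R]_n) : 'cV[R]_d := \sum_j c 0 j *: f j.
have -> : hull [set f j | j in [set` J]] = g @` Delta.
  apply/seteqP; split.
    apply: smallest_sub.
      apply/convex_setP => _ _ t /andP[t0 t1] [c [c0 cJ c1] <-] [e [e0 eJ e1] <-].
      exists (t *: c + (1 - t) *: e).
        split=> [j|j jJ|]; first by rewrite !mxE addr_ge0 ?mulr_ge0// subr_ge0.
          by rewrite !mxE cJ// eJ// !mulr0 addr0.
        rewrite (eq_bigr (fun j => t * c 0 j + (1 - t) * e 0 j)); last by move=> j _; rewrite !mxE.
        by rewrite big_split/= -!mulr_sumr c1 e1; lra.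
      rewrite /g !scaler_sumr -big_split; apply: eq_bigr => j _.
      by rewrite /= !scalerA -scalerDl !mxE.
    move=> _ [j /= jJ <-]; exists (delta_mx 0 j).
      split=> [k|k kJ|]; first by rewrite mxE eqxx; case: eqP.
        by rewrite mxE eqxx; case: eqP => // kj; rewrite kj jJ in kJ.
      rewrite (bigD1 j)//= big1 ?addr0 ?mxE ?eqxx// => k kj.
      by rewrite mxE eqxx (negbTE kj).
    rewrite /g (bigD1 j)//= big1 ?addr0 ?mxE ?eqxx ?scale1r// => k kj.
    by rewrite mxE eqxx (negbTE kj) scale0r.
  move=> _ [c [c0 cJ c1] <-]; apply: (@convex_combination n f _ _ J (fun j => c 0 j)) => //.
    exact: hull_convex.
  by move=> j jJ C [_]; apply; exists j.
have cg : continuous g.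
  apply: (@lipschitz_continuous R _ _ _ (\sum_j `|f j|)) => c e.
  rewrite /g -sumrB (le_trans (ler_norm_sum _ _ _))// mulr_suml ler_sum// => j _.
  rewrite -scalerBl normrZ mulrC ler_wpM2l//.
  by have := entry_le_norm (c - e) 0 j; rewrite !mxE.
apply: compact_closed; first exact: norm_hausdorff.
apply: continuous_compact; first by apply: continuous_subspaceT.
apply: bounded_closed_compact.
  exists 1; split => // M M1 c [c0 cJ c1]; apply: (@le_trans _ _ 1); last exact: ltW.
  apply: norm_le_entry => // i j; rewrite ord1 ger0_norm// -c1 (bigD1 j)//= lerDl.
  exact: sumr_ge0.
have coordc (j : 'I_n) : continuous (fun c : 'rV[R]_n => c 0 j).
  apply: (@lipschitz_continuous R 'rV[R]_n R _ 1) => c e; rewrite mul1r.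
  by have := entry_le_norm (c - e) 0 j; rewrite !mxE.
have -> : Delta = \bigcap_(j in [set: 'I_n]) [set c | 0 <= c 0 j] `&`
    \bigcap_(j in [set j | j \notin J]) [set c | c 0 j = 0] `&`
    [set c | \sum_j c 0 j = 1].
  apply/seteqP; split => [c [c0 cJ c1]|c [[c0 cJ] c1]].
    by split => //; split => j ?; [exact: c0|exact: cJ].
  by split => [j|j|//]; [exact: c0|exact: cJ].
apply: closedI; first apply: closedI.
- apply: closed_bigI => j _.
  apply: (@closed_comp _ _ (fun c : 'rV[R]_n => c 0 j) [set y | 0 <= y]); last exact: closed_ge.
  by move=> c _; exact: coordc.
- apply: closed_bigI => j _.
  apply: (@closed_comp _ _ (fun c : 'rV[R]_n => c 0 j) [set y | y = 0]); last exact: closed_eq.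
  by move=> c _; exact: coordc.
- apply: (@closed_comp _ _ (fun c : 'rV[R]_n => \sum_j c 0 j) [set y | y = 1]); last exact: closed_eq.
  move=> c _; apply: (@lipschitz_continuous R 'rV[R]_n R _ n%:R) => {}c e.
  rewrite -sumrB (le_trans (ler_norm_sum _ _ _))// mulr_natl -[X in _ *+ X]card_ord -sumr_const ler_sum// => j _.
  by have := entry_le_norm (c - e) 0 j; rewrite !mxE.
Qed.

End convex_hulls.

(** * Frequencies and means of samples *)

Section bounded_integrals.
Variables (R : realType) (d : nat) (P : probability 'cV[R]_d R).
Local Notation S := (msupport P).
Local Notation pr := (prob P).
Implicit Types (A B D : set 'cV[R]_d) (f g : 'cV[R]_d -> R).

Lemma prob_fin A : measurable A -> P A \is a fin_num.
Proof. exact: fin_num_measure. Qed.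

Lemma prob_lty A : measurable A -> (P A < +oo)%E.
Proof. by move=> mA; rewrite -ge0_fin_numE// prob_fin. Qed.

Lemma probE A : measurable A -> P A = (pr A)%:E.
Proof. by move=> mA; rewrite fineK// prob_fin. Qed.

Lemma prob_ge0 A : 0 <= pr A.
Proof. exact/fine_ge0/measure_ge0. Qed.

Lemma prob_le A B : measurable A -> measurable B -> A `<=` B -> pr A <= pr B.
Proof.
by move=> mA mB AB; rewrite -lee_fin -!probE// le_measure// inE.
Qed.

Lemma prob_setU A B : measurable A -> measurable B -> A `&` B = set0 ->
  pr (A `|` B) = pr A + pr B.
Proof.
move=> mA mB AB; apply/EFin_inj; rewrite EFinD -!probE//; last exact: measurableU.
by rewrite measureU.
Qed.

Lemma prob_setID A B : measurable A -> measurable B ->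
  pr A = pr (A `&` B) + pr (A `\` B).
Proof.
move=> mA mB; rewrite -prob_setU ?setUIDK//.
- exact: measurableI.
- exact: measurableD.
- by rewrite setDE setIACA setICr setI0.
Qed.

Lemma prob_setT : pr setT = 1.
Proof. by rewrite /prob probability_setT. Qed.

Lemma prob_setC A : measurable A -> pr (~` A) = 1 - pr A.
Proof.
move=> mA; rewrite -prob_setT (prob_setID measurableT mA) setTI setTD.
by rewrite addrC addKr.
Qed.

Lemma bigcup_ord m (F : 'I_m -> set 'cV[R]_d) :
  \bigcup_i F i = \big[setU/set0]_(i < m) F i.
Proof.
rewrite -bigcup_seq; congr (bigcup _ F).
by apply/seteqP; split => i //= _; exact: mem_index_enum.
Qed.

Lemma measurable_bigcup_ord m (F : 'I_m -> set 'cV[R]_d) :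
  (forall i, measurable (F i)) -> measurable (\bigcup_i F i).
Proof. by move=> mF; rewrite bigcup_ord; apply: bigsetU_measurable. Qed.

Lemma prob_bigcup m (F : 'I_m -> set 'cV[R]_d) : (forall i, measurable (F i)) ->
  (forall i j, i != j -> F i `&` F j = set0) -> pr (\bigcup_i F i) = \sum_i pr (F i).
Proof.
move=> mF dF; have mU := measurable_bigcup_ord mF.
apply/EFin_inj; rewrite -(probE mU) bigcup_ord measure_semi_additive_ord//.
- by rewrite -sumEFin; apply: eq_bigr => i _; exact: probE.
- by apply/trivIsetP => i j _ _; exact: dF.
- by rewrite -bigcup_ord.
Qed.

Lemma prob_negligible A : measurable A -> P.-negligible A -> pr A = 0.
Proof. by move=> mA nA; rewrite /prob (measure_negligible mA nA). Qed.

Lemma prob_setI_full A B : measurable A -> measurable B -> P.-negligible (~` B) ->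
  pr (A `&` B) = pr A.
Proof.
move=> mA mB nB; rewrite [RHS](prob_setID mA mB) [X in _ + X](_ : _ = 0) ?addr0//.
apply: prob_negligible; first exact: measurableD.
by apply: negligibleS nB => x [].
Qed.

(** The complement of the support is null, so a bound on the support suffices. *)
Lemma integral_bound D f (e : R) : measurable D -> P.-integrable D (EFin \o f) ->
  0 <= e -> (forall x, D x -> S x -> `|f x| <= e) ->
  `|\int[P]_(x in D) f x| <= e * pr D.
Proof.
move=> mD intf e0 fe.
have mS : measurable S by apply: closed_measurable_mx; exact: support_closed.
have mN : measurable (~` S) by exact: measurableC.
have -> : \int[P]_(x in D) f x = \int[P]_(x in D `\` ~` S) f x.
  rewrite /Rintegral; congr fine; apply: negligible_integral => //.
  exact: (measure_negligible mN (support_full P)).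
have mDS : measurable (D `\` ~` S) by exact: measurableD.
have intf' : P.-integrable (D `\` ~` S) (EFin \o f) by apply: integrableS intf => // x [].
rewrite (le_trans (le_normr_Rintegral mDS intf'))//.
apply: (@le_trans _ _ (\int[P]_(x in D `\` ~` S) e)).
  apply: le_Rintegral => //.
  - exact: (integrable_norm intf').
  - by apply: measurable_bounded_integrable => //; [exact: prob_lty|exact: bounded_cst].
  - by move=> x [Dx /contrapT Sx]; exact: fe.
rewrite Rintegral_cst// ler_wpM2l//; apply: prob_le => //.
Qed.

Lemma measurable_coord (i : 'I_d) : measurable_fun [set: 'cV[R]_d] (fun x => x i 0).
Proof.
apply: (measurability _ (RGenOInfty.measurableE R)).
move=> _ [_ [a ->] <-]; rewrite setTI; apply: open_measurable_mx.
have /continuousP := @coord_continuous R d 1 i 0; apply.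
exact: interval_open.
Qed.

Hypothesis P_bounded : bounded_set (msupport P).

Lemma bounded_integrable D f (r : R) : measurable D -> measurable_fun setT f ->
  (forall x, S x -> `|f x| <= r) -> P.-integrable D (EFin \o f).
Proof.
move=> mD mf fr.
have mS : measurable S by apply: closed_measurable_mx; exact: support_closed.
have mN : measurable (~` S) by exact: measurableC.
apply/(@negligible_integrable _ _ _ P D (~` S)) => //.
- by apply/measurable_EFinP; exact: measurable_funTS.
- exact: (measure_negligible mN (support_full P)).
apply: measurable_bounded_integrable.
- exact: measurableD.
- by apply: prob_lty; exact: measurableD.
- exact: measurable_funTS.
- exists `|r|; split => // M rM x [_ /contrapT /fr fx].
  by rewrite /= (le_trans fx)// (le_trans (ler_norm _))// ltW.
Qed.

End bounded_integrals.

Section coordinate_integrals.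
Variables (R : realType) (d : nat) (P : probability 'cV[R]_d R).
Local Notation S := (msupport P).
Local Notation pr := (prob P).
Variable r : R.
Hypotheses (r0 : 0 <= r) (Sr : forall x, S x -> `|x| <= r).

Lemma coord_integrable (D : set 'cV[R]_d) i : measurable D ->
  P.-integrable D (EFin \o (fun x => x i 0)).
Proof.
move=> mD; apply: (@bounded_integrable _ _ _ _ _ r) => //; first exact: measurable_coord.
by move=> x /Sr; apply: le_trans; exact: entry_le_norm.
Qed.

Lemma coord_integral_dist (A B : set 'cV[R]_d) i : measurable A -> measurable B ->
  `|\int[P]_(x in A) x i 0 - \int[P]_(x in B) x i 0| <= r * (pr (A `\` B) + pr (B `\` A)).
Proof.
move=> mA mB.
have split_int C D : measurable C -> measurable D ->
    \int[P]_(x in C) x i 0 = \int[P]_(x in C `&` D) x i 0 + \int[P]_(x in C `\` D) x i 0.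
  move=> mC mD; rewrite -[in LHS](setUIDK C D) Rintegral_setU//.
  - exact: measurableI.
  - exact: measurableD.
  - by rewrite setUIDK; exact: coord_integrable.
  - by apply/disj_set2P; rewrite setDE setIACA setICr setI0.
rewrite (split_int A B)// (split_int B A)// setIC opprD addrACA subrr add0r.
rewrite (le_trans (ler_normB _ _))// mulrDr lerD//.
- apply: integral_bound => //; [exact: measurableD| |].
    by apply: coord_integrable; exact: measurableD.
  by move=> x _ /Sr; apply: le_trans; exact: entry_le_norm.
- apply: integral_bound => //; [exact: measurableD| |].
    by apply: coord_integrable; exact: measurableD.
  by move=> x _ /Sr; apply: le_trans; exact: entry_le_norm.
Qed.

End coordinate_integrals.

Section ladders.
Variables (R : realType) (dT : measure_display) (T : measurableType dT).
Variables (mu : probability T R) (I : Type).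

Definition ladder (a b : R) (s : seq I) (A : I -> set T) (x : T) : R :=
  a + b * \sum_(i <- s) (x \in A i)%:R.

Lemma ladder_integrable (D : set T) a b s A : measurable D ->
  (forall i, measurable (A i)) ->
  mu.-integrable D (EFin \o ladder a b s A) /\
  \int[mu]_(x in D) ladder a b s A x =
    a * fine (mu D) + b * \sum_(i <- s) fine (mu (D `&` A i)).
Proof.
move=> mD mA.
have cst_int c : mu.-integrable D (EFin \o cst c).
  apply: measurable_bounded_integrable => //; last exact: bounded_cst.
  by rewrite -ge0_fin_numE// fin_num_measure.
have ind_int B : measurable B -> mu.-integrable D (EFin \o (fun x => (x \in B)%:R : R)).
  move=> mB; rewrite [X in _.-integrable _ X](_ : _ = (fun x => (\1_B x)%:E)).
    by apply: (@integrableS _ _ _ mu setT) => //; exact: integrable_indic.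
  by apply/funext => x /=; rewrite indicE.
elim: s => [|i s [IH1 IH2]].
  have E : ladder a b [::] A = cst a.
    by apply/funext => x; rewrite /ladder big_nil mulr0 addr0.
  by rewrite E Rintegral_cst// big_nil mulr0 addr0.
have E x : ladder a b (i :: s) A x = ladder a b s A x + b * (x \in A i)%:R.
  by rewrite /ladder big_cons mulrDr addrCA addrC.
have i2 : mu.-integrable D (EFin \o (fun x => b * (x \in A i)%:R)).
  rewrite [X in _.-integrable _ X](_ : _ = (fun x => b%:E * ((x \in A i)%:R)%:E)%E).
    by apply: integrableZl => //; exact: ind_int.
  by apply/funext => x /=; rewrite EFinM.
split.
  rewrite [X in _.-integrable _ X](_ : _ =
      (EFin \o ladder a b s A) \+ (EFin \o (fun x => b * (x \in A i)%:R))).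
    exact: integrableD.
  by apply/funext => x /=; rewrite E EFinD.
rewrite (_ : ladder a b (i :: s) A = fun x => ladder a b s A x + b * (x \in A i)%:R);
  last exact/funext/E.
rewrite RintegralD// IH2 RintegralZl//; last exact: ind_int.
rewrite big_cons mulrDr addrCA addrC; congr (_ + b * _).
rewrite /Rintegral; congr fine.
rewrite (eq_integral (fun x => (\1_(A i) x)%:E)); last by move=> x _; rewrite indicE.
by rewrite integral_indic// setIC.
Qed.

End ladders.

Lemma count_ladder (R : realType) (z : R) (m : nat) : 0 <= z <= m%:R ->
  0 <= z - \sum_(l < m) (l.+1%:R <= z)%R%:R <= 1.
Proof.
move=> /andP[z0 zm].
have -> : \sum_(l < m) ((l.+1%:R <= z)%R%:R : R) = (Num.truncn z)%:R.
  have tm : (Num.truncn z <= m)%N.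
    by rewrite -(ler_nat R) (le_trans _ zm)// truncn_le.
  transitivity (\sum_(l < m) ((l < Num.truncn z)%N%:R : R)).
    by apply: eq_bigr => l _; rewrite truncn_ge_nat.
  rewrite -natr_sum; congr (_%:R).
  rewrite -(subnKC tm) big_split_ord/=.
  rewrite (eq_bigr (fun=> 1%N)) => [|l _]; last by rewrite ltn_ord.
  rewrite sum1_card card_ord big1 ?addn0// => l _.
  by rewrite ltnNge leq_addr.
have := truncn_le z; rewrite z0 => h1; have := truncnS_gt z; rewrite -natr1 => h2.
by apply/andP; split; lra.
Qed.

Lemma cvg_sumr (R : realType) (X : Type) (F : set_system X) (FF : Filter F) (I : Type)
    (s : seq I) (f : I -> X -> R) (l : I -> R) :
  (forall i, f i @ F --> l i) -> (fun t => \sum_(i <- s) f i t) @ F --> \sum_(i <- s) l i.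
Proof.
move=> fl; elim: s => [|i s IH].
  rewrite big_nil (_ : (fun t => _) = cst 0); first exact: cvg_cst.
  by apply/funext => t; rewrite big_nil.
rewrite big_cons (_ : (fun t => _) = f i \+ (fun t => \sum_(i <- s) f i t)).
  by apply: cvgD; [exact: fl|exact: IH].
by apply/funext => t; rewrite big_cons.
Qed.

Section empirical.
Variables (R : realType) (d : nat) (P : probability 'cV[R]_d R).
Local Notation pr := (prob P).

Definition freq n (x : 'I_n -> 'cV[R]_d) (E : set 'cV[R]_d) : R :=
  n%:R^-1 * \sum_(j < n) (x j \in E)%:R.

(** Balls serve the local arguments, and slabs the approximation of the coordinate
functions by staircases. *)
Definition event_algebra (EE : set (set 'cV[R]_d)) : Prop :=
  [/\ forall E, EE E -> measurable E,
      forall E, EE E -> EE (~` E),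
      forall E F, EE E -> EE F -> EE (E `|` F),
      forall q, EE (rball q) &
      forall i (q : rat), EE [set x | x i 0 < ratr q]].

Lemma event_algebraI EE : event_algebra EE -> forall E F, EE E -> EE F -> EE (E `&` F).
Proof.
move=> [_ EC EU _ _] E F EEE EEF.
by rewrite -[E `&` F]classical_sets.setCK classical_sets.setCI; apply/EC/EU; exact: EC.
Qed.

Lemma event_algebra0 EE : event_algebra EE -> EE set0.
Proof.
move=> EA; have [_ EC _ EB _] := EA.
by rewrite -(setICr (rball (0, 0))); apply: event_algebraI => //; apply: EC.
Qed.

Variable r : nat.
Hypotheses (r0 : (0 < r)%N) (Sr : forall x, msupport P x -> `|x| <= r%:R).
Variables (U : set_system nat) (n : nat -> nat) (x : forall k : nat, 'I_(n k) -> 'cV[R]_d).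
Hypotheses (FU : ProperFilter U) (n_gt0 : U [set k | (0 < n k)%N]).
Hypothesis xr : forall (k : nat) (j : 'I_(n k)), `|@x k j| <= r%:R.
Variable EE : set (set 'cV[R]_d).
Hypotheses (EA : event_algebra EE).
Hypothesis Efreq : forall E, EE E -> (fun k => freq (@x k) E) @ U --> pr E.

Definition emean n (x : 'I_n -> 'cV[R]_d) (E : set 'cV[R]_d) i : R :=
  n%:R^-1 * \sum_(j < n) (x j \in E)%:R * x j i 0.

(** The coordinate is within [1 / L] of a step function of itself whose steps
belong to the algebra, so convergence of the frequencies gives convergence of
the partial means. *)
Lemma mean_cvg E i : EE E ->
  (fun k => emean (@x k) E i) @ U --> \int[P]_(y in E) y i 0.
Proof.
move=> EEE; have [EM EC EU _ ES] := EA.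
apply/cvgrPdist_lt => e e0.
pose L := (Num.truncn (3 / e)).+1.
have L0 : (0 : R) < L%:R by rewrite ltr0n.
have Le : L%:R^-1 < e / 3.
  by rewrite invf_plt ?posrE ?divr_gt0// invf_div; exact: truncnS_gt.
pose ql (l : nat) : rat := - r%:R + l.+1%:R / L%:R.
pose A l : set 'cV[R]_d := ~` [set y | y i 0 < ratr (ql l)].
have EEA l : EE (A l) by exact/EC/ES.
pose m := (2 * r * L)%N.
pose f := ladder (- r%:R : R) L%:R^-1 (index_enum 'I_m) A.
have inA y l : (y \in A l) = (l.+1%:R <= (y i 0 + r%:R) * L%:R).
  apply/idP/idP; rewrite /A /ql inE/= => h.
    move/negP: h; rewrite -leNgt rmorphD rmorphN fmorph_div/= !ratr_nat.
    by rewrite [- r%:R + _]addrC lerBlDr ler_pdivrMr.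
  apply/negP; rewrite -leNgt rmorphD rmorphN fmorph_div/= !ratr_nat.
  by rewrite [- r%:R + _]addrC lerBlDr ler_pdivrMr.
have fE (y : 'cV[R]_d) : `|y| <= r%:R -> `|y i 0 - f y| <= L%:R^-1.
  move=> yr; pose z := (y i 0 + r%:R) * L%:R.
  have /andP[y1 y2] : - r%:R <= y i 0 <= r%:R.
    by rewrite -ler_norml (le_trans (entry_le_norm _ _ _)).
  have zm : 0 <= z <= m%:R.
    rewrite /z /m !natrM; apply/andP; split; first by rewrite mulr_ge0//; lra.
    by rewrite ler_wpM2r//; lra.
  have /andP[h1 h2] := count_ladder zm.
  have -> : y i 0 - f y = L%:R^-1 * (z - \sum_(l < m) (l.+1%:R <= z)%R%:R).
    rewrite /f /ladder mulrBr (_ : L%:R^-1 * z = y i 0 + r%:R); last first.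
      by rewrite /z mulrC mulfK// gt_eqF.
    rewrite opprD opprK addrA.
    by congr (_ - _ * _); apply: eq_bigr => l _; rewrite inA.
  rewrite ger0_norm ?mulr_ge0 ?invr_ge0//.
  by rewrite ler_piMr// invr_ge0 ltW.
have [fint fI] := ladder_integrable P (- r%:R) L%:R^-1 (index_enum 'I_m) (EM _ EEE) (fun l => EM _ (EEA l)).
rewrite -/f in fint fI.
have intP : `|\int[P]_(y in E) y i 0 - \int[P]_(y in E) f y| <= L%:R^-1.
  pose coordi (y : 'cV[R]_d) := y i 0.
  have ci := coord_integrable Sr i (EM _ EEE).
  rewrite -RintegralB//; last exact: EM.
  apply: (@le_trans _ _ (L%:R^-1 * pr E)).
    apply: integral_bound; [exact: EM| |by rewrite invr_ge0 ltW|].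
      rewrite [X in _.-integrable _ X](_ : _ =
          ((EFin \o coordi) \- (EFin \o f))%E).
        by apply: integrableB => //; exact: EM.
      by apply/funext => y /=; rewrite EFinB.
    by move=> y _ /Sr; exact: fE.
  rewrite ler_piMr ?invr_ge0 ?(ltW L0)// -(prob_setT P).
  by apply: prob_le => //; exact: EM.
pose g k := - r%:R * freq (@x k) E + L%:R^-1 * \sum_(l < m) freq (@x k) (E `&` A l).
have gcvg : g @ U --> \int[P]_(y in E) f y.
  rewrite fI; apply: cvgD; apply: cvgM; [exact: cvg_cst|exact: Efreq|exact: cvg_cst|].
  apply: cvg_sumr => l.
  by apply: Efreq; exact: event_algebraI.
have emp k : (0 < n k)%N -> `|emean (@x k) E i - g k| <= L%:R^-1.
  move=> nk; have nk0 : (0 : R) < (n k)%:R by rewrite ltr0n.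
  have -> : g k = (n k)%:R^-1 * \sum_(j < n k) (@x k j \in E)%:R * f (@x k j).
    rewrite /g /freq mulrCA -mulr_sumr [X in _ + X]mulrCA -mulrDr; congr (_ * _).
    rewrite exchange_big/= !mulr_sumr -big_split/=; apply: eq_bigr => j _.
    rewrite /f /ladder mulrDr mulrC; congr (_ + _); rewrite mulrCA; congr (_ * _).
    by rewrite mulr_sumr; apply: eq_bigr => l _; rewrite in_setI; case: (@x k j \in E);
      rewrite ?mul1r ?mul0r.
  rewrite /emean -mulrBr -sumrB normrM gtr0_norm ?invr_gt0// ler_pdivrMl//.
  rewrite (le_trans (ler_norm_sum _ _ _))// mulr_natl -[X in _ *+ X]card_ord -sumr_const.
  apply: ler_sum => j _; rewrite -mulrBr normrM.
  apply: (@le_trans _ _ (1 * L%:R^-1)); last by rewrite mul1r.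
  by rewrite ler_pM//; [case: (_ \in _); rewrite ?normr1 ?normr0|exact: fE].
have gk : \forall k \near U, `|\int[P]_(y in E) f y - g k| < e / 3.
  by move/cvgrPdist_lt : gcvg; apply; rewrite divr_gt0.
near=> k; have nk : (0 < n k)%N by near: k.
have := emp _ nk; have : `|\int[P]_(y in E) f y - g k| < e / 3 by near: k.
move: intP.
set a := \int[P]_(y in E) y i 0; set b := \int[P]_(y in E) f y.
rewrite !ler_norml !ltr_norml => /andP[? ?] /andP[? ?] /andP[? ?].
by apply/andP; split; lra.
Unshelve. all: by end_near. Qed.

End empirical.

(** * Limits of cluster hulls along an ultrafilter *)

Section ultrafilters.
Variables (X : Type) (U : set_system X) (UU : UltraFilter U).

Lemma ultra_exists_fin (I : finType) (A : I -> set X) :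
  U [set k | exists i, A i k] -> exists i, U (A i).
Proof.
move=> UA; apply: contrapT => /forallNP nA.
have : U [set k | forall i, ~ A i k].
  apply: (@filter_forall _ I (fun i k => ~ A i k)) => i.
  by have [|//] := in_ultra_setVsetC (A i) UU; move=> /nA.
by move=> /(filterI UA)/filter_ex[k [[i Aik] /(_ i)]].
Qed.

(** The image ultrafilter contains a compact segment. *)
Lemma ultra_limit (R : realType) (u : X -> R) (M : R) :
  U [set k | `|u k| <= M] -> exists l : R, u @ U --> l.
Proof.
move=> uM.
have uU : UltraFilter (u @ U).
  split; first exact: fmap_proper_filter.
  move=> G GF uG; apply/seteqP; split => // B GB.
  have [//|UB] := in_ultra_setVsetC (u @^-1` B) UU.
  have : G (~` B) by exact: uG.
  by move=> /(filterI GB)/filter_ex[y []].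
have := @segment_compact R (- M) M; rewrite compact_ultra => /(_ (u @ U) uU).
case; last by move=> l [_ ul]; exists l.
suff h : U (u @^-1` `[- M, M]%classic) by [].
by apply: filterS uM => k /=; rewrite in_itv/= -ler_norml.
Qed.

End ultrafilters.

Section limit_cells.
Variables (R : realType) (d : nat) (alpha : R) (T Sigma : 'M[R]_d).
Hypotheses (d_ge1 : (1 <= d)%N) (alpha_gt0 : 0 < alpha).
Hypotheses (pT : posdefmx T) (pS : posdefmx Sigma).
Variable P : probability 'cV[R]_d R.
Hypotheses (P_bounded : bounded_set (msupport P)).
Hypotheses (P_ac : P `<< @lebesgue_vector R d).
Local Notation pr := (prob P).
Variables (U : set_system nat) (UU : UltraFilter U).
Variables (n : nat -> nat) (x : forall k : nat, 'I_(n k) -> 'cV[R]_d).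
Arguments x : clear implicits.
Variable JJ : forall k, {set {set 'I_(n k)}}.
Variables (r : nat) (EE : set (set 'cV[R]_d)) (K : nat).
Hypotheses (xr : forall (k : nat) (j : 'I_(n k)), `|x k j| <= r%:R).
Hypothesis mapJJ : forall k, MAP_partition alpha T Sigma (x k) (JJ k).
Hypotheses (n_gt0 : U [set k | (0 < n k)%N]) (cardJJ : U [set k | #|JJ k| = K]).
Hypotheses (EA : event_algebra EE).
Hypothesis Efreq : forall E, EE E -> (fun k => freq (x k) E) @ U --> pr E.

Local Notation hull := (smallest (@convex_set R 'cV[R]_d)).

Let both A B : U A -> U B -> U (A `&` B).
Proof. exact: filterI. Qed.

Let witness A : U A -> exists k, A k.
Proof. exact: filter_ex. Qed.

Definition clust k (a : 'I_K) : {set 'I_(n k)} := nth finset.set0 (enum (JJ k)) a.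
Definition clust_hull k a : set 'cV[R]_d := hull [set x k j | j in [set` clust k a]].

Lemma clust_in k a : #|JJ k| = K -> clust k a \in JJ k.
Proof. by move=> cK; rewrite -mem_enum mem_nth// -cardE cK. Qed.

Lemma clust_inj k : #|JJ k| = K -> injective (clust k).
Proof.
move=> cK a b /eqP; rewrite nth_uniq ?enum_uniq -?cardE ?cK// => /eqP.
exact: val_inj.
Qed.

Lemma clust_surj k J : #|JJ k| = K -> J \in JJ k -> exists a, J = clust k a.
Proof.
rewrite -mem_enum => cK JJJ.
have iK : (index J (enum (JJ k)) < K)%N by rewrite -cK cardE index_mem.
by exists (Ordinal iK); rewrite /clust nth_index.
Qed.

Lemma clust_sum (V : nmodType) k (F : {set 'I_(n k)} -> V) : #|JJ k| = K ->
  \sum_(J in JJ k) F J = \sum_(a < K) F (clust k a).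
Proof.
move=> cK; rewrite -big_enum/= (big_nth finset.set0) -cardE cK big_mkord.
by apply: eq_bigr => a _.
Qed.

Lemma clust_cover k (j : 'I_(n k)) : #|JJ k| = K -> exists a, j \in clust k a.
Proof.
move=> cK; have [pJJ _] := mapJJ k.
have : j \in finset.cover (JJ k) by rewrite (cover_partition pJJ) inE.
move=> /bigcupP[J JJJ jJ]; have [a Ja] := clust_surj cK JJJ.
by exists a; rewrite -Ja.
Qed.

Lemma clust_sep k a b : #|JJ k| = K -> a != b ->
  exists w c, [/\ `|w| = 1, `|c| <= d%:R * r%:R,
    forall j, j \in clust k a -> c <= dot w (x k j) &
    forall j, j \in clust k b -> dot w (x k j) <= c].
Proof.
move=> cK ab.
have [|w [c [w1 wa wb [i ia ci]]]] := MAP_separated d_ge1 alpha_gt0 pT pS (mapJJ k)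
  (clust_in a cK) (clust_in b cK).
  by apply: contra_neq ab; exact: clust_inj.
exists w, c; split => //; rewrite ci (le_trans (dot_le _ _))// w1 mul1r.
by rewrite ler_wpM2l.
Qed.

Lemma hull_data k a j : j \in clust k a -> clust_hull k a (x k j).
Proof. by move=> ja; apply: sub_gen_smallest; exists j. Qed.

(** An open subset of one hull avoids the hyperplane that bounds the other. *)
Lemma hulls_open_disjoint k a b (W : set 'cV[R]_d) z : #|JJ k| = K -> a != b ->
  open W -> W z -> W `<=` clust_hull k a -> ~ clust_hull k b z.
Proof.
move=> cK ab oW Wz Wa zb.
have [w [c [w1 _ wa wb]]] := clust_sep cK ab.
have ha y : clust_hull k a y -> c <= dot w y.
  have sub : [set x k j | j in [set` clust k a]] `<=` [set y | c <= dot w y].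
    by move=> _ [j ja <-]; exact: wa.
  by move/(smallest_sub (@halfspace_convex R d w c) sub).
have hb y : clust_hull k b y -> dot w y <= c.
  have sub : [set x k j | j in [set` clust k b]] `<=` [set y | dot w y <= c].
    by move=> _ [j jb <-]; exact: wb.
  by move/(smallest_sub (@halfspace_convex_le R d w c) sub).
have /nbhs_ballP[e /= e0 eW] : nbhs z W by exact: open_nbhs_nbhs.
have zW : W (z - (e / 2) *: w).
  apply: eW; rewrite -ball_normE/= opprB addrCA subrr addr0 normrZ w1 mulr1.
  by rewrite gtr0_norm ?divr_gt0//; lra.
have := ha _ (Wa _ zW); rewrite dotB dotZ; have := hb _ zb.
have ww : 0 < dot w w.
  apply: (@lt_le_trans _ _ (`|w| ^+ 2)); first by rewrite w1 expr1n.
  by rewrite (le_trans (norm_le_enorm _))// enormE /bil mulmx1 dot_self.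
have e20 : 0 < e / 2 by rewrite divr_gt0.
have := mulr_gt0 e20 ww; lra.
Qed.

(** Along an ultrafilter, often and eventually mean the same: the ball contains
observations of the cluster for almost all [k]. *)
Definition near_cluster a (y : 'cV[R]_d) :=
  forall q, rball q y -> U [set k | exists2 j, j \in clust k a & rball q (x k j)].

Lemma near_cluster_limit a (w : nat -> 'cV[R]_d) (c : nat -> R) (w0 : 'cV[R]_d) (c0 : R) :
  (forall i, (fun k => w k i 0) @ U --> w0 i 0) -> c @ U --> c0 ->
  U [set k | `|w k| <= 1] ->
  U [set k | forall j, j \in clust k a -> c k <= dot (w k) (x k j)] ->
  forall y, near_cluster a y -> c0 <= dot w0 y.
Proof.
move=> ww0 cc0 w1 cw y ny; rewrite leNgt; apply/negP => lt0.
pose e := c0 - dot w0 y.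
have e0 : 0 < e by rewrite subr_gt0.
have dcvg : (fun k => dot (w k) y) @ U --> dot w0 y.
  by apply: cvg_sumr => i; apply: cvgM; [exact: ww0|exact: cvg_cst].
have d0 : (0 : R) < d%:R by rewrite ltr0n.
have ed : 0 < e / 3 / d%:R by rewrite !divr_gt0.
have [q [qy qb]] := @open_rball _ _ (ball y (e / 3 / d%:R)) y (ball_open y _) (ballxx _ ed).
have h1 : U [set k | `|dot w0 y - dot (w k) y| < e / 3].
  by move/cvgrPdist_lt : dcvg; apply; rewrite divr_gt0.
have h2 : U [set k | `|c0 - c k| < e / 3].
  by move/cvgrPdist_lt : cc0; apply; rewrite divr_gt0.
have := both (both h1 h2) (both w1 (both cw (ny _ qy))).
move=> /witness[k [/= [+ +] [w1k [cwk [j jk qj]]]]].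
have := cwk _ jk; have /qb := qj; rewrite -ball_normE/= => yx.
have dy : `|dot (w k) (y - x k j)| <= e / 3.
  rewrite (le_trans (dot_le _ _))// -ler_pdivlMl// [leRHS]mulrC.
  apply: (@le_trans _ _ (1 * `|y - x k j|)); first by rewrite ler_wpM2r.
  by rewrite mul1r ltW.
move: dy; rewrite dotB ler_norml => /andP[? ?] ?.
rewrite !ltr_norml => /andP[? ?] /andP[? ?].
have eE : e = c0 - dot w0 y by [].
lra.
Qed.

(** The hyperplanes that separate the two clusters have unit normals and bounded
offsets, so they converge along the ultrafilter; what both clusters approach lies
on both sides of the limit. *)
Lemma near_clusters_hyperplane a b : a != b -> exists w c, w != 0 /\
  forall y, near_cluster a y -> near_cluster b y -> dot w y = c.
Proof.
move=> ab.
have /choice[wc wcP] : forall k, exists wc : 'cV[R]_d * R, #|JJ k| = K ->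
  [/\ `|wc.1| = 1, `|wc.2| <= d%:R * r%:R,
    forall j, j \in clust k a -> wc.2 <= dot wc.1 (x k j) &
    forall j, j \in clust k b -> dot wc.1 (x k j) <= wc.2].
  move=> k; have [cK|ncK] := pselect (#|JJ k| = K); last by exists (0, 0).
  by have [w [c h]] := clust_sep cK ab; exists (w, c).
have [c cP] : exists c : R, (fun k => (wc k).2) @ U --> c.
  apply: (ultra_limit UU (M := d%:R * r%:R)).
  by apply: filterS cardJJ => k /wcP[].
have /choice[w wP] : forall i, exists l : R, (fun k => (wc k).1 i 0) @ U --> l.
  move=> i; apply: (ultra_limit UU (M := 1)).
  apply: filterS cardJJ => k /wcP[w1 _ _ _] /=.
  by rewrite -w1; exact: entry_le_norm.
have [i0 i0P] : exists i, U [set k | `|(wc k).1 i 0| = 1].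
  apply: (ultra_exists_fin UU); apply: filterS cardJJ => k /wcP[w1 _ _ _] /=.
  have nw : mx_norm (wc k).1 = 1 by exact: w1.
  have := @mx_norm_neq0 _ _ _ (wc k).1; rewrite nw oner_eq0.
  by move=> /(_ isT)[[i j] /= ->]; exists i; rewrite ord1.
exists (\col_i w i), c; split.
  apply/eqP => /colP/(_ i0); rewrite !mxE => w0.
  have /cvgrPdist_lt/(_ 1 ltr01) := wP i0.
  rewrite w0 => h; have /witness[k /= []] := both h i0P.
  by rewrite sub0r normrN => /[swap] ->; rewrite ltxx.
have wP' i : (fun k => (wc k).1 i 0) @ U --> (\col_i w i) i 0 by rewrite mxE; exact: wP.
move=> y na nb; apply/eqP; rewrite eq_le; apply/andP; split; last first.
  apply: (near_cluster_limit wP' cP) na.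
    by apply: filterS cardJJ => k /wcP[w1 _ _ _] /=; rewrite w1.
  by apply: filterS cardJJ => k /wcP[].
rewrite -lerN2 (_ : - dot _ y = dot (- \col_i w i) y); last first.
  by rewrite -(scaleN1r (\col_i w i)) dotZl mulN1r.
apply: (@near_cluster_limit b (fun k => - (wc k).1) (fun k => - (wc k).2)) nb.
- move=> i; rewrite mxE (_ : (fun k => _) = (fun k => - (wc k).1 i 0)).
    by apply: cvgN; exact: wP'.
  by apply/funext => k; rewrite mxE.
- exact: cvgN.
- by apply: filterS cardJJ => k /wcP[w1 _ _ _] /=; rewrite normrN w1.
- apply: filterS cardJJ => k /wcP[_ _ _ wb] /= j /wb.
  by rewrite -(scaleN1r (wc k).1) dotZl mulN1r lerN2.
Qed.

Lemma data_in_ball q : (0 < P (rball q))%E -> U [set k | exists j, rball q (x k j)].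
Proof.
move=> Pq; have [EM _ _ EB _] := EA.
have p0 : 0 < pr (rball q).
  by rewrite -lte_fin -(probE P (EM _ (EB q))).
have /cvgrPdist_lt/(_ _ p0) := Efreq (EB q).
apply: filterS => k /=; rewrite ltr_norml => /andP[_ h].
have {h}f0 : 0 < freq (x k) (rball q) by lra.
apply: contrapT => /forallNP nj; move: f0; rewrite /freq big1 ?mulr0 ?ltxx// => j _.
by rewrite memNset.
Qed.

Definition inner_ball a (q : 'cV[rat]_d * rat) := U [set k | rball q `<=` clust_hull k a].

(** Around a point with mass in all corners, all data eventually belong to one
cluster unless the point lies on a limit of separating hyperplanes; data in all
corners then put a whole neighbourhood inside the hull of that cluster. *)
Lemma inner_ball_exists y : full_point P y ->
  (forall a b, a != b -> near_cluster a y -> near_cluster b y -> False) ->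
  exists a q, rball q y /\ inner_ball a q.
Proof.
move=> [Sy fy] uniq_near.
have /choice[qb qbP] : forall b : 'I_K, exists q, rball q y /\ (near_cluster b y \/
    U [set k | forall j, j \in clust k b -> ~ rball q (x k j)]).
  move=> b; have [nb|/existsNP[q /not_implyP[qy nq]]] := pselect (near_cluster b y).
    by have [q [qy _]] := open_rball openT (I : setT y); exists q; split => //; left.
  exists q; split => //; right; have [//|] := in_ultra_setVsetC
    [set k | exists2 j, j \in clust k b & rball q (x k j)] UU.
  by apply: filterS => k h j jb qj; apply: h; exists j.
pose V : set 'cV[R]_d := [set z | forall b, rball (qb b) z].
have oV : open V.
  rewrite openE => z Vz; rewrite /interior.
  apply: (@filter_forall _ _ (fun b => rball (qb b)) (nbhs (z : 'cV[R]_d))) => b.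
  by apply: open_nbhs_nbhs; split; [exact: rball_open|exact: Vz].
have Vy : V y by move=> b; have [] := qbP b.
have [a na] : exists a, near_cluster a y.
  apply: contrapT => /forallNP nn.
  have [q [qy qV]] := open_rball oV Vy.
  have := data_in_ball (support_open (@rball_open _ _ q) Sy qy).
  have : U [set k | forall b j, j \in clust k b -> ~ rball (qb b) (x k j)].
    apply: (@filter_forall _ _ (fun b k => forall j, j \in clust k b -> ~ rball (qb b) (x k j))) => b.
    by have [_ [/nn|]] := qbP b.
  move=> h1 h2; have /witness[k /= [[cK h3] [j qj]]] := both (both cardJJ h1) h2.
  have [b jb] := clust_cover j cK.
  by apply: (h3 _ _ jb); exact: qV.
have Va : U [set k | forall j, V (x k j) -> j \in clust k a].
  have h1 : U [set k | forall b, b != a -> forall j, j \in clust k b -> ~ rball (qb b) (x k j)].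
    apply: (@filter_forall _ _ (fun b k => b != a -> forall j, j \in clust k b -> ~ rball (qb b) (x k j))) => b.
    have [_ [nb|h]] := qbP b; last by apply: filterS h => k h _.
    have [->|ba] := eqVneq b a; first exact: filterE.
    by have := uniq_near _ _ ba nb na.
  apply: filterS (both h1 cardJJ) => k [/= h cK] j Vj.
  have [b jb] := clust_cover j cK.
  have [<-//|ba] := eqVneq b a.
  by have := h _ ba _ jb (Vj b).
have /nbhs_ballP[e /= e0 eV] : nbhs y V by exact: open_nbhs_nbhs.
have /choice[f fP] : forall s : {ffun 'I_d -> bool}, exists qd : ('cV[rat]_d * rat) * R,
    [/\ 0 < qd.2, forall z i, rball qd.1 z -> qd.2 < (-1) ^+ (s i) * (z i 0 - y i 0) < e &
    (0 < P (rball qd.1))%E].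
  by move=> s; have [q [dl h]] := fy s _ e0; exists (q, dl).
pose dl := \big[Num.min/1]_s (f s).2.
have dl0 : 0 < dl by apply/bigmin_gtP; split => // s _; have [] := fP s.
have dls s : dl <= (f s).2 by exact: bigmin_le.
have [q [qy qd]] := @open_rball _ _ (ball y dl) y (ball_open y dl) (ballxx _ dl0).
exists a, q; split => //.
have fd : U [set k | forall s, exists j, rball (f s).1 (x k j)].
  apply: (@filter_forall _ _ (fun s k => exists j, rball (f s).1 (x k j))) => s.
  by apply: data_in_ball; have [] := fP s.
apply: filterS (both Va fd) => k [/= Vk fk] z /qd[_ yz].
have /choice[js jsP] := fk.
apply: (@orthants_mem _ _ _ z (fun s => x k (js s))).
- exact: hull_convex.
- move=> s; apply: hull_data; apply: Vk; apply: eV; rewrite -ball_normE/=.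
  have [_ fs _] := fP s.
  apply: (@le_lt_trans _ _ (\big[Num.max/0]_i `|(y - x k (js s)) i 0|)).
    apply: norm_le_entry => [|i j]; first exact: bigmax_ge_id.
    by rewrite ord1; apply: (le_bigmax _ (fun i => `|(y - x k (js s)) i 0|)).
  apply/bigmax_ltP; split => // i _.
  have /andP[h1 h2] := fs _ i (jsP s); rewrite !mxE distrC.
  rewrite -(normrMsign (s i)) gtr0_norm//.
  by apply: lt_trans h1; have [] := fP s.
- move=> s i; have [_ fs _] := fP s; have /andP[h1 _] := fs _ i (jsP s).
  have := yz i 0; rewrite /ball/= => h2.
  have h3 : (-1) ^+ (s i) * (z i 0 - y i 0) <= `|y i 0 - z i 0|.
    by rewrite (le_trans (ler_norm _))// normrM normrX normrN1 expr1n mul1r distrC.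
  have -> : x k (js s) i 0 - z i 0 = (x k (js s) i 0 - y i 0) - (z i 0 - y i 0) by ring.
  rewrite mulrBr; have := dls s; lra.
Qed.

Definition limit_cell a : set 'cV[R]_d := \bigcup_(q in [set q | inner_ball a q]) rball q.

Lemma limit_cell_open a : open (limit_cell a).
Proof. by apply: bigcup_open => q _; exact: rball_open. Qed.

(** Exceptions are points without charged corners and points on one of the finitely
many limit hyperplanes, and [P] charges neither. *)
Lemma limit_cells_full : P.-negligible (~` \bigcup_a limit_cell a).
Proof.
pose N (ab : 'I_K * 'I_K) : set 'cV[R]_d :=
  [set y | ab.1 != ab.2 /\ near_cluster ab.1 y /\ near_cluster ab.2 y].
apply: (@negligibleS _ _ _ _ ((~` full_point P) `|` \bigcup_ab N ab)).
  move=> y ny; have [fy|] := pselect (full_point P y); last by left.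
  right; apply: contrapT => nNy; apply: ny.
  have [a b ab na nb|a [q [qy aq]]] := inner_ball_exists fy.
    by apply: nNy; exists (a, b).
  by exists a => //; exists q.
apply: negligibleU; first exact: full_point_ae.
apply: negligible_bigcup_countable => -[a b]; rewrite /N/=.
have [->|ab] := eqVneq a b.
  by apply: (@negligibleS _ _ _ _ set0); [move=> y [] |exact: negligible_set0].
have [w [c [w0 wc]]] := near_clusters_hyperplane ab.
by apply: negligibleS (hyperplane_negligible P_bounded P_ac c w0) => y [_ [/wc]]; apply.
Qed.

Lemma limit_cells_disjoint a b : a != b -> limit_cell a `&` limit_cell b = set0.
Proof.
move=> ab; apply/seteqP; split => // z [[q aq qz] [q' bq' qz']].
have /witness[k [/= [ka kb] cK]] := both (both aq bq') cardJJ.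
exact: (hulls_open_disjoint cK ab (@rball_open _ _ q) qz ka (kb _ qz')).
Qed.

Let mcell a : measurable (limit_cell a).
Proof. by apply: open_measurable_mx; exact: limit_cell_open. Qed.

Lemma limit_cell_subset_prob (F : 'I_K -> set 'cV[R]_d) : (forall a, measurable (F a)) ->
  (forall a, F a `<=` limit_cell a) -> pr (\bigcup_a F a) = \sum_a pr (F a).
Proof.
move=> mF Fc; apply: prob_bigcup => // a b ab.
apply/seteqP; split => // z [/Fc za /Fc zb].
by have := limit_cells_disjoint ab => /seteqP[/(_ z)+ _]; apply.
Qed.

Lemma limit_cells_sum : \sum_a pr (limit_cell a) = 1.
Proof.
have mU : measurable (\bigcup_a limit_cell a) by exact: measurable_bigcup_ord.
transitivity (pr (\bigcup_a limit_cell a)).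
  exact: (esym (limit_cell_subset_prob mcell (fun a y h => h))).
rewrite -[RHS](prob_setT P).
by rewrite -[RHS](prob_setI_full measurableT mU limit_cells_full) setTI.
Qed.

Let piece a (i : nat) : set 'cV[R]_d :=
  if choice.unpickle i is Some q then if `[< inner_ball a q >] then rball q else set0 else set0.

(** A finite stage of the limit cell: it lies in the hull of the corresponding
cluster along the whole ultrafilter, not just pointwise. *)
Definition stage a m : set 'cV[R]_d := \big[setU/set0]_(i < m) piece a i.

Lemma pieceP a i : EE (piece a i) /\ open (piece a i) /\
  U [set k | piece a i `<=` clust_hull k a] /\ piece a i `<=` limit_cell a.
Proof.
have [_ _ _ EB _] := EA.
have z : EE set0 /\ open (set0 : set 'cV[R]_d) /\
    U [set k | set0 `<=` clust_hull k a] /\ set0 `<=` limit_cell a.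
  split; first exact: event_algebra0 EA.
  by split; [exact: open0|split; [by apply: filterE => k; exact: sub0set|exact: sub0set]].
rewrite /piece; case: choice.unpickle => [q|]; last exact: z.
case: ifPn => [/asboolP aq|_]; last exact: z.
split; first exact: EB.
split; first exact: rball_open.
by split; [exact: aq|move=> y qy; exists q].
Qed.

Lemma limit_cell_pieces a : limit_cell a = \bigcup_i piece a i.
Proof.
apply/seteqP; split => [y [q aq qy]|y [i _ iy]].
  by exists (choice.pickle q) => //; rewrite /piece choice.pickleK ifT//; apply/asboolP.
by have [_ [_ [_ h]]] := pieceP a i; exact: h.
Qed.

Lemma stageP a m : EE (stage a m) /\ open (stage a m) /\
  U [set k | stage a m `<=` clust_hull k a] /\ stage a m `<=` limit_cell a.
Proof.
have [_ _ EU _ _] := EA.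
rewrite /stage; elim/big_ind: _ => [|A B [A1 [A2 [A3 A4]]] [B1 [B2 [B3 B4]]]|i _].
- split; first exact: event_algebra0 EA.
  by split; [exact: open0|split; [by apply: filterE => k; exact: sub0set|exact: sub0set]].
- split; first exact: EU.
  split; first exact: openU.
  split; last by move=> y [/A4|/B4].
  by apply: filterS (both A3 B3) => k [hA hB] y [/hA|/hB].
- exact: pieceP.
Qed.

Lemma mstage a m : measurable (stage a m).
Proof. by have [EM _ _ _ _] := EA; apply: EM; have [] := stageP a m. Qed.

Lemma stage_approx (e : R) : 0 < e ->
  exists m, forall a, pr (limit_cell a) - e < pr (stage a m).
Proof.
move=> e0.
have h a : \forall m \near \oo, pr (limit_cell a) - e < pr (stage a m).
  have nd : nondecreasing_seq (stage a).
    by apply/nondecreasing_seqP => m; rewrite subsetEset /stage big_ord_recr/=; left.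
  have cE : limit_cell a = \bigcup_m stage a m.
    rewrite limit_cell_pieces; apply/seteqP; split => [y [i _ iy]|y [m _]].
      by exists i.+1 => //; rewrite /stage big_ord_recr/=; right.
    exact: bigsetU_bigcup.
  have cv : P \o stage a @ \oo --> (pr (limit_cell a))%:E.
    rewrite -(probE P (mcell a)) cE; apply: nondecreasing_cvg_mu => //.
    - exact: mstage.
    - by rewrite -cE.
  move: cv => /fine_cvgP[_].
  move=> /cvgrPdist_lt/(_ _ e0); apply: filterS => m /=.
  by rewrite ltr_norml => /andP[_]; rewrite /prob; lra.
have /filter_ex[m hm] : \forall m \near \oo, forall a, pr (limit_cell a) - e < pr (stage a m).
  exact: (@filter_forall _ _ (fun a m => pr (limit_cell a) - e < pr (stage a m)) \oo _ h).
by exists m.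
Qed.

Lemma stage_event m : U [set k | [/\ #|JJ k| = K, (0 < n k)%N &
  forall a, stage a m `<=` clust_hull k a]].
Proof.
have h : U [set k | forall a, stage a m `<=` clust_hull k a].
  apply: (@filter_forall _ _ (fun a k => stage a m `<=` clust_hull k a)) => a.
  by have [_ [_ []]] := stageP a m.
by apply: filterS (both (both cardJJ n_gt0) h) => k [[]].
Qed.

Lemma stage_data k m a j : #|JJ k| = K -> (forall a, stage a m `<=` clust_hull k a) ->
  stage a m (x k j) -> j \in clust k a.
Proof.
move=> cK sh sj; have [b jb] := clust_cover j cK.
have [<-//|ba] := eqVneq b a.
have [_ [oa _]] := stageP a m; rewrite eq_sym in ba.
by have := hulls_open_disjoint cK ba oa sj (sh a); case; exact: hull_data.
Qed.

(** A hull and its limit cell both contain their stage and avoid the other stages, so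
they differ outside all stages, where little mass is left. *)
Lemma cell_dist_cvg (e : R) : 0 < e ->
  U [set k | forall a, dist_P P (clust_hull k a) (limit_cell a) < e].
Proof.
move=> e0; have e1 : 0 < e / K.+1%:R by rewrite divr_gt0.
have [m hm] := stage_approx e1.
apply: filterS (stage_event m) => k [cK nk sh] a.
have mU : measurable (\bigcup_b stage b m) by apply: measurable_bigcup_ord => b; exact: mstage.
have mh : measurable (clust_hull k a).
  by apply: closed_measurable_mx; exact: hull_finite_closed.
apply: (@le_lt_trans _ _ (pr (~` \bigcup_b stage b m))).
  apply: prob_le.
  - by apply: measurableU; exact: measurableD.
  - exact: measurableC.
  - move=> y hy [b _ yb]; have [_ [ob [_ sb]]] := stageP b m.
    have [ab|ab] := eqVneq b a.
      by rewrite ab in yb sb; case: hy => -[h1 h2]; [apply: h2; exact: sb|apply: h2; exact: sh].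
    case: hy => -[h1 h2].
      exact: (hulls_open_disjoint cK ab ob yb (sh b) h1).
    have := limit_cells_disjoint ab => /seteqP[/(_ y)+ _]; apply.
    by split => //; exact: sb.
rewrite prob_setC// (@limit_cell_subset_prob (fun b => stage b m)); last 2 first.
- by move=> b; exact: mstage.
- by move=> b; have [_ [_ []]] := stageP b m.
rewrite -[X in X - _]limit_cells_sum -sumrB.
apply: (@le_lt_trans _ _ (\sum_(b < K) e / K.+1%:R)).
  by apply: ler_sum => b _; rewrite lerBlDl -lerBlDr ltW.
rewrite sumr_const card_ord -[ltLHS]mulr_natr -mulrA gtr_pMr//.
by rewrite mulrC ltr_pdivrMr// mul1r ltr_nat.
Qed.

Definition share k a : R := #|clust k a|%:R / (n k)%:R.

Lemma share_sum k : #|JJ k| = K -> (0 < n k)%N -> \sum_a share k a = 1.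
Proof.
move=> cK nk; rewrite /share -mulr_suml -(clust_sum (fun J => #|J|%:R)) //.
by rewrite sum_card_partition ?mulfV ?pnatr_eq0 -?lt0n//; have [] := mapJJ k.
Qed.

Lemma freq_stage_le k m a : #|JJ k| = K -> (forall a, stage a m `<=` clust_hull k a) ->
  freq (x k) (stage a m) <= share k a.
Proof.
move=> cK sh; rewrite /freq /share mulrC ler_wpM2r// -sum1_card natr_sum [leRHS]big_mkcond/=.
apply: ler_sum => j _; have [jm|//] := boolP (x k j \in _); last by case: ifP.
by rewrite (stage_data cK sh (set_mem jm)).
Qed.

(** The observations in a stage belong to the corresponding cluster, which bounds
every share from below; as the shares and the masses of the cells both add up to
1, they are bounded from above as well. *)
Lemma share_cvg a : (fun k => share k a) @ U --> pr (limit_cell a).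
Proof.
apply/cvgrPdist_lt => e e0.
pose e' := e / (2 * K.+1%:R).
have e'0 : 0 < e' by rewrite divr_gt0// mulr_gt0.
have [m hm] := stage_approx e'0.
have fr : U [set k | forall b, `|pr (stage b m) - freq (x k) (stage b m)| < e'].
  apply: (@filter_forall _ _ (fun b k => `|pr (stage b m) - freq (x k) (stage b m)| < e')) => b.
  have [Eb _] := stageP b m.
  by have /cvgrPdist_lt/(_ _ e'0) := Efreq Eb.
apply: filterS (both (stage_event m) fr) => k [[cK nk sh] frk].
have lo b : pr (limit_cell b) - 2 * e' < share k b.
  have := hm b; have := frk b; have := freq_stage_le b cK sh.
  by rewrite ltr_norml => h1 /andP[h2 h3] h4; lra.
have Ke : 2 * e' * K%:R < e.
  have -> : 2 * e' = e / K.+1%:R by rewrite /e' invfM mulrCA mulVKf.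
  by rewrite -mulrA gtr_pMr// mulrC ltr_pdivrMr// mul1r ltr_nat.
have K1 : (1 : R) <= K%:R by rewrite ler1n; case: (K) a => // -[].
have up : share k a - pr (limit_cell a) <= 2 * e' * K%:R.
  have : \sum_b share k b = \sum_b pr (limit_cell b).
    by rewrite share_sum// limit_cells_sum.
  rewrite (bigD1 a)//= [in RHS](bigD1 a)//=.
  have : \sum_(b | b != a) (pr (limit_cell b) - 2 * e') <= \sum_(b | b != a) share k b.
    by apply: ler_sum => b _; exact: ltW.
  rewrite sumrB.
  have : \sum_(b < K | b != a) 2 * e' <= 2 * e' * K%:R.
    rewrite sumr_const -[leLHS]mulr_natr ler_wpM2l//; first by rewrite mulr_ge0// ltW.
    by rewrite ler_nat -[X in (_ <= X)%N](card_ord K) max_card.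
  lra.
rewrite ltr_norml; apply/andP; split; first by lra.
have := lo a; have : 2 * e' * 1 <= 2 * e' * K%:R by rewrite ler_wpM2l// mulr_ge0// ltW.
lra.
Qed.

Definition clust_moment k a i : R := (n k)%:R^-1 * (\sum_(j in clust k a) x k j) i 0.

Hypotheses (Sr : forall y, msupport P y -> `|y| <= r%:R).

(** The cluster has few observations outside its stage, and these are bounded; on the
stage the means converge. *)
Lemma clust_moment_cvg a i :
  (fun k => clust_moment k a i) @ U --> \int[P]_(y in limit_cell a) y i 0.
Proof.
have r0 : (0 : R) <= r%:R by [].
apply/cvgrPdist_lt => e e0.
pose e' := e / (4 * r%:R + 2).
have c0 : (0 : R) < 4 * r%:R + 2 by rewrite ltr_wpDl// mulr_ge0.
have e'0 : 0 < e' by rewrite divr_gt0.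
have [m hm] := stage_approx e'0.
have [Ea [_ [_ sa]]] := stageP a m.
have /cvgrPdist_lt/(_ _ e'0) h1 := Efreq Ea.
have /cvgrPdist_lt/(_ _ e'0) h2 := share_cvg (a := a).
have mc : (fun k => emean (x k) (stage a m) i) @ U --> \int[P]_(y in stage a m) y i 0.
  by apply: (@mean_cvg _ _ P r _ _ n) EA Efreq _ _ Ea.
have /cvgrPdist_lt/(_ _ e'0) h3 := mc.
have h4 : `|\int[P]_(y in limit_cell a) y i 0 - \int[P]_(y in stage a m) y i 0| <= r%:R * e'.
  have := coord_integral_dist r0 Sr i (mcell a) (mstage a m).
  move=> /le_trans; apply; rewrite ler_wpM2l//.
  have -> : stage a m `\` limit_cell a = set0.
    by apply/seteqP; split => // y [/sa].
  rewrite (_ : pr set0 = 0) ?addr0; last by rewrite /prob measure0.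
  have := prob_setID P (mcell a) (mstage a m); rewrite setIidr//.
  by have := hm a; lra.
apply: filterS (both (both h1 h2) (both h3 (stage_event m))) => k [[/= f1 f2] [/= f3 [cK nk sh]]].
have nk0 : (0 : R) < (n k)%:R by rewrite ltr0n.
have h5 : `|emean (x k) (stage a m) i - clust_moment k a i| <=
    r%:R * (share k a - freq (x k) (stage a m)).
  have -> : clust_moment k a i = (n k)%:R^-1 * \sum_(j < n k) (j \in clust k a)%:R * x k j i 0.
    rewrite /clust_moment summxE; congr (_ * _); rewrite big_mkcond/=.
    by apply: eq_bigr => j _; case: ifP; rewrite ?mul1r ?mul0r.
  rewrite /emean -mulrBr -sumrB normrM gtr0_norm ?invr_gt0// ler_pdivrMl//.
  have -> : (n k)%:R * (r%:R * (share k a - freq (x k) (stage a m))) =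
      r%:R * (#|clust k a|%:R - \sum_(j < n k) (x k j \in stage a m)%:R).
    rewrite /share /freq; move: (\sum_(j < n k) _) (#|clust k a|%:R) => s t.
    by field; rewrite gt_eqF.
  rewrite -sum1_card natr_sum [X in X - _]big_mkcond/= -sumrB mulr_sumr.
  rewrite (le_trans (ler_norm_sum _ _ _))// ler_sum// => j _.
  rewrite -mulrBl normrM mulrC.
  have xji : `|x k j i 0| <= r%:R by rewrite (le_trans (entry_le_norm _ _ _)).
  have [jm|jm] := boolP (x k j \in stage a m).
    by rewrite (stage_data cK sh (set_mem jm)) subrr normr0 !mulr0.
  case: ifP => _; first by rewrite sub0r normrN normr1 mulr1 subr0 mulr1.
  by rewrite subrr normr0 !mulr0.
have eE : (4 * r%:R + 2) * e' = e by rewrite /e' mulrC divfK// gt_eqF.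
have h6 : r%:R * (share k a - freq (x k) (stage a m)) <= r%:R * (3 * e').
  rewrite ler_wpM2l//; move: f1 f2; rewrite !ltr_norml => /andP[? ?] /andP[? ?].
  by have := hm a; have := prob_le P (mstage a m) (mcell a) sa; lra.
move: h4 h5 f3; rewrite !ler_norml !ltr_norml => /andP[? ?] /andP[? ?] /andP[? ?].
by apply/andP; split; lra.
Qed.

End limit_cells.

(** * Delta as a sum of cell scores *)

Section limit_score.
Variables (R : realType) (d : nat) (Sigma : 'M[R]_d).
Hypothesis pS : posdefmx Sigma.
Local Notation Si := (invmx Sigma).

(** The contribution of a cell of mass [p] and first moment [s]: the mean being
[s / p], the second term is half the mass times the squared norm of the
rescaled mean. *)
Definition cell_score (p : R) (s : 'cV[R]_d) : R := p * ln p + 2^-1 * (bil Si s s / p).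

Lemma cell_score0 s : cell_score 0 s = 0.
Proof. by rewrite /cell_score mul0r invr0 !mulr0 addr0. Qed.

Section delta.
Variable P : probability 'cV[R]_d R.
Local Notation pr := (prob P).

(** Unlike the conditional mean, the first moment depends continuously on a cell whose
mass vanishes. *)
Definition moment (G : set 'cV[R]_d) : 'cV[R]_d := \col_i \int[P]_(y in G) y i 0.

Lemma finite_set_enum (F : set (set 'cV[R]_d)) : finite_set F ->
  exists m (G : 'I_m -> set 'cV[R]_d), injective G /\ F = range G.
Proof.
move=> fF; pose s : seq (set 'cV[R]_d) := fset_set F.
exists (size s), (fun i => nth set0 s i); split.
  move=> i j /eqP; rewrite nth_uniq// => [/eqP|]; first exact: val_inj.
  exact: fset_uniq.
apply/seteqP; split => [G FG|_ [i _ <-]].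
  have Gs : G \in s by rewrite /s/= in_fset_set// inE.
  have iG : (index G s < size s)%N by rewrite index_mem.
  by exists (Ordinal iG) => //=; rewrite nth_index.
have : nth set0 s i \in s by rewrite mem_nth.
by rewrite /s/= in_fset_set// inE.
Qed.

Lemma Delta_range m (G : 'I_m -> set 'cV[R]_d) : injective G ->
  Delta P Sigma (range G) = \sum_i cell_score (pr (G i)) (moment (G i)).
Proof.
move=> Ginj; have frange (f : set 'cV[R]_d -> R) :
    \sum_(A \in range G) f A = \sum_(i < m) f (G i).
  rewrite fsbig_image; last by move=> i j _ _; exact: Ginj.
  rewrite [RHS]fsbig_seq ?index_enum_uniq//; apply: eq_fsbigl.
  by apply/seteqP; split => i //= _; exact: mem_index_enum.
rewrite /Delta !frange mulr_sumr -big_split/=; apply: eq_bigr => i _.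
rewrite /cell_score addrC; congr (_ + _ * _).
have -> : condmean P (G i) = (pr (G i))^-1 *: moment (G i).
  by apply/colP => j; rewrite !mxE.
rewrite energyE// bilZl bilZr.
have [->|p0] := eqVneq (pr (G i)) 0; first by rewrite mul0r invr0 mulr0.
by rewrite mulVKf// mulrC.
Qed.

End delta.

Section convergence.
Variables (U : set_system nat) (FU : ProperFilter U).

Lemma bil_cvg (A : 'M[R]_d) (s : nat -> 'cV[R]_d) (s0 : 'cV[R]_d) :
  (forall i, (fun k => s k i 0) @ U --> s0 i 0) ->
  (fun k => bil A (s k) (s k)) @ U --> bil A s0 s0.
Proof.
move=> ss0.
have bE v : bil A v v = \sum_j (\sum_i v i 0 * A i j) * v j 0.
  rewrite /bil mxE; apply: eq_bigr => j _; rewrite mxE; congr (_ * _).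
  by apply: eq_bigr => i _; rewrite mxE.
rewrite bE (_ : (fun k => _) = (fun k => \sum_j (\sum_i s k i 0 * A i j) * s k j 0)); last first.
  by apply/funext => k; rewrite bE.
apply: cvg_sumr => j; apply: cvgM; last exact: ss0.
by apply: cvg_sumr => i; apply: cvgM; [exact: ss0|exact: cvg_cst].
Qed.

(** [ln z <= z] at [z = y ^ (-1/2)]. *)
Lemma xlnx_bound (y : R) : 0 <= y <= 1 -> `|y * ln y| <= 2 * Num.sqrt y.
Proof.
move=> /andP[y0 y1]; have [->|yn0] := eqVneq y 0; first by rewrite mul0r normr0 sqrtr0 mulr0.
have yp : 0 < y by rewrite lt_neqAle eq_sym yn0.
have sp : 0 < Num.sqrt y by rewrite sqrtr_gt0.
have ys : y = Num.sqrt y ^+ 2 by rewrite sqr_sqrtr.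
rewrite ler0_norm; last by rewrite mulr_ge0_le0// ln_le0.
have l : - ln y = 2 * ln (Num.sqrt y)^-1.
  by rewrite lnV ?posrE// [in LHS]ys lnXn// mulrN mulr2n mulrDl mul1r opprD.
rewrite -mulrN l mulrCA ler_wpM2l//.
have h : ln (Num.sqrt y)^-1 <= (Num.sqrt y)^-1.
  by apply/ltW/ln_sublinear; rewrite invr_gt0.
have := ler_wpM2l y0 h; rewrite [X in _ <= X * _ -> _]ys expr2 mulfK ?gt_eqF//.
Qed.

Lemma cell_score_cvg (r : R) (p : nat -> R) (s : nat -> 'cV[R]_d) p0 (s0 : 'cV[R]_d) :
  0 <= r -> (forall k, 0 <= p k) -> (forall k, `|s k| <= p k * r) ->
  p @ U --> p0 -> (forall i, (fun k => s k i 0) @ U --> s0 i 0) ->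
  (fun k => cell_score (p k) (s k)) @ U --> cell_score p0 s0.
Proof.
move=> r0 pge0 sr pp0 ss0.
have p0ge0 : 0 <= p0.
  by apply: (cvgr_to_ge pp0); exact: filterE.
have [E|p0n0] := eqVneq p0 0; last first.
  have p0p : 0 < p0 by rewrite lt_neqAle eq_sym p0n0.
  apply: cvgD.
    apply: cvgM => //; apply: continuous_cvg pp0.
    exact: continuous_ln.
  apply: cvgM; first exact: cvg_cst.
  by apply: cvgM; [exact: bil_cvg|exact: cvgV].
(* If the mass tends to 0, so do the entropy term, by [xlnx_bound], and the energy,
   which is at most of the order of the mass. *)
rewrite E cell_score0; rewrite E in pp0.
apply/cvgrPdist_lt => e e0.
have sq : (fun k => Num.sqrt (p k)) @ U --> (0 : R).
  by rewrite -[X in _ --> X]sqrtr0; apply: continuous_cvg pp0; exact: sqrt_continuous.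
have e40 : 0 < e / 4 by rewrite divr_gt0.
have c0 : 0 < mx_size Si * r ^+ 2 + 1 by rewrite ltr_wpDl// mulr_ge0 ?mx_size_ge0 ?sqr_ge0.
have /cvgrPdist_lt/(_ _ e40) h1 := sq.
have /cvgrPdist_lt/(_ _ (divr_gt0 e0 c0)) h2 := pp0.
have /cvgrPdist_lt/(_ _ ltr01) h3 := pp0.
near=> k.
have : `|0 - Num.sqrt (p k)| < e / 4 by near: k.
have : `|0 - p k| < e / (mx_size Si * r ^+ 2 + 1) by near: k.
have : `|0 - p k| < 1 by near: k.
rewrite !sub0r !normrN (ger0_norm (pge0 k)) (ger0_norm (sqrtr_ge0 _)) => k1 k2 k3.
have k4 := @xlnx_bound (p k); rewrite pge0 (ltW k1) in k4.
have {k4} := k4 isT => k4.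
have k5 : `|bil Si (s k) (s k) / p k| <= mx_size Si * r ^+ 2 * p k.
  have [->|pn0] := eqVneq (p k) 0; first by rewrite invr0 !mulr0 normr0.
  have pp : 0 < p k by rewrite lt_neqAle eq_sym pn0 pge0.
  rewrite normrM [X in _ * X]gtr0_norm ?invr_gt0// ler_pdivrMr//.
  rewrite (le_trans (bil_le _ _ _))// -!mulrA; apply: ler_wpM2l; first exact: mx_size_ge0.
  by apply: (le_trans (ler_pM _ _ (sr k) (sr k))) => //; apply/le_of_eq; ring.
rewrite ltr_pdivlMr// in k2; rewrite mulrC mulrDl mul1r in k2.
have pk0 := pge0 k.
rewrite /cell_score (le_lt_trans (ler_normD _ _))// [X in _ + X]normrM (@ger0_norm _ 2^-1)//.
move: k4 k5; set u := `| _ |; set v := `| _ |; lra.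
Unshelve. all: by end_near. Qed.

End convergence.

End limit_score.

(** * From log posteriors to scores *)

Section score_estimate.
Variables (R : realType) (d : nat) (alpha : R) (T Sigma : 'M[R]_d).
Hypotheses (alpha_gt0 : 0 < alpha) (pT : posdefmx T) (pS : posdefmx Sigma).
Local Notation lw := (log_weight alpha T Sigma).
Local Notation Si := (invmx Sigma).
Local Notation D := ((d + 2)%:R / 2 : R).

(** Stirling's bounds turn the log weights into the limit score; the factors
that are polynomial in the sizes only cost a logarithm per cluster. *)
Lemma score_estimate (r : R) : 0 <= r -> exists2 B : R, 0 <= B &
  forall n (x : 'I_n -> 'cV[R]_d) (JJ : {set {set 'I_n}}), (0 < n)%N ->
  (forall j, `|x j| <= r) -> finset.partition JJ [set: 'I_n]%SET ->
  `|\sum_(J in JJ) lw #|J| (\sum_(j in J) x j) - (n%:R * ln n%:R - n%:R)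
    - n%:R * \sum_(J in JJ) cell_score Sigma (#|J|%:R / n%:R)
        (n%:R^-1 *: \sum_(j in J) x j)| <= #|JJ|%:R * (B * (1 + ln n%:R)).
Proof.
move=> r0; have [K K0 KP] := log_weight_approx alpha pT pS r0.
have D0 : 0 <= D by [].
exists (K + 1 + D) => [|n x JJ n0 xr pJJ]; first by rewrite !addr_ge0.
have n1 : (0 : R) < n%:R by rewrite ltr0n.
have gt0 := partition_nonempty pJJ.
have -> : n%:R * ln n%:R - n%:R = \sum_(J in JJ) (#|J|%:R * ln n%:R - #|J|%:R) :> R.
  by rewrite sumrB -mulr_suml sum_card_partition.
rewrite mulr_sumr -!sumrB (le_trans (ler_norm_sum _ _ _))// mulr_natl -sumr_const.
apply: ler_sum => J JJJ; have J0 := gt0 _ JJJ.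
have J1 : (0 : R) < #|J|%:R by rewrite ltr0n.
have sJ := norm_sum_le J xr.
have lJn : ln #|J|%:R <= ln n%:R :> R.
  by rewrite ler_ln ?posrE// ler_nat -[X in (_ <= X)%N](card_ord n) max_card.
have lJ0 := ln_nat_ge0 R #|J|.
have := KP _ _ J0 sJ; have := ln_fact_ge R #|J|; have := ln_fact_le R #|J|.
have -> : n%:R * cell_score Sigma (#|J|%:R / n%:R) (n%:R^-1 *: \sum_(j in J) x j) =
    #|J|%:R * ln #|J|%:R - #|J|%:R * ln n%:R
      + 2^-1 * (bil Si (\sum_(j in J) x j) (\sum_(j in J) x j) / #|J|%:R).
  rewrite /cell_score ln_div ?posrE// bilZl bilZr.
  move: (bil Si _ _) (ln _) (ln _) => b l l'.
  by field; rewrite !gt_eqF.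
have Dl : D * ln #|J|%:R <= D * ln n%:R by rewrite ler_wpM2l.
have Dl0 : 0 <= D * ln #|J|%:R by rewrite mulr_ge0.
have K1 : 0 <= K * ln n%:R by rewrite mulr_ge0// ln_nat_ge0.
rewrite !ler_norml => f1 f2 /andP[l1 l2].
move: f1 f2 l1 l2; move: (lw _ _) (bil _ _ _ / _) (ln (#|J|)`!%:R) => w q f f1 f2 l1 l2.
by apply/andP; split; lra.
Qed.

Lemma log_negligible (B e : R) : 0 <= B -> 0 < e ->
  exists2 m : nat, (0 < m)%N & forall n, (m <= n)%N -> B * (1 + ln n%:R) <= e * n%:R.
Proof.
move=> B0 e0; pose m := (Num.truncn ((3 * B / e) ^+ 2)).+1.
exists m => // n mn; have n0 : (0 < n)%N by exact: leq_trans mn.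
have n1 : (1 : R) <= n%:R by rewrite ler1n.
have np : (0 : R) < n%:R by rewrite ltr0n.
have sn : n%:R = Num.sqrt n%:R ^+ 2 :> R by rewrite sqr_sqrtr.
have s1 : 1 <= Num.sqrt n%:R :> R by have := ler_wsqrtr n1; rewrite sqrtr1.
have l2 : ln n%:R <= 2 * Num.sqrt n%:R :> R.
  have -> : ln n%:R = 2 * ln (Num.sqrt n%:R) :> R.
    by rewrite {1}sn lnXn ?sqrtr_gt0// mulr2n mulrDl mul1r.
  by rewrite ler_wpM2l//; apply/ltW/ln_sublinear; rewrite sqrtr_gt0.
have s2 : 3 * B / e <= Num.sqrt n%:R.
  rewrite -[leLHS]ger0_norm ?divr_ge0 ?mulr_ge0 ?(ltW e0)// -sqrtr_sqr ler_wsqrtr//.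
  apply: (@le_trans _ _ m%:R); last by rewrite ler_nat.
  exact/ltW/truncnS_gt.
rewrite ler_pdivrMr// in s2.
apply: (@le_trans _ _ (B * (3 * Num.sqrt n%:R))); first by rewrite ler_wpM2l//; lra.
have := ler_wpM2r (sqrtr_ge0 (n%:R : R)) s2.
rewrite [X in _ -> _ <= e * X]sn; lra.
Qed.

End score_estimate.

Section distances.
Variables (R : realType) (d : nat) (P : probability 'cV[R]_d R).
Implicit Types F G : set (set 'cV[R]_d).

Lemma dbar_ge0 F G : 0 <= dbar_P P F G.
Proof.
rewrite /dbar_P; apply/bigmin_geP; split => [|s _]; exact: bigmax_ge_id.
Qed.

Lemma fset_set_range m (A : 'I_m -> set 'cV[R]_d) : injective A ->
  size (fset_set (range A) : seq (set 'cV[R]_d)) = m /\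
  forall B, (B \in (fset_set (range A) : seq (set 'cV[R]_d))) = (B \in range A).
Proof.
move=> Ainj; have fA : finite_set (range A) by apply: finite_image; exact: finite_finset.
have mem B : (B \in (fset_set (range A) : seq (set 'cV[R]_d))) = (B \in range A).
  by rewrite in_fset_set.
split => //; rewrite -[RHS](size_enum_ord m) -(size_map A).
apply/eqP; rewrite eqn_leq; apply/andP; split; apply: uniq_leq_size.
- exact: fset_uniq.
- by move=> B; rewrite mem inE => -[i _ <-]; rewrite map_f// mem_enum.
- by rewrite map_inj_uniq// enum_uniq.
- by move=> B /mapP[i _ ->]; rewrite mem inE; exists i.
Qed.

Lemma dbar_le m (A B : 'I_m -> set 'cV[R]_d) (e : R) : injective A -> injective B ->
  0 <= e -> (forall i, dist_P P (A i) (B i) <= e) -> dbar_P P (range A) (range B) <= e.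
Proof.
move=> Ainj Binj e0 ABe.
have [sA mA] := fset_set_range Ainj; have [sB mB] := fset_set_range Binj.
rewrite /dbar_P; set a : seq (set 'cV[R]_d) := fset_set (range A) in sA mA *.
set b : seq (set 'cV[R]_d) := fset_set (range B) in sB mB *.
set M := maxn _ _.
have Mm : M = m by rewrite /M sA sB maxnn.
have /choice[f fP] : forall i : 'I_M, exists c, A c = nth set0 a i.
  move=> i; have : nth set0 a i \in a by rewrite mem_nth// sA -Mm.
  by rewrite mA inE => -[c _ <-]; exists c.
have gM i : (index (B (f i)) b < M)%N.
  by rewrite [X in (_ < X)%N]Mm -[X in (_ < X)%N]sB index_mem mB inE; exists (f i).
pose g i := Ordinal (gM i).
have ginj : injective g.
  move=> i j /(congr1 val)/= /(congr1 (nth set0 b)).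
  rewrite !nth_index ?mB ?inE; [|by exists (f j)|by exists (f i)].
  move=> /Binj fij; have : nth set0 a i = nth set0 a j by rewrite -!fP fij.
  move=> /eqP; rewrite nth_uniq ?sA -?Mm// ?fset_uniq// => /eqP.
  exact: val_inj.
apply: le_trans; first exact: (bigmin_le _ (perm ginj)).
apply/bigmax_leP; split => // i _.
rewrite permE /g/= nth_index ?mB ?inE; last by exists (f i).
by rewrite -fP.
Qed.

End distances.

(** * Limits of MAP partitions *)

Section core.
Variables (R : realType) (d : nat) (alpha : R) (T Sigma : 'M[R]_d).
Hypotheses (d_ge1 : (1 <= d)%N) (alpha_gt0 : 0 < alpha).
Hypotheses (pT : posdefmx T) (pS : posdefmx Sigma).
Variable P : probability 'cV[R]_d R.
Hypotheses (P_bounded : bounded_set (msupport P)).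
Hypotheses (P_ac : P `<< @lebesgue_vector R d).
Local Notation pr := (prob P).
Variables (U : set_system nat) (UU : UltraFilter U).
Variables (n : nat -> nat) (x : forall k : nat, 'I_(n k) -> 'cV[R]_d).
Arguments x : clear implicits.
Variables (r : nat) (EE : set (set 'cV[R]_d)).
Hypotheses (xr : forall (k : nat) (j : 'I_(n k)), `|x k j| <= r%:R).
Hypotheses (Sr : forall y, msupport P y -> `|y| <= r%:R).
Hypotheses (n_oo : forall m, U [set k | (m <= n k)%N]).
Hypotheses (EA : event_algebra EE).
Hypothesis Efreq : forall E, EE E -> (fun k => freq (x k) E) @ U --> pr E.

Definition empirical_score k (KK : {set {set 'I_(n k)}}) : R :=
  \sum_(J in KK) cell_score Sigma (#|J|%:R / (n k)%:R)
    ((n k)%:R^-1 *: \sum_(j in J) x k j).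

Lemma null_diff (A B : set 'cV[R]_d) : measurable A -> measurable B -> B `<=` A ->
  P.-negligible (A `\` B) -> pr A = pr B /\ moment P A = moment P B.
Proof.
move=> mA mB BA nAB.
have p0 : pr (A `\` B) = 0 by apply: prob_negligible => //; exact: measurableD.
split; first by rewrite (prob_setID P mA mB) p0 addr0 setIidr.
apply/colP => i; rewrite !mxE; apply/eqP; rewrite -subr_eq0 -normr_le0.
have r0 : (0 : R) <= r%:R by [].
have := coord_integral_dist r0 Sr i mA mB.
rewrite p0 (_ : B `\` A = set0); last by apply/seteqP; split => // y [/BA].
by rewrite /prob measure0 addr0 mulr0.
Qed.

(** A finite [P]-partition, made disjoint and completed by the null remainder,
cuts every sample into clusters whose score tends to its [Delta]. *)
Lemma induced_score (F : set (set 'cV[R]_d)) : finite_set F -> P_partition P F ->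
  (forall G, F G -> EE G) ->
  exists (KK : forall k, {set {set 'I_(n k)}}) (m : nat),
    [/\ forall k, finset.partition (KK k) [set: 'I_(n k)]%SET,
        forall k, (#|KK k| <= m)%N &
        (fun k => empirical_score (KK k)) @ U --> Delta P Sigma F].
Proof.
move=> finF [mF coverF disjF] FE.
have [EM EC EU _ _] := EA.
have [m [G [Ginj FG]]] := finite_set_enum finF.
have FGi i : F (G i) by rewrite FG; exists i.
pose Gx (l : nat) : set 'cV[R]_d := if insub l is Some i then G (i : 'I_m) else setT.
have E0 := event_algebra0 EA.
have ET : EE setT by rewrite -setC0; exact: EC.
have EGx l : EE (Gx l) by rewrite /Gx; case: insubP => [i _ _|_] //; apply: FE.
pose H := seqDU Gx.
have EH l : EE (H l).
  rewrite /H /seqDU setDE; apply: event_algebraI => //; apply: EC.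
  by elim/big_ind: _ => // A B; exact: EU.
have mH l : measurable (H l) by exact: EM.
have Hcover y : exists i : 'I_m.+1, H i y.
  have : (\big[setU/set0]_(l < m.+1) Gx l) y.
    by rewrite big_ord_recr/=; right; rewrite /Gx insubN// -leqNgt.
  rewrite bigsetU_seqDU -(big_mkord xpredT (seqDU Gx)) -bigcup_seq => -[l /=].
  by rewrite mem_index_iota => /= lm Hl; exists (Ordinal lm).
have Hdisj (i j : nat) y : H i y -> H j y -> i = j.
  by move=> Hi Hj; apply: (@trivIset_seqDU _ Gx i j) => //; exists y.
have GxE (i : 'I_m) : Gx i = G i by rewrite /Gx valK.
have nG (i l : 'I_m) : i != l -> P.-negligible (G i `&` G l).
  move=> il; apply/negligibleP; first by apply: measurableI; exact: mF.
  by apply: disjF => // /Ginj; exact/eqP.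
have prH (i : 'I_m) : pr (G i) = pr (H i) /\ moment P (G i) = moment P (H i).
  apply: null_diff => //; first exact: mF.
    by rewrite -GxE; exact: subset_seqDU.
  pose N (l : 'I_m) : set 'cV[R]_d := if l == i then set0 else G i `&` G l.
  apply: (@negligibleS _ _ _ _ (\bigcup_l N l)).
    move=> y [Gy nHy].
    have : (\big[setU/set0]_(l < i) Gx l) y.
      by apply: contrapT => h; apply: nHy; split => //; rewrite GxE.
    rewrite -(big_mkord xpredT Gx) -bigcup_seq => -[l /=].
    rewrite mem_index_iota => /= li Gl.
    have lm : (l < m)%N by exact: ltn_trans li (ltn_ord i).
    exists (Ordinal lm) => //; rewrite /N -val_eqE/= ltn_eqF//; split => //.
    by move: Gl; rewrite -[l]/(val (Ordinal lm)) GxE.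
  apply: negligible_bigcup_countable => l; rewrite /N.
  by case: eqVneq => [_|li]; [exact: negligible_set0|apply: nG; rewrite eq_sym].
have prHm : pr (H m) = 0.
  apply: prob_negligible => //.
  have mC : measurable (\bigcup_(A in F) A).
    rewrite FG bigcup_image; apply: measurable_bigcup_ord => i; exact: mF.
  apply: (@negligibleS _ _ _ _ (~` \bigcup_(A in F) A)).
    move=> y [_ nGy] [A FA Ay]; apply: nGy.
    move: FA; rewrite FG => -[i _ GA].
    rewrite -(big_mkord xpredT Gx) -bigcup_seq; exists (val i).
      by rewrite /= mem_index_iota ltn_ord.
    by rewrite GxE GA.
  apply/negligibleP; first exact: measurableC.
  apply: etrans (probability_setC P mC) _.
  by rewrite coverF subee.
pose L k (i : 'I_m.+1) : {set 'I_(n k)} := [set j | x k j \in H i]%SET.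
pose I k : {set 'I_m.+1} := [set i | L k i != finset.set0]%SET.
pose KK k : {set {set 'I_(n k)}} := [set L k i | i in I k]%SET.
have Ldisj k (i j : 'I_m.+1) : j != i -> fintype.disjoint (mem (L k i)) (mem (L k j)).
  move=> ji; rewrite -setI_eq0; apply/eqP/setP => a; rewrite !inE.
  apply/negP => /andP[]; rewrite !inE => Hi Hj.
  by move/negP: ji; apply; apply/eqP/val_inj; exact: Hdisj Hj Hi.
have KKP k : finset.partition (KK k) (finset.cover (KK k)) /\ {in I k &, injective (L k)}.
  apply: (@indexed_partition _ _ (mem (I k)) (L k)).
    by move=> i j _ _; exact: Ldisj.
  by move=> i Ii; have : i \in I k by []; rewrite inE.
exists KK, m.+1; split.
- move=> k; have [+ _] := KKP k; congr (finset.partition _ _).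
  apply/setP => j; rewrite inE; apply/bigcupP.
  have [i Hi] := Hcover (x k j).
  have jL : j \in L k i by rewrite inE; exact: mem_set.
  exists (L k i) => //; apply: imset_f; rewrite inE.
  by apply/set0Pn; exists j.
- by move=> k; rewrite (leq_trans (leq_imset_card _ _))// -[X in (_ <= X)%N](card_ord m.+1) max_card.
have -> : Delta P Sigma F = \sum_(i < m.+1) cell_score Sigma (pr (H i)) (moment P (H i)).
  rewrite FG Delta_range// big_ord_recr/= prHm cell_score0 addr0.
  by apply: eq_bigr => i _; have [-> ->] := prH i.
rewrite (_ : (fun k => _) = fun k => \sum_(i < m.+1) cell_score Sigma
    (#|L k i|%:R / (n k)%:R) ((n k)%:R^-1 *: \sum_(j in L k i) x k j)); last first.
  apply/funext => k; rewrite /empirical_score big_imset/=; last by have [] := KKP k.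
  rewrite big_mkcond/=; apply: eq_bigr => i _; rewrite inE.
  by case: eqVneq => //= ->; rewrite cards0 mul0r cell_score0.
have r0 : (0 : R) <= r%:R by [].
apply: cvg_sumr => i; apply: (cell_score_cvg _ r0).
- by move=> k; rewrite divr_ge0.
- move=> k; rewrite normrZ ger0_norm ?invr_ge0// mulrAC [leRHS]mulrC.
  by rewrite ler_wpM2l ?invr_ge0// norm_sum_le.
- rewrite (_ : (fun k => _) = fun k => freq (x k) (H i)); first exact: Efreq.
  apply/funext => k; rewrite /freq mulrC; congr (_ * _).
  rewrite -sum1_card natr_sum big_mkcond/=; apply: eq_bigr => j _.
  by rewrite inE; case: (_ \in _).
- move=> c; rewrite (_ : (fun k => _) = fun k => emean (x k) (H i) c); last first.
    apply/funext => k; rewrite /emean mxE summxE; congr (_ * _).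
    rewrite big_mkcond/=; apply: eq_bigr => j _.
    by rewrite inE; case: (_ \in _); rewrite ?mul1r ?mul0r.
  rewrite [X in _ --> X]mxE.
  by apply: (@mean_cvg _ _ P r _ _ n) EA Efreq _ _ (EH i).
Qed.

Variable JJ : forall k, {set {set 'I_(n k)}}.
Hypothesis mapJJ : forall k, MAP_partition alpha T Sigma (x k) (JJ k).

(** The log posteriors of the two partitions have the main term [n * ln n - n] in
common, and with boundedly many clusters the errors of the scores are [o(n)], so
the optimality of the MAP partition passes to the limit. *)
Lemma score_comparison (KK : forall k, {set {set 'I_(n k)}}) (m K : nat) (a b : R) :
  (forall k, finset.partition (KK k) [set: 'I_(n k)]%SET) ->
  (forall k, (#|KK k| <= m)%N) -> U [set k | #|JJ k| = K] ->
  (fun k => empirical_score (KK k)) @ U --> a ->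
  (fun k => empirical_score (JJ k)) @ U --> b -> a <= b.
Proof.
move=> pKK cKK cJJ KKa JJb; apply/ler_addgt0Pr => e e0.
have r0 : (0 : R) <= r%:R by [].
have [B B0 BP] := score_estimate alpha pT pS r0.
have mKB0 : 0 <= (m + K)%:R * B by rewrite mulr_ge0.
have [m0 m00 m0P] := log_negligible mKB0 e0.
have JJbe : (fun k => empirical_score (JJ k) + e) @ U --> b + e.
  by apply: cvgD => //; exact: cvg_cst.
apply: (ler_cvg_to KKa JJbe).
apply: filterS (filterI cJJ (n_oo m0)) => k [/= cK mn].
have nk : (0 < n k)%N by exact: leq_trans mn.
have nk0 : (0 : R) < (n k)%:R by rewrite ltr0n.
have [pJJ _] := mapJJ k.
have := BP _ _ _ nk (@xr k) pJJ; have := BP _ _ _ nk (@xr k) (pKK k).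
rewrite -/(empirical_score (KK k)) -/(empirical_score (JJ k)).
have := MAP_log_weight alpha_gt0 pT pS (mapJJ k) (pKK k).
set s1 := \sum_(J in KK k) _; set s2 := \sum_(J in JJ k) _ => s12.
rewrite !ler_norml => /andP[l1 _] /andP[_ l2].
have B1 : 0 <= B * (1 + ln (n k)%:R) by rewrite mulr_ge0// addr_ge0// ln_nat_ge0.
have c1 : #|KK k|%:R * (B * (1 + ln (n k)%:R)) <= m%:R * (B * (1 + ln (n k)%:R)).
  by rewrite ler_wpM2r// ler_nat.
have c2 : #|JJ k|%:R = K%:R :> R by rewrite cK.
have := m0P _ mn; rewrite natrD -mulrA mulrDl => c3.
rewrite c2 in l2.
rewrite -(ler_pM2l nk0) mulrDr.
move: l1 l2 c1 c3; move: ((n k)%:R) (B * _) => *.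
lra.
Qed.

Lemma cluster_hulls_range k K : #|JJ k| = K ->
  cluster_hulls (x k) (JJ k) = range (@clust_hull R d n x JJ K k).
Proof.
move=> cK; apply/seteqP; split => [_ [J JJJ <-]|_ [a _ <-]].
  by have [a ->] := clust_surj cK JJJ; exists a.
by exists (clust JJ k a) => //; exact: clust_in.
Qed.

(** The limit cells of the hulls form a [P]-partition, whose [Delta] is the limit of
the scores of the MAP partitions, and these dominate the scores of the partitions
that any other [P]-partition cuts out of the samples. *)
Theorem MAP_limit : exists M : set (set 'cV[R]_d), [/\ finite_set M, P_partition P M,
  forall F, finite_set F -> P_partition P F -> (forall G, F G -> EE G) ->
    Delta P Sigma F <= Delta P Sigma M &
  forall e, 0 < e -> U [set k | dbar_P P (cluster_hulls (x k) (JJ k)) M < e]].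
Proof.
have r0 : (0 : R) <= r%:R by [].
have [delta delta0 deltaP] := MAP_cluster_size alpha_gt0 pT pS r0.
have n_gt0 : U [set k | (0 < n k)%N] := n_oo 1.
have sizeP k J : (0 < n k)%N -> J \in JJ k -> delta * (n k)%:R <= #|J|%:R.
  by move=> nk; exact: deltaP _ (@xr k) (mapJJ k) J.
(* Clusters of linear size are boundedly many, so their number is constant along
   the ultrafilter. *)
have [K cardJJ] : exists K, U [set k | #|JJ k| = K].
  pose N := Num.truncn delta^-1.
  have [K cK] : exists K : 'I_N.+1, U [set k | #|JJ k| = K].
    apply: (ultra_exists_fin UU); apply: filterS n_gt0 => k /= nk.
    have nk0 : (0 : R) < (n k)%:R by rewrite ltr0n.
    have cN : (#|JJ k| < N.+1)%N.
      rewrite ltnS /N truncn_ge_nat ?invr_ge0 ?(ltW delta0)//.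
      rewrite -[leRHS]mul1r ler_pdivlMr// -(ler_pM2r nk0) mul1r -mulrA.
      have [pJJ _] := mapJJ k; rewrite -[leRHS](sum_card_partition R pJJ).
      rewrite mulr_natl -sumr_const; apply: ler_sum => J; exact: sizeP.
    by exists (Ordinal cN).
  by exists K.
pose cell := @limit_cell R d U n x JJ K.
have sharecvg a : (fun k => @share R n JJ K k a) @ U --> pr (cell a).
  exact: (share_cvg d_ge1 alpha_gt0 pT pS P_bounded P_ac UU xr mapJJ n_gt0 cardJJ EA Efreq).
have cell_ge a : delta <= pr (cell a).
  apply: (cvgr_to_ge (sharecvg a)).
  apply: filterS (filterI cardJJ n_gt0) => k [/= cK nk].
  by rewrite /share ler_pdivlMr ?ltr0n//; apply: sizeP => //; exact: clust_in.
have cell_gt0 a : 0 < pr (cell a) by exact: lt_le_trans (cell_ge a).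
have cell_disj a b : a != b -> cell a `&` cell b = set0.
  exact: (limit_cells_disjoint d_ge1 alpha_gt0 pT pS UU xr mapJJ cardJJ).
have mcell a : measurable (cell a).
  by apply: open_measurable_mx; exact: limit_cell_open.
have cell_inj : injective cell.
  move=> a b ab; apply/eqP/negPn/negP => /cell_disj; rewrite ab setIid => h.
  by have := cell_gt0 b; rewrite h /prob measure0 ltxx.
have mU : measurable (\bigcup_a cell a) by exact: measurable_bigcup_ord.
exists (range cell); split.
- by apply: finite_image; exact: finite_finset.
- split.
  + by move=> _ [a _ <-].
  + rewrite bigcup_image (probE P mU) prob_bigcup//.
    by rewrite (limit_cells_sum d_ge1 alpha_gt0 pT pS P_bounded P_ac UU xr mapJJ cardJJ EA Efreq).
  + move=> _ _ [a _ <-] [b _ <-] ab; rewrite cell_disj ?measure0//.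
    by apply/eqP => ab'; apply: ab; rewrite ab'.
- move=> F finF PF FE.
  have [KK [m [pKK cKK KKF]]] := induced_score finF PF FE.
  apply: (score_comparison pKK cKK cardJJ KKF).
  rewrite Delta_range//.
  have h : (fun k => \sum_(a < K) cell_score Sigma (@share R n JJ K k a)
      ((n k)%:R^-1 *: \sum_(j in clust JJ k a) x k j)) @ U -->
      \sum_a cell_score Sigma (pr (cell a)) (moment P (cell a)).
    apply: cvg_sumr => a; apply: (cell_score_cvg _ r0).
    - by move=> k; rewrite /share divr_ge0.
    - move=> k; rewrite normrZ ger0_norm ?invr_ge0// /share mulrAC [leRHS]mulrC.
      by rewrite ler_wpM2l ?invr_ge0// norm_sum_le.
    - exact: sharecvg.
    - move=> i; rewrite [X in _ --> X]mxE.
      rewrite (_ : (fun k => _) = fun k => @clust_moment R d n x JJ K k a i); last first.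
        by apply/funext => k; rewrite mxE.
      exact: (clust_moment_cvg d_ge1 alpha_gt0 pT pS P_bounded P_ac UU xr mapJJ n_gt0
        cardJJ EA Efreq Sr).
  have eqn : \forall k \near U, \sum_(a < K) cell_score Sigma (@share R n JJ K k a)
      ((n k)%:R^-1 *: \sum_(j in clust JJ k a) x k j) = empirical_score (JJ k).
    by apply: filterS cardJJ => k /= cK; rewrite /empirical_score (clust_sum _ cK).
  exact: cvg_trans (near_eq_cvg eqn) h.
- move=> e e0; have e20 : 0 < e / 2 by rewrite divr_gt0.
  have dcvg := cell_dist_cvg d_ge1 alpha_gt0 pT pS P_bounded P_ac UU xr mapJJ n_gt0
    cardJJ EA Efreq e20.
  (* Charged stages make the hulls pairwise different, so that they can be indexed
   like the cells. *)
have [m hm] : exists m, forall a : 'I_K, 0 < pr (stage U x JJ a m).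
    have [c c0 cP] : exists2 c : R, 0 < c & forall a, c <= pr (cell a).
      by exists delta => // a; exact: cell_ge.
    have [m hm] := stage_approx P UU x JJ K EA c0.
    by exists m => a; have := hm a; have := cP a; rewrite /cell; lra.
  apply: filterS (filterI dcvg (stage_event UU x n_gt0 cardJJ EA m)) => k [/= dk [cK nk sk]].
  rewrite (cluster_hulls_range cK).
  apply: (@le_lt_trans _ _ (e / 2)); last by lra.
  apply: dbar_le => //; last 2 first.
  + exact: ltW.
  + by move=> a; exact: ltW.
  move=> a b ab; apply/eqP/negPn/negP => nab.
  have [_ [oa _]] := stageP UU x JJ EA a m.
  have [y ya] : stage U x JJ a m !=set0.
    by apply/set0P/eqP => h; have := hm a; rewrite h /prob measure0 ltxx.
  apply: (hulls_open_disjoint d_ge1 alpha_gt0 pT pS xr mapJJ cK nab oa ya (sk a)).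
  by rewrite -ab; exact: sk.
Qed.

End core.

(** * The law of large numbers for indicators *)

Lemma square_between n : (0 < n)%N -> exists m, (m.+1 ^ 2 <= n < m.+2 ^ 2)%N.
Proof.
elim: n => // -[_ _|n IH _]; first by exists 0%N.
have [//|m /andP[m1 m2]] := IH.
have [n2|n2] := ltnP n.+2 (m.+2 ^ 2); first by exists m; rewrite n2 andbT (leq_trans m1).
by exists m.+1; rewrite n2/= (leq_ltn_trans m2)// ltn_exp2r.
Qed.

Lemma sum_inverse_squares (R : realType) n :
  \sum_(0 <= m < n.+1) (m.+1%:R ^+ 2)^-1 <= 2 - n.+1%:R^-1 :> R.
Proof.
elim: n => [|n IH]; first by rewrite big_nat1 expr1n invr1; lra.
rewrite big_nat_recr//= (le_trans (lerD IH (lexx _)))// -addrA lerD2l.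
have : (0 : R) < n.+1%:R by rewrite ltr0n.
rewrite -[n.+2%:R]natr1; move: (n.+1%:R : R) => t t0.
have t1 : 0 < t + 1 by rewrite addr_gt0.
rewrite -subr_ge0.
have -> : - (t + 1)^-1 - (- t^-1 + ((t + 1) ^+ 2)^-1) = (t * (t + 1) ^+ 2)^-1.
  by field; rewrite !gt_eqF.
by rewrite invr_ge0 mulr_ge0 ?exprn_ge0 ?ltW.
Qed.

Section law_of_large_numbers.
Variables (R : realType) (dO : measure_display) (Omega : measurableType dO).
Variables (Pr : probability Omega R) (B : nat -> set Omega) (p : R).
Hypotheses (mB : forall j, measurable (B j)) (PrB : forall j, Pr (B j) = p%:E).
Hypothesis PrBB : forall i j, i != j -> Pr (B i `&` B j) = (p * p)%:E.

Definition deviation n w : R := \sum_(j < n) (w \in B j)%:R - n%:R * p.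

Let p01 : 0 <= p <= 1.
Proof.
by rewrite -!lee_fin -(PrB 0) measure_ge0/= probability_le1.
Qed.

Lemma measurable_deviation n : measurable_fun setT (deviation n).
Proof.
have [/measurable_int/measurable_EFinP h _] := ladder_integrable Pr (- (n%:R * p)) 1
  (index_enum 'I_n) measurableT (fun i : 'I_n => mB i).
rewrite (_ : deviation n = ladder (- (n%:R * p)) 1 (index_enum 'I_n) (fun i : 'I_n => B i))//.
by apply/funext => w; rewrite /deviation /ladder mul1r addrC.
Qed.

Lemma measurable_large_deviation n (c : R) :
  measurable [set w | (c <= `|deviation n w|)%R].
Proof.
rewrite (_ : mkset _ = setT `&` (fun w => `|deviation n w|) @^-1` `[c, +oo[).
  by apply: (measurableT_comp (@normr_measurable R setT) (measurable_deviation n)).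
by apply/seteqP; split => w /=; rewrite in_itv/= andbT => //; case.
Qed.

(** Pairwise independence makes the variances of the indicators add up. *)
Lemma variance_le n : Pr.-integrable setT (EFin \o (fun w => deviation n w ^+ 2)) /\
  \int[Pr]_w (deviation n w ^+ 2) <= n%:R.
Proof.
pose f1 := @ladder R dO Omega ('I_n * 'I_n)%type 0 1 (index_enum _) (fun q => B q.1 `&` B q.2).
pose f2 := @ladder R dO Omega 'I_n (n%:R ^+ 2 * p ^+ 2) (- (2 * n%:R * p)) (index_enum _)
  (fun i => B i).
have E : (fun w => deviation n w ^+ 2) = (fun w => f1 w + f2 w).
  apply/funext => w; rewrite /deviation /f1 /f2 /ladder add0r mul1r.
  have -> : \sum_(q : 'I_n * 'I_n) (w \in B q.1 `&` B q.2)%:R =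
      (\sum_(j < n) (w \in B j)%:R) ^+ 2 :> R.
    rewrite expr2 mulr_suml -(pair_bigA _ (fun i j : 'I_n => (w \in B i `&` B j)%:R))/=.
    apply: eq_bigr => i _; rewrite mulr_sumr; apply: eq_bigr => j _.
    by rewrite in_setI; case: (w \in B i); rewrite ?mul1r ?mul0r.
  by ring.
have [i1 I1] := @ladder_integrable R dO Omega Pr _ setT 0 1 (index_enum ('I_n * 'I_n)%type)
  (fun q => B q.1 `&` B q.2) measurableT (fun q => measurableI _ _ (mB _) (mB _)).
have [i2 I2] := ladder_integrable Pr (n%:R ^+ 2 * p ^+ 2) (- (2 * n%:R * p)) (index_enum 'I_n)
  measurableT (fun i : 'I_n => mB i).
rewrite -/f1 in i1 I1; rewrite -/f2 in i2 I2.
split.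
  rewrite E [X in _.-integrable _ X](_ : _ = (EFin \o f1) \+ (EFin \o f2))//.
  exact: integrableD.
rewrite E RintegralD// I1 I2 mul0r add0r mul1r probability_setT/= mulr1.
rewrite (eq_bigr (fun q : 'I_n * 'I_n => p * p + (q.1 == q.2)%:R * (p - p * p))); last first.
  move=> [i j] _ /=; rewrite setTI; have [->|ij] := eqVneq i j.
    by rewrite setIid PrB/= mul1r addrC subrK.
  by rewrite PrBB//= mul0r addr0.
rewrite (eq_bigr (fun=> p)); last by move=> i _; rewrite setTI PrB.
rewrite big_split/= !sumr_const !card_prod !card_ord.
have -> : \sum_(q : 'I_n * 'I_n) (q.1 == q.2)%:R * (p - p * p) = n%:R * (p - p * p).
  rewrite -mulr_suml; congr (_ * _).
  rewrite -(pair_bigA _ (fun i j : 'I_n => (i == j)%:R))/=.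
  rewrite (eq_bigr (fun=> 1)); first by rewrite sumr_const card_ord.
  by move=> i _; rewrite (bigD1 i)//= eqxx big1 ?addr0// => j; rewrite eq_sym => /negPf->.
rewrite -[p * p *+ _]mulr_natl -[p *+ _]mulr_natl natrM.
have -> : n%:R * n%:R * (p * p) + n%:R * (p - p * p) +
    (n%:R ^+ 2 * p ^+ 2 + - (2 * n%:R * p) * (n%:R * p)) = n%:R * (p - p * p) by ring.
rewrite ler_piMr//; have /andP[p0 p1] := p01; nra.
Qed.

Lemma chebyshev_deviation n (c : R) : 0 < c ->
  (Pr [set w | (c <= `|deviation n w|)%R] <= (n%:R / c ^+ 2)%:E)%E.
Proof.
move=> c0; set A := [set w | _].
have mA : measurable A by exact: measurable_large_deviation.
have [iv V] := variance_le n.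
have [iA IA] := ladder_integrable Pr 0 (c ^+ 2) [:: tt] measurableT (fun=> mA).
rewrite -[leLHS]fineK ?fin_num_measure// lee_fin ler_pdivlMr ?exprn_gt0// mulrC.
apply: le_trans V; move: IA; rewrite mul0r add0r big_seq1 setTI => <-.
apply: le_Rintegral => // w _; rewrite /ladder add0r big_seq1.
case: (asboolP (A w)) => Aw.
  rewrite mem_set// mulr1 -[leRHS]real_normK ?num_real//.
  by rewrite ler_pXn2r// nnegrE ltW.
by rewrite memNset// mulr0 sqr_ge0.
Qed.

Lemma deviation_dist k n w : (k <= n)%N ->
  `|deviation n w| <= `|deviation k w| + (n - k)%:R.
Proof.
move=> kn; rewrite -(subnKC kn) addKn.
have -> : deviation (k + (n - k)) w = deviation k w +
    \sum_(j < n - k) ((w \in B (k + j)%N)%:R - p).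
  rewrite /deviation big_split_ord/= sumrB sumr_const card_ord natrD mulrDl -[p *+ _]mulr_natl.
  by rewrite opprD addrACA.
rewrite (le_trans (ler_normD _ _))// lerD2l (le_trans (ler_norm_sum _ _ _))//.
rewrite -[X in _ <= X%:R](card_ord (n - k)) -sumr_const; apply: ler_sum => j _.
have /andP[p0 p1] := p01.
by rewrite ler_norml; case: (_ \in _) => /=; apply/andP; split; lra.
Qed.

(** Along the squares the Chebyshev bounds are summable, and between two
consecutive squares the deviation moves by at most the gap. *)
Lemma deviation_cvg : {ae Pr, forall w, (fun n => n%:R^-1 * deviation n w) @ \oo --> (0 : R)}.
Proof.
pose F (l m : nat) := [set w | ((m.+1 ^ 2)%:R / l.+1%:R <= `|deviation (m.+1 ^ 2) w|)%R].
have c0 (l m : nat) : 0 < (m.+1 ^ 2)%:R / l.+1%:R :> R by rewrite divr_gt0// ltr0n expn_gt0.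
have mF l m : measurable (F l m) by exact: measurable_large_deviation.
have FN l : Pr.-negligible (lim_sup_set (F l)).
  apply/negligibleP.
    by apply: bigcap_measurable => // k _; apply: bigcup_measurable => j _.
  apply: lim_sup_set_cvg0 => //.
  apply: (@le_lt_trans _ _ ((l.+1%:R ^+ 2 * 2)%:E)); last exact: ltry.
  apply: lime_le; first exact: is_cvg_nneseries.
  exists 1%N => // -[//|n] _.
  apply: (@le_trans _ _ (\sum_(0 <= m < n.+1) ((l.+1%:R ^+ 2) * (m.+1%:R ^+ 2)^-1)%:E)%E).
    apply: lee_sum => m _; apply: le_trans (chebyshev_deviation _ (c0 l m)) _.
    rewrite lee_fin natrX le_eqVlt; apply/orP; left; apply/eqP.
    have [ml ll] : (m.+1%:R != 0 :> R) /\ (l.+1%:R != 0 :> R) by rewrite !pnatr_eq0.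
    by move: (m.+1%:R : R) (l.+1%:R : R) ml ll => s t s0 t0; field; rewrite s0 t0.
  rewrite sumEFin lee_fin -mulr_sumr ler_wpM2l ?sqr_ge0//.
  by rewrite (le_trans (sum_inverse_squares R n))// gerBl invr_ge0.
have : {ae Pr, forall w, forall l, ~ lim_sup_set (F l) w}.
  apply/ae_foralln => l; apply: negligibleS (FN l) => w /=; exact: contrapT.
apply: filterS => w hw.
apply/cvgrPdist_lt => e e0.
pose l := Num.truncn (2 / e).
have le : l.+1%:R^-1 < e / 2.
  by rewrite invf_plt ?posrE ?divr_gt0// invf_div; exact: truncnS_gt.
have [m0 m0P] : exists m0, forall m, (m0 <= m)%N ->
    `|deviation (m.+1 ^ 2) w| < (m.+1 ^ 2)%:R / l.+1%:R.
  have := hw l; rewrite /lim_sup_set => /existsNP[m0 /not_implyP[_ h]].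
  exists m0 => m mm; rewrite ltNge; apply/negP => h'.
  by apply: h; exists m.
pose m1 := maxn m0 (Num.truncn (4 / e)).
exists (m1.+2 ^ 2)%N => // n /= nm.
have n0 : (0 < n)%N by apply: leq_trans nm; rewrite expn_gt0.
have np : (0 : R) < n%:R by rewrite ltr0n.
have [m /andP[mn nm']] := square_between n0.
have mm : (m1 <= m)%N.
  by have := leq_ltn_trans nm nm'; rewrite ltn_exp2r// !ltnS => /ltnW.
rewrite sub0r normrN normrM ger0_norm ?invr_ge0// ltr_pdivrMl//.
apply: le_lt_trans (deviation_dist w mn) _.
have d1 : `|deviation (m.+1 ^ 2) w| < n%:R * (e / 2).
  apply: (lt_le_trans (m0P _ (leq_trans (leq_maxl _ _) mm))).
  apply: ler_pM => //; [by rewrite ler_nat|exact: ltW].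
have d2 : (n - m.+1 ^ 2)%:R <= n%:R * (e / 2).
  have gap : (n - m.+1 ^ 2 <= 2 * m.+1)%N.
    by move: nm'; rewrite -[m.+2]addn1 sqrnD muln1 exp1n addnAC addn1 ltnS leq_subLR.
  apply: (@le_trans _ _ (2 * m.+1%:R)); first by rewrite -natrM ler_nat.
  have h4 : 4 / e <= m.+1%:R.
    apply: (le_trans (ltW (truncnS_gt (4 / e)))); rewrite ler_nat ltnS.
    by rewrite (leq_trans _ mm)// leq_maxr.
  apply: (@le_trans _ _ (m.+1%:R ^+ 2 * (e / 2))); last first.
    by rewrite ler_wpM2r ?divr_ge0 ?(ltW e0)// -natrX ler_nat.
  move: h4; rewrite ler_pdivrMr//; move: (m.+1%:R : R) (ler0n R m.+1) => t t0 h4.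
  by nra.
rewrite [X in _ < X](_ : _ = n%:R * (e / 2) + n%:R * (e / 2)); last by field.
exact: ltr_leD.
Qed.

End law_of_large_numbers.

Lemma freq_cvg (R : realType) (d : nat) (P : probability 'cV[R]_d R)
    (dO : measure_display) (Omega : measurableType dO) (Pr : probability Omega R)
    (X : nat -> {RV Pr >-> 'cV[R]_d}) (A : set 'cV[R]_d) :
  iid_with X P -> measurable A ->
  {ae Pr, forall w, (fun n => freq (fun j : 'I_n => X j w) A) @ \oo --> prob P A}.
Proof.
move=> [indep distr] mA.
have mB j : measurable (X j @^-1` A).
  by rewrite -[X in measurable X]setTI; apply: measurable_funP.
have PrB j : Pr (X j @^-1` A) = (prob P A)%:E by rewrite -probE// -(distr j).
have PrBB i j : i != j -> Pr (X i @^-1` A `&` X j @^-1` A) = (prob P A * prob P A)%:E.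
  move=> ij; have := indep [fset i; j]%fset (fun=> A) (fun=> mA).
  rewrite big_fsetU1/= ?inE// big_seq_fset1 !PrB EFinM => <-; congr (Pr _).
  apply/seteqP; split => w /=.
    by move=> [wi wj] k; rewrite /= !inE => /orP[] /eqP->.
  by move=> h; split; apply: h; rewrite /= !inE eqxx ?orbT.
have := deviation_cvg mB PrB PrBB; apply: filterS => w h.
have : (fun n => prob P A + n%:R^-1 * deviation (fun j => X j @^-1` A) (prob P A) n w) @ \oo
    --> prob P A + 0 by apply: cvgD => //; exact: cvg_cst.
rewrite addr0; apply: cvg_trans; apply: near_eq_cvg; exists 1%N => // n /= n1.
rewrite /freq /deviation mulrBr mulrA mulVf ?pnatr_eq0 -?lt0n// mul1r addrC subrK.
by congr (_ * _); apply: eq_bigr => j _; congr (nat_of_bool _)%:R; apply/idP/idP; rewrite !inE.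
Qed.

(** * A countable algebra of events *)

(** A [P]-partition for each rational level that [Delta] can exceed gives a countable
family that is cofinal for [Delta]. This reduces the comparison with uncountably
many partitions to events whose frequencies converge simultaneously. *)
Lemma base_events (R : realType) (d : nat) (Sigma : 'M[R]_d) (P : probability 'cV[R]_d R) :
  exists B : nat -> set 'cV[R]_d, [/\ forall i, measurable (B i),
    forall q, exists i, rball q = B i,
    forall i (q : rat), exists l, [set x : 'cV[R]_d | x i 0 < ratr q] = B l &
    forall (q : rat) F, finite_set F -> P_partition P F -> ratr q < Delta P Sigma F ->
      exists F', [/\ finite_set F', P_partition P F', ratr q < Delta P Sigma F' &
        forall G, F' G -> exists i, G = B i]].
Proof.
have /choice[c cP] : forall q : rat, exists c : nat -> set 'cV[R]_d,
    (forall i, measurable (c i)) /\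
    forall F, finite_set F -> P_partition P F -> ratr q < Delta P Sigma F ->
      exists F', [/\ finite_set F', P_partition P F', ratr q < Delta P Sigma F' &
        forall G, F' G -> exists i, G = c i].
  move=> q; have [[F [finF PF qF]]|nF] := pselect (exists F,
      [/\ finite_set F, P_partition P F & ratr q < Delta P Sigma F]); last first.
    by exists (fun=> set0); split=> // F finF PF qF; exfalso; apply: nF; exists F.
  have [m [G [_ FG]]] := finite_set_enum finF.
  exists (fun l => if insub l is Some i then G (i : 'I_m) else set0); split.
    move=> l; case: insubP => // i _ _; have [mF _ _] := PF.
    by apply: mF; rewrite FG; exists i.
  move=> _ _ _ _; exists F; split=> // A; rewrite FG => -[i _ <-].
  by exists i; rewrite valK.
pose I : Type := (('cV[rat]_d * rat) + ('I_d * rat) + (rat * nat))%type.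
pose b (i : I) : set 'cV[R]_d := match i with
  | inl (inl q) => rball q
  | inl (inr (i, q)) => [set x | x i 0 < ratr q]
  | inr (q, l) => c q l
  end.
pose B l := if @choice.unpickle (I : countType) l is Some i then b i else set0.
have bB i : exists l, b i = B l by exists (choice.pickle i); rewrite /B choice.pickleK.
exists B; split.
- move=> l; rewrite /B; case: choice.unpickle => // -[[q|[i q]]|[q i]] /=.
  + exact: measurable_rball.
  + rewrite [X in measurable X](_ : _ = setT `&` (fun x : 'cV[R]_d => x i 0) @^-1` `]-oo, ratr q[).
      by apply: measurable_coord.
    by apply/seteqP; split => x /=; rewrite in_itv//= => -[].
  + by have [] := cP q.
- by move=> q; exact: (bB (inl (inl q))).
- by move=> i q; exact: (bB (inl (inr (i, q)))).
- move=> q F finF PF qF; have [_ /(_ F finF PF qF)[F' [? ? ? h]]] := cP q.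
  exists F'; split=> // G /h[i ->].
  exact: (bB (inr (q, i))).
Qed.

Section determined_events.
Variables (R : realType) (d : nat) (B : nat -> set 'cV[R]_d).
Hypothesis mB : forall i, measurable (B i).

Definition signature k (x : 'cV[R]_d) : {ffun 'I_k -> bool} := [ffun i : 'I_k => x \in B i].

(** Being decided by finitely many of the [B i] characterises the algebra that they
generate, without reference to Boolean expressions. *)
Definition decided k (E : set 'cV[R]_d) : Prop :=
  forall x y, signature k x = signature k y -> E x -> E y.

Definition decidable_event (E : set 'cV[R]_d) : Prop := exists k, decided k E.

Lemma decided_le k l E : (k <= l)%N -> decided k E -> decided l E.
Proof.
move=> kl h x y /ffunP xy; apply: h; apply/ffunP => i.
by have := xy (widen_ord kl i); rewrite !ffunE.
Qed.

Lemma measurable_signature k (t : {ffun 'I_k -> bool}) :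
  measurable [set x | signature k x = t].
Proof.
rewrite (_ : mkset _ = \bigcap_(i in [set: 'I_k]) (if t i then B i else ~` B i)).
  apply: fin_bigcap_measurable => // i _.
  by case: ifP => _; [exact: mB|apply: measurableC].
apply/seteqP; split => [x /= <- i _|x h].
  by rewrite ffunE; case: ifPn => [/set_mem//|/negP xB Bx]; apply: xB; exact: mem_set.
apply/ffunP => i; rewrite ffunE; have := h i Logic.I.
case: (t i) => [|/=] Bx; first exact: mem_set.
exact: memNset.
Qed.

Definition coded_event (c : {k : nat & {set {ffun 'I_k -> bool}}}) : set 'cV[R]_d :=
  [set x | signature (tag c) x \in tagged c].

Lemma measurable_coded_event c : measurable (coded_event c).
Proof.
rewrite (_ : coded_event c = \bigcup_(t in [set` tagged c]) [set x | signature (tag c) x = t]).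
  by apply: fin_bigcup_measurable => // t _; exact: measurable_signature.
apply/seteqP; split => [x xc|x [t /= tc xt]]; first by exists (signature (tag c) x).
by rewrite /coded_event/= xt.
Qed.

Lemma decidable_eventE E : decidable_event E -> exists c, E = coded_event c.
Proof.
move=> [k kE].
exists (existT _ k [set t | `[<exists2 x, signature k x = t & E x>]]%SET).
apply/seteqP; split => x; rewrite /coded_event/= inE.
  by move=> Ex; apply/asboolP; exists x.
by move=> /asboolP[y yx]; exact: kE.
Qed.

Lemma decidable_base i : decidable_event (B i).
Proof.
exists i.+1 => x y /ffunP/(_ ord_max); rewrite !ffunE/= => xy Bx.
by apply/set_mem; rewrite -xy; exact: mem_set.
Qed.

Lemma decidable_event_algebra : (forall q, exists i, rball q = B i) ->
  (forall i (q : rat), exists l, [set x : 'cV[R]_d | x i 0 < ratr q] = B l) ->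
  event_algebra decidable_event.
Proof.
move=> Bball Bslab; split.
- by move=> E /decidable_eventE[c ->]; exact: measurable_coded_event.
- by move=> E [k kE]; exists k => x y xy nEx Ey; apply: nEx; exact: kE (esym xy) Ey.
- move=> E F [k kE] [l lF]; exists (maxn k l) => x y xy [Ex|Fx]; [left|right].
    exact: (decided_le (leq_maxl k l) kE xy).
  exact: (decided_le (leq_maxr k l) lF xy).
- by move=> q; have [i ->] := Bball q; exact: decidable_base.
- move=> i q; have [l /= Bl] := Bslab i q.
  by have := decidable_base l; rewrite -Bl.
Qed.

End determined_events.

(** * Deterministic samples *)

Lemma sum_nth_ge (I : eqType) (i0 : I) (s : seq I) (N : nat) (i : I) : (size s <= N)%N ->
  (count_mem i s <= \sum_(j < N) (nth i0 s j == i))%N.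
Proof.
move=> sN; rewrite -sum1_count -(subnKC sN) big_split_ord/=.
rewrite (leq_trans _ (leq_addr _ _))// big_mkcond (big_nth i0) big_mkord.
by apply: leq_sum => j _; case: (_ == _).
Qed.

(** Rounding the weights down loses less than one unit for each index, and the
units left over can be given away arbitrarily. *)
Lemma rounded_counts (R : realType) (I : finType) (i0 : I) (p : I -> R) (N : nat) :
  (forall i, 0 <= p i) -> \sum_i p i = 1 ->
  exists t : 'I_N -> I, forall i, N%:R * p i - 1 <= \sum_(j < N) (t j == i)%:R.
Proof.
move=> p0 p1; pose c i := Num.truncn (N%:R * p i).
have Np i : 0 <= N%:R * p i by rewrite mulr_ge0.
pose s := flatten [seq nseq (c i) i | i <- enum I].
have cs i : count_mem i s = c i.
  rewrite /s count_flatten -map_comp.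
  rewrite (eq_map (g := fun k => (k == i) * c k)%N); last by move=> k /=; rewrite count_nseq.
  rewrite sumnE big_map big_enum/= (bigD1 i)//= eqxx mul1n big1 ?addn0// => k /negPf->.
  by rewrite mul0n.
have sN : (size s <= N)%N.
  rewrite /s size_flatten /shape -map_comp sumnE big_map big_enum/=.
  have Np1 : \sum_i N%:R * p i = N%:R by rewrite -mulr_sumr p1 mulr1.
  rewrite -(ler_nat R) -Np1 natr_sum; apply: ler_sum => i _.
  by rewrite /= size_nseq /c truncn_le Np.
exists (fun j => nth i0 s j) => i.
apply: (@le_trans _ _ (c i)%:R).
  by rewrite lerBlDr natr1 ltW// truncnS_gt.
by rewrite -natr_sum ler_nat -(cs i) sum_nth_ge.
Qed.

Section quantization.
Variables (R : realType) (d : nat) (P : probability 'cV[R]_d R).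
Variables (B : nat -> set 'cV[R]_d) (mB : forall i, measurable (B i)).
Variables (r : nat) (Sr : forall x, msupport P x -> `|x| <= r%:R).
Local Notation pr := (prob P).

Let atom k (t : {ffun 'I_k -> bool}) : set 'cV[R]_d := [set x | signature B k x = t].

Let matom k t : measurable (@atom k t).
Proof. exact: measurable_signature. Qed.

Let prob_atoms k E : measurable E -> pr E = \sum_t pr (@atom k t `&` E).
Proof.
move=> mE.
rewrite (eq_bigl (mem {:{ffun 'I_k -> bool}}))// big_enum_val/=.
rewrite -prob_bigcup.
- congr pr; apply/seteqP; split => [x Ex|x [i _ []]//].
  exists (enum_rank (signature B k x)) => //; split=> //.
  by rewrite /atom/= enum_rankK.
- by move=> i; exact: measurableI.
- move=> i j ij; apply/seteqP; split => // x [[xi _] [xj _]].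
  by move/eqP: ij; apply; apply: enum_val_inj; rewrite -xi -xj.
Qed.

(** Each atom may cost one observation, that is a share of [1 / (k + 1)] in total. *)
Definition sample_size k := (k.+1 * #|{:{ffun 'I_k -> bool}}|)%N.

Lemma sample_size_ge k : (k < sample_size k)%N.
Proof.
by rewrite /sample_size leq_pmulr//; apply/card_gt0P; exists [ffun=> true].
Qed.

(** The observations are distributed over the atoms of the first [k] base events, in
proportion to their masses. The rounding errors bound each frequency from below,
and from above by passing to the complement. *)
Lemma quantization k : exists x : 'I_(sample_size k) -> 'cV[R]_d,
  (forall j, `|x j| <= r%:R) /\
  forall E, measurable E -> decided B k E -> `|freq x E - pr E| <= k.+1%:R^-1.
Proof.
have /choice[y yP] : forall t : {ffun 'I_k -> bool}, exists y : 'cV[R]_d,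
    `|y| <= r%:R /\ (0 < pr (atom t) -> atom t y).
  move=> t; have [pt|pt] := ltP 0 (pr (atom t)); last by exists 0; rewrite normr0; split.
  have [y [ty Sy]] : atom t `&` msupport P !=set0.
    apply/set0P/eqP => h; have mS : measurable (msupport P).
      by apply: closed_measurable_mx; exact: support_closed.
    have := prob_setI_full (matom t) mS (support_full P).
    by rewrite h /prob measure0 => h'; move: pt; rewrite /prob -h' ltxx.
  by exists y; split=> //; exact: Sr.
have sum1 : \sum_t pr (@atom k t) = 1.
  rewrite -(prob_setT P) (prob_atoms k measurableT).
  by apply: eq_bigr => t _; rewrite setIT.
have [t tP] := rounded_counts [ffun=> true] (sample_size k)
  (fun t => prob_ge0 P (@atom k t)) sum1.
pose N := sample_size k; pose A := #|{:{ffun 'I_k -> bool}}|.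
have N0 : (0 : R) < N%:R by rewrite ltr0n (leq_trans _ (sample_size_ge k)).
have A0 : (0 : R) < A%:R by rewrite ltr0n; apply/card_gt0P; exists [ffun=> true].
pose x (j : 'I_(sample_size k)) := y (t j).
(* The chosen point of a charged atom is in [E] exactly if the whole atom is. *)
have lower E : measurable E -> decided B k E -> pr E - k.+1%:R^-1 <= freq x E.
  move=> mE kE.
  have -> : k.+1%:R^-1 = N%:R^-1 * A%:R :> R.
    by rewrite /N /sample_size natrM invfM -mulrA mulVf ?mulr1// gt_eqF.
  rewrite -(ler_pM2l N0) /freq mulrA mulfV ?gt_eqF// mul1r mulrBr mulrA mulfV ?gt_eqF// mul1r.
  rewrite (prob_atoms k mE) mulr_sumr.
  have -> : A%:R = \sum_(s : {ffun 'I_k -> bool}) 1 :> R by rewrite sumr_const.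
  rewrite -sumrB.
  have -> : \sum_(j < sample_size k) (x j \in E)%:R =
      \sum_s \sum_(j < sample_size k) (t j == s)%:R * (y s \in E)%:R :> R.
    rewrite exchange_big/=; apply: eq_bigr => j _.
    rewrite (bigD1 (t j))//= eqxx mul1r big1 ?addr0// => s.
    by rewrite eq_sym => /negPf->; rewrite mul0r.
  apply: ler_sum => s _; rewrite -mulr_suml.
  have [_ ys] := yP s.
  have nonneg : 0 <= (\sum_(j < sample_size k) (t j == s)%:R) * (y s \in E)%:R :> R.
    by rewrite mulr_ge0// sumr_ge0.
  have [ps|ps] := ltP 0 (pr (atom s)); last first.
    rewrite (_ : pr (atom s `&` E) = 0) ?mulr0 ?sub0r; first by rewrite (le_trans _ nonneg)// lerN10.
    apply/eqP; rewrite eq_le prob_ge0 andbT (le_trans _ ps)//.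
    by apply: prob_le => //; apply: measurableI.
  have sy := ys ps.
  have [yE|yE] := pselect (E (y s)).
    rewrite mem_set// mulr1 (le_trans _ (tP s))// lerB// ler_wpM2l ?(ltW N0)//.
    by apply: prob_le => //; apply: measurableI.
  rewrite (_ : _ `&` E = set0) ?/prob ?measure0 ?mulr0 ?sub0r.
    by rewrite (le_trans _ nonneg)// lerN10.
  apply/seteqP; split => // z [sz Ez]; apply: yE; apply: kE Ez.
  by rewrite sz sy.
exists x; split; first by move=> j; have [] := yP (t j).
move=> E mE kE; have l1 := lower E mE kE.
have := lower (~` E) (measurableC mE); have -> : freq x (~` E) = 1 - freq x E.
  have Nn0 : N%:R != 0 :> R by rewrite gt_eqF.
  apply: (mulfI Nn0); rewrite mulrBr mulr1 /freq !mulrA mulfV// !mul1r.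
  have -> : N%:R = \sum_(j < sample_size k) 1 :> R by rewrite sumr_const card_ord.
  rewrite -sumrB; apply: eq_bigr => j _; rewrite in_setC.
  by case: (_ \in _); rewrite /= ?subrr ?subr0.
rewrite prob_setC// => l2.
have {}l2 := l2 (fun u v uv nEu Ev => nEu (kE _ _ (esym uv) Ev)).
move: l1 l2; move: (k.+1%:R^-1) (freq x E) (pr E) => c f q l1 l2.
by rewrite ler_norml; apply/andP; split; lra.
Qed.

End quantization.

(** * Maximisers and almost sure convergence *)

Section convergence.
Variables (R : realType) (d : nat) (alpha : R) (T Sigma : 'M[R]_d).
Hypotheses (d_ge1 : (1 <= d)%N) (alpha_gt0 : 0 < alpha).
Hypotheses (pT : posdefmx T) (pS : posdefmx Sigma).
Variable P : probability 'cV[R]_d R.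
Hypotheses (P_bounded : bounded_set (msupport P)).
Hypotheses (P_ac : P `<< @lebesgue_vector R d).
Variables (r : nat) (Sr : forall y, msupport P y -> `|y| <= r%:R).
Variables (B : nat -> set 'cV[R]_d) (mB : forall i, measurable (B i)).
Hypothesis Bball : forall q, exists i, rball q = B i.
Hypothesis Bslab : forall i (q : rat), exists l, [set x : 'cV[R]_d | x i 0 < ratr q] = B l.
Hypothesis Bcofinal : forall (q : rat) F, finite_set F -> P_partition P F ->
  ratr q < Delta P Sigma F ->
  exists F', [/\ finite_set F', P_partition P F', ratr q < Delta P Sigma F' &
    forall G, F' G -> exists i, G = B i].

(** A partition with a larger [Delta] would leave room for a rational number, hence
for a partition of the cofinal family with a larger [Delta]. *)
Lemma MAP_limit_maximal (U : set_system nat) (UU : UltraFilter U) (n : nat -> nat)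
    (x : forall k, 'I_(n k) -> 'cV[R]_d) (JJ : forall k, {set {set 'I_(n k)}}) :
  (forall k j, `|x k j| <= r%:R) -> (forall m, U [set k | (m <= n k)%N]) ->
  (forall E, decidable_event B E -> (fun k => freq (x k) E) @ U --> prob P E) ->
  (forall k, MAP_partition alpha T Sigma (x k) (JJ k)) ->
  exists2 M, maximal_partitions P Sigma M &
    forall e, 0 < e -> U [set k | dbar_P P (cluster_hulls (x k) (JJ k)) M < e].
Proof.
move=> xr n_oo Efreq mapJJ.
have EA := decidable_event_algebra mB Bball Bslab.
have [M [finM PM maxM cvgM]] := MAP_limit d_ge1 alpha_gt0 pT pS P_bounded P_ac UU xr Sr
  n_oo EA Efreq mapJJ.
exists M => //; split=> // F finF PF; rewrite leNgt; apply/negP => MF.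
have [q] := rat_in_itvoo MF; rewrite in_itv/= => /andP[Mq qF].
have [F' [finF' PF' qF' F'B]] := Bcofinal finF PF qF.
have := maxM F' finF' PF'; rewrite leNgt => /(_ _)/negP; apply; last exact: lt_trans qF'.
by move=> G /F'B[i ->]; exact: decidable_base.
Qed.

Lemma MAP_partition_exists n (x : 'I_n -> 'cV[R]_d) :
  exists JJ, MAP_partition alpha T Sigma x JJ.
Proof.
pose isp (JJ : {set {set 'I_n}}) := finset.partition JJ [set: 'I_n]%SET.
have p0 : isp (preim_partition (fun=> tt) [set: 'I_n]%SET) by exact: preim_partitionP.
exists [arg max_(JJ > preim_partition (fun=> tt) [set: 'I_n]%SET | isp JJ)
  posterior alpha T Sigma x JJ]%O.
by case: Order.TotalTheory.arg_maxP => // JJ pJJ maxJJ; split.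
Qed.

(** A maximiser is found as a limit of the MAP partitions of deterministic samples. *)
Lemma maximal_partitions_nonempty : maximal_partitions P Sigma !=set0.
Proof.
have [U [UU ooU]] := ultraFilterLemma (eventually_filter : ProperFilter \oo).
pose x k := projT1 (cid (quantization mB Sr k)).
have xP k : (forall j, `|x k j| <= r%:R) /\ forall E, measurable E -> decided B k E ->
    `|freq (x k) E - prob P E| <= k.+1%:R^-1 := projT2 (cid (quantization mB Sr k)).
pose JJ k := projT1 (cid (MAP_partition_exists (x k))).
have JJP k : MAP_partition alpha T Sigma (x k) (JJ k) := projT2 (cid (MAP_partition_exists (x k))).
have [||||M] := MAP_limit_maximal UU (n := sample_size) (x := x) (JJ := JJ); last by exists M.
- by move=> k j; have [] := xP k.
- move=> m; apply: ooU; exists m => // k /= mk.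
  by rewrite (leq_trans mk)// ltnW// sample_size_ge.
- move=> E [l lE]; apply: (cvg_trans (G := (fun k => freq (x k) E) @ \oo)).
    by move=> A /= /ooU.
  have mE : measurable E.
    have [+ _ _ _ _] := decidable_event_algebra mB Bball Bslab; apply.
    by exists l.
  apply/cvgrPdist_lt => e e0; exists (maxn l (Num.truncn e^-1)) => // k /=.
  rewrite geq_max => /andP[lk ek].
  rewrite distrC; have [_ /(_ _ mE (decided_le lk lE))] := xP k.
  move=> /le_lt_trans; apply; rewrite invf_plt ?posrE//.
  by rewrite (lt_le_trans (truncnS_gt _))// ler_nat ltnS.
- exact: JJP.
Qed.

(** An ultrafilter that contains the indices at which the distance exceeds [e] would
produce a maximiser that the hulls approach along these indices. *)
Lemma MAP_cvg (x : nat -> 'cV[R]_d) (JJ : forall n, {set {set 'I_n}}) :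
  (forall j, `|x j| <= r%:R) ->
  (forall E, decidable_event B E ->
    (fun n => freq (fun j : 'I_n => x j) E) @ \oo --> prob P E) ->
  (forall n, MAP_partition alpha T Sigma (fun j : 'I_n => x j) (JJ n)) ->
  (fun n => inf [set dbar_P P (cluster_hulls (fun j : 'I_n => x j) (JJ n)) M
               | M in maximal_partitions P Sigma]) @ \oo --> (0 : R).
Proof.
move=> xr Efreq mapJJ.
set u := fun n => inf _.
apply/cvgrPdist_lt => e e0; apply: contrapT => bad.
pose D := ~` [set n | `|0 - u n| < e].
have FD : ProperFilter (within D \oo).
  apply: Build_ProperFilter_ex => A DA; apply: contrapT => A0; apply: bad.
  have {}DA : \forall n \near \oo, D n -> A n := DA.
  apply: filterS DA => n /= nA; apply: contrapT => Dn; apply: A0; exists n; exact: nA.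
have [U [UU subU]] := ultraFilterLemma FD.
have ooU A : \oo A -> U A.
  move=> ooA; apply: subU.
  by have : \forall n \near \oo, D n -> A n by apply: filterS ooA => n.
have UD : U D by apply: subU; exact: withinT.
have [||||M maxM cvgM] := MAP_limit_maximal UU (n := id) (x := fun n (j : 'I_n) => x j) (JJ := JJ).
- by [].
- by move=> m; apply: ooU; exists m.
- by move=> E /Efreq; apply: cvg_trans => A /= /ooU.
- exact: mapJJ.
have [n [Dn dn]] := @filter_ex _ U _ _ (filterI UD (cvgM _ e0)).
apply: Dn; rewrite /= sub0r normrN.
have S0 : lbound [set dbar_P P (cluster_hulls (fun j : 'I_n => x j) (JJ n)) M
               | M in maximal_partitions P Sigma] 0.
  by move=> _ [M' _ <-]; exact: dbar_ge0.
rewrite ger0_norm /u; last by apply: lb_le_inf => //; eexists; exists M.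
apply: le_lt_trans dn; apply: ge_inf; last by exists M.
by exists 0.
Qed.

End convergence.

(** The algebra is countable, so the exceptional sets of the laws of large numbers
add up to a null set. *)
Lemma typical_sample (R : realType) (d : nat) (P : probability 'cV[R]_d R)
    (dO : measure_display) (Omega : measurableType dO) (Pr : probability Omega R)
    (X : nat -> {RV Pr >-> 'cV[R]_d}) (B : nat -> set 'cV[R]_d) :
  iid_with X P -> (forall i, measurable (B i)) ->
  {ae Pr, forall w, (forall j, msupport P (X j w)) /\
    forall E, decidable_event B E ->
      (fun n => freq (fun j : 'I_n => X j w) E) @ \oo --> prob P E}.
Proof.
move=> iidX mB.
have supp : {ae Pr, forall w, forall j, msupport P (X j w)}.
  apply/ae_foralln => j; have [_ distr] := iidX.
  have mS : measurable (msupport P).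
    by apply: closed_measurable_mx; exact: support_closed.
  have mSC := measurableC mS.
  apply: (@negligibleS _ _ _ _ (X j @^-1` ~` msupport P)) => //; apply/negligibleP.
    by rewrite -[X in measurable X]setTI; apply: measurable_funP.
  have := distr j _ (measurableC mS); rewrite /distribution /pushforward => h.
  apply: etrans h _.
  exact: (measure_negligible (measurableC mS) (support_full P)).
have freqs : {ae Pr, forall w, forall l,
    if choice.unpickle l is Some c then
      (fun n => freq (fun j : 'I_n => X j w) (coded_event B c)) @ \oo -->
        prob P (coded_event B c) else True}.
  apply/ae_foralln => l; case: choice.unpickle => [c|]; last exact: aeW.
  by apply: freq_cvg => //; exact: measurable_coded_event.
apply: filterS2 supp freqs => w ws wf; split=> // E /decidable_eventE[c ->].
by have := wf (choice.pickle c); rewrite choice.pickleK.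
Qed.

Theorem proposition3 (R : realType) (d : nat) (d_ge1 : (1 <= d)%N)
    (alpha : R) (alpha_gt0 : 0 < alpha)
    (T Sigma : 'M[R]_d) (T_posdef : posdefmx T) (Sigma_posdef : posdefmx Sigma)
    (P : probability 'cV[R]_d R)
    (P_bounded : bounded_set (msupport P))
    (P_ac : P `<< @lebesgue_vector R d) :
  maximal_partitions P Sigma !=set0 /\
  forall (dO : measure_display) (Omega : measurableType dO)
    (Pr : probability Omega R) (X : nat -> {RV Pr >-> 'cV[R]_d})
    (Jhat : forall n : nat, Omega -> {set {set 'I_n}}),
    iid_with X P ->
    (forall (n : nat) (w : Omega),
      MAP_partition alpha T Sigma (fun j : 'I_n => X j w) (Jhat n w)) ->
    {ae Pr, forall w,
      (fun n : nat =>
         inf [set dbar_P P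
                    (cluster_hulls (fun j : 'I_n => X j w) (Jhat n w)) M
               | M in maximal_partitions P Sigma])
        @ \oo --> (0 : R)}.
Proof.
have [r r0 Sr] := support_bound P_bounded.
have [B [mB Bball Bslab Bcofinal]] := base_events Sigma P.
split.
  exact: (maximal_partitions_nonempty d_ge1 alpha_gt0 T_posdef Sigma_posdef P_bounded P_ac
    Sr mB Bball Bslab Bcofinal).
move=> dO Omega Pr X Jhat iidX mapJ.
apply: filterS (typical_sample iidX mB) => w [ws wf].
exact: (MAP_cvg d_ge1 alpha_gt0 T_posdef Sigma_posdef P_bounded P_ac Sr mB Bball Bslab
  Bcofinal (x := fun j => X j w) (JJ := fun n => Jhat n w)
  (fun j => Sr _ (ws j)) wf (fun n => mapJ n w)).
Qed.
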